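(* Let $V_5$ be a five-dimensional complex vector space, let $F=F(2,3,V_5)$ with projections $p:F\to G(2,V_5)$ and $q:F\to G(3,V_5)$, and let $s$ be a generic section of $\mathcal O(1,1)$ on $F$. Put $X=Z(p_*s)$ and $Y=Z(q_*s)$. Then in the Grothendieck ring of varieties $$([X]-[Y])\,\mathbb L^2=0,$$ where $\mathbb L$ is the class of the affine line.
   Context: The base field is $\mathbb C$. $G(k,V_5)$ is the Grassmannian of $k$-dimensional subspaces of $V_5$, with universal bundle $\mathcal U_k$ and universal quotient bundle $\mathcal Q_k$; $\mathcal O(1)$ is the Plücker hyperplane bundle. $F=\{([V],[W])\in G(2,V_5)\times G(3,V_5): V\subset W\}$, and $\mathcal O(1,1)=p^*\mathcal O(1)\otimes q^*\mathcal O(1)$. One has $p_*\mathcal O(1,1)=\mathcal Q_2^\vee(2)$ and $q_*\mathcal O(1,1)=\mathcal U_3(2)$; $p_*s$ and $q_*s$ denote the sections of these bundles corresponding to $s$. $Z(\cdot)$ denotes the zero locus. *)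

(* Defs.v *)
From HB Require Import structures.
From mathcomp Require Import all_boot all_order all_algebra.
From mathcomp Require Import mpoly.
From mathcomp Require Import boolp classical_sets functions cardinality reals.
From mathcomp Require Import complex.
From Stdlib Require Ring_theory.
Set Implicit Arguments.
Unset Strict Implicit.
Unset Printing Implicit Defensive.
Import GRing.Theory passmx.
Local Open Scope ring_scope.
Local Open Scope classical_set_scope.

(* Closed, open and regular are always relative to a coordinate map
   c : T -> K^n: they are the notions on the image c @` W, pulled back to W. *)
Section Zariski.
Variable K : fieldType.

Definition algebraic_set n (S : set {mpoly K[n]}) : set 'rV[K]_n :=
  [set x | forall p, S p -> p.@[x 0] = 0].

Definition locally_closed n (W : set 'rV[K]_n) :=
  exists S1 S2, W = algebraic_set S1 `\` algebraic_set S2.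

Definition closed_in T n (c : T -> 'rV[K]_n) (W Z : set T) :=
  exists S, Z = W `&` c @^-1` algebraic_set S.

Definition open_in T n (c : T -> 'rV[K]_n) (W U : set T) :=
  U `<=` W /\ closed_in c W (W `\` U).

Definition regular_on T n (c : T -> 'rV[K]_n) (W : set T) (f : T -> K) :=
  forall x, W x -> exists P Q : {mpoly K[n]}, Q.@[c x 0] != 0 /\
    forall y, W y -> Q.@[c y 0] != 0 -> f y = P.@[c y 0] / Q.@[c y 0].

Definition regular_map_on T n m (c : T -> 'rV[K]_n) (W : set T)
    (g : T -> 'rV[K]_m) :=
  forall k, regular_on c W (fun x => g x 0 k).

Lemma algebraic_setI n (S1 S2 : set {mpoly K[n]}) :
  algebraic_set S1 `&` algebraic_set S2 = algebraic_set (S1 `|` S2).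
Proof.
apply/seteqP; split=> x /=; first by move=> [h1 h2] p [/h1|/h2].
by move=> h; split=> p Sp; apply: h; [left|right].
Qed.

Lemma algebraic_setU n (S1 S2 : set {mpoly K[n]}) :
  algebraic_set S1 `|` algebraic_set S2 =
  algebraic_set [set r | exists p q, [/\ S1 p, S2 q & r = p * q]].
Proof.
apply/seteqP; split=> x /=.
  by move=> [h|h] _ [p [q [Sp Sq ->]]]; rewrite mevalM;
      [rewrite (h p)// mul0r|rewrite (h q)// mulr0].
move=> h; case: (pselect (algebraic_set S1 x)) => [?|]; first by left.
move=> /existsNP[p] /not_implyP[Sp /eqP px]; right=> q Sq.
have /eqP := h (p * q) (ex_intro _ p (ex_intro _ q (And3 Sp Sq erefl))).
by rewrite mevalM mulf_eq0 (negPf px) => /eqP.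
Qed.

Lemma algebraic_set_set0 n : algebraic_set (set0 : set {mpoly K[n]}) = setT.
Proof. by apply/seteqP; split=> x // _ p []. Qed.

Lemma locally_closedI n (W1 W2 : set 'rV[K]_n) :
  locally_closed W1 -> locally_closed W2 -> locally_closed (W1 `&` W2).
Proof.
move=> [S1 [S2 ->]] [S3 [S4 ->]].
have [S eS] : exists S, algebraic_set S2 `|` algebraic_set S4 = algebraic_set S.
  by rewrite algebraic_setU; eexists.
exists (S1 `|` S3), S; rewrite -algebraic_setI -eS.
apply/seteqP; split=> x /=; first by move=> [[? ?] [? ?]]; split=> // -[].
by move=> [[? ?] /not_orP[]].
Qed.

Lemma algebraic_set1 n : algebraic_set [set 1 : {mpoly K[n]}] = set0.
Proof.
by apply/seteqP; split=> x //= /(_ 1 erefl) /eqP; rewrite meval1 oner_eq0.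
Qed.

Lemma locally_closed_algebraic n (S : set {mpoly K[n]}) :
  locally_closed (algebraic_set S).
Proof.
by exists S, [set 1]; rewrite algebraic_set1 setD0.
Qed.

Lemma open_inP T n (c : T -> 'rV[K]_n) (W U : set T) :
  open_in c W U <-> U `<=` W /\ forall x, U x -> exists Q : {mpoly K[n]},
    Q.@[c x 0] != 0 /\ forall y, W y -> Q.@[c y 0] != 0 -> U y.
Proof.
split=> -[UW h]; split=> //.
  case: h => S eS x Ux.
  have : ~ (W `&` c @^-1` algebraic_set S) x by rewrite -eS => -[].
  move=> /not_andP[/(_ (UW _ Ux))//|/existsNP[Q] /not_implyP[SQ /eqP Qx]].
  exists Q; split=> // y Wy Qy; apply: contrapT => Uy.
  have : (W `\` U) y by []. 
  by rewrite eS => -[_ /(_ _ SQ)] /eqP; rewrite (negPf Qy).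
exists [set Q | forall y, W y -> Q.@[c y 0] != 0 -> U y].
apply/seteqP; split=> x /=.
  move=> [Wx Ux]; split=> // Q hQ; apply/eqP; apply/negPn/negP => Qx.
  by apply: Ux; exact: hQ.
move=> [Wx hx]; split=> // Ux; have [Q [Qx hQ]] := h _ Ux.
by move: (hx Q hQ) => /eqP; rewrite (negPf Qx).
Qed.

Lemma open_in_refl T n (c : T -> 'rV[K]_n) (W : set T) : open_in c W W.
Proof. by apply/open_inP; split=> // x Wx; exists 1; rewrite meval1 oner_eq0. Qed.

Lemma closed_inP T n (c : T -> 'rV[K]_n) (W Z : set T) :
  Z `<=` W -> closed_in c W Z <-> open_in c W (W `\` Z).
Proof.
by move=> ZW; rewrite /open_in setDD (setIidr ZW); split=> [h|[]//]; split=> // x [].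
Qed.

Definition polyfun T n (c : T -> 'rV[K]_n) (f : T -> K) :=
  exists p : {mpoly K[n]}, forall x, f x = p.@[c x 0].

Section Polyfun.
Variables (T : Type) (n : nat) (c : T -> 'rV[K]_n).

Lemma polyfunC a : polyfun c (fun=> a).
Proof. by exists a%:MP => x; rewrite mevalC. Qed.

Lemma polyfunX i : polyfun c (fun x => c x 0 i).
Proof. by exists 'X_i => x; rewrite mevalXU. Qed.

Lemma polyfunD f g : polyfun c f -> polyfun c g -> polyfun c (fun x => f x + g x).
Proof. by move=> [p hp] [q hq]; exists (p + q) => x; rewrite mevalD hp hq. Qed.

Lemma polyfunM f g : polyfun c f -> polyfun c g -> polyfun c (fun x => f x * g x).
Proof. by move=> [p hp] [q hq]; exists (p * q) => x; rewrite mevalM hp hq. Qed.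

Lemma polyfunN f : polyfun c f -> polyfun c (fun x => - f x).
Proof. by move=> [p hp]; exists (- p) => x; rewrite mevalN hp. Qed.

Lemma polyfun_sum I (r : seq I) (P : pred I) (F : I -> T -> K) :
  (forall i, polyfun c (F i)) -> polyfun c (fun x => \sum_(i <- r | P i) F i x).
Proof.
move=> hF; elim: r => [|i r IH]; first by under eq_fun do rewrite big_nil; exact: polyfunC.
under eq_fun do rewrite big_cons; case: (P i) => //; exact: polyfunD.
Qed.

Lemma polyfun_prod I (r : seq I) (P : pred I) (F : I -> T -> K) :
  (forall i, polyfun c (F i)) -> polyfun c (fun x => \prod_(i <- r | P i) F i x).
Proof.
move=> hF; elim: r => [|i r IH]; first by under eq_fun do rewrite big_nil; exact: polyfunC.
under eq_fun do rewrite big_cons; case: (P i) => //; exact: polyfunM.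
Qed.

Definition polymx m k (A : T -> 'M[K]_(m, k)) := forall i j, polyfun c (fun x => A x i j).

Lemma polymxC m k (A : 'M[K]_(m, k)) : polymx (fun=> A).
Proof. by move=> i j; exact: polyfunC. Qed.

Lemma polymxM m k l (A : T -> 'M[K]_(m, k)) (B : T -> 'M[K]_(k, l)) :
  polymx A -> polymx B -> polymx (fun x => A x *m B x).
Proof.
move=> hA hB i j; under eq_fun do rewrite mxE.
by apply: polyfun_sum => k'; exact: polyfunM.
Qed.

Lemma polymx_col m1 m2 k (A : T -> 'M[K]_(m1, k)) (B : T -> 'M[K]_(m2, k)) :
  polymx A -> polymx B -> polymx (fun x => col_mx (A x) (B x)).
Proof.
move=> hA hB i j; case: (split_ordP i) => i' ->.
  by under eq_fun do rewrite col_mxEu; exact: hA.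
by under eq_fun do rewrite col_mxEd; exact: hB.
Qed.

Lemma polymx_row m k1 k2 (A : T -> 'M[K]_(m, k1)) (B : T -> 'M[K]_(m, k2)) :
  polymx A -> polymx B -> polymx (fun x => row_mx (A x) (B x)).
Proof.
move=> hA hB i j; case: (split_ordP j) => j' ->.
  by under eq_fun do rewrite row_mxEl; exact: hA.
by under eq_fun do rewrite row_mxEr; exact: hB.
Qed.

Lemma polymx_sub m k m' k' (f : 'I_m' -> 'I_m) (g : 'I_k' -> 'I_k) (A : T -> 'M[K]_(m, k)) :
  polymx A -> polymx (fun x => mxsub f g (A x)).
Proof. by move=> hA i j; under eq_fun do rewrite mxE; exact: hA. Qed.

Lemma polymx_mxvec m k (A : T -> 'M[K]_(m, k)) :
  polymx A -> polymx (fun x => mxvec (A x)).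
Proof.
move=> hA i j; case/mxvec_indexP: j => i' j'.
by rewrite ord1; under eq_fun do rewrite mxvecE; exact: hA.
Qed.

Lemma polyfun_det m (A : T -> 'M[K]_m) :
  polymx A -> polyfun c (fun x => \det (A x)).
Proof.
move=> hA; apply: polyfun_sum => s; apply: polyfunM; first exact: polyfunC.
by apply: polyfun_prod => i; exact: hA.
Qed.

Lemma polymx_adj m (A : T -> 'M[K]_m) :
  polymx A -> polymx (fun x => \adj (A x)).
Proof.
move=> hA i j; under eq_fun do rewrite mxE.
apply: polyfunM; first exact: polyfunC; apply: polyfun_det => i' j'.
by under eq_fun do rewrite !mxE; exact: hA.
Qed.

End Polyfun.

Lemma polyfun_comp T n m (c : T -> 'rV[K]_n) (d : T -> 'rV[K]_m) f :
  polymx c d -> polyfun d f -> polyfun c f.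
Proof.
move=> hd [p hp]; have /choice[P hP] : forall k, exists q : {mpoly K[n]}, forall x, d x 0 k = q.@[c x 0].
  by move=> k; exact: hd.
exists (p \mPo [tuple P k | k < m]) => x; rewrite comp_mpoly_meval hp.
by apply: meval_eq => k; rewrite tnth_mktuple hP.
Qed.

Section Change.
Variables (T T' : Type) (n m : nat) (c : T -> 'rV[K]_n) (d : T' -> 'rV[K]_m).
Variables (h : T -> T') (W : set T) (W' : set T').
Hypotheses (hc : polymx c (d \o h)) (hW : forall x, W x -> W' (h x)).

Lemma poly_pull (p : {mpoly K[m]}) :
  exists q : {mpoly K[n]}, forall x, p.@[d (h x) 0] = q.@[c x 0].
Proof. by apply: (polyfun_comp hc); exists p. Qed.

Lemma closed_in_pull Z : closed_in d W' Z -> closed_in c W (W `&` h @^-1` Z).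
Proof.
move=> [S ->]; exists [set q | exists2 p, S p & forall x, p.@[d (h x) 0] = q.@[c x 0]].
apply/seteqP; split=> x [Wx hx]; split=> //=.
  by move=> q [p Sp <-]; case: hx => _ /(_ p Sp).
split; first exact: hW.
move=> p Sp; have [q hq] := poly_pull p; rewrite hq; apply: hx.
by exists p.
Qed.

Lemma open_in_pull U : open_in d W' U -> open_in c W (W `&` h @^-1` U).
Proof.
move=> [UW /closed_in_pull hU]; split=> [x []//|].
congr (closed_in c W _): hU; apply/seteqP; split=> x /=.
  by move=> [Wx [_ Ux]]; split=> // -[].
by move=> [Wx Ux]; split=> //; split; [exact: hW|move=> ?; apply: Ux].
Qed.

Lemma regular_on_pull f : regular_on d W' f -> regular_on c W (f \o h).
Proof.
move=> hf x Wx; have [P [Q [Qx hPQ]]] := hf _ (hW Wx).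
have [P' hP'] := poly_pull P; have [Q' hQ'] := poly_pull Q.
exists P', Q'; rewrite -hQ'; split=> // y Wy; rewrite -hQ' -hP' => Qy.
by rewrite /= hPQ //; exact: hW.
Qed.

End Change.

Section Regular.
Variables (T : Type) (n : nat) (c : T -> 'rV[K]_n).

Lemma regular_on_sub W W' f : W `<=` W' -> regular_on c W' f -> regular_on c W f.
Proof.
move=> WW' h x /WW' /h [P [Q [Qx hPQ]]]; exists P, Q; split=> // y /WW'.
exact: hPQ.
Qed.

Lemma eq_regular_on W f g : (forall x, W x -> f x = g x) ->
  regular_on c W f -> regular_on c W g.
Proof.
by move=> fg h x /h [P [Q [Qx hPQ]]]; exists P, Q; split=> // y Wy /hPQ <-//; rewrite fg.
Qed.

Lemma regular_on_polyfun W f : polyfun c f -> regular_on c W f.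
Proof.
by move=> [p hp] x Wx; exists p, 1; rewrite meval1 oner_eq0; split=> // y _ _; rewrite meval1 divr1.
Qed.

Lemma regular_on_div W f g : polyfun c f -> polyfun c g ->
  (forall x, W x -> g x != 0) -> regular_on c W (fun x => f x / g x).
Proof.
move=> [p hp] [q hq] g0 x Wx; exists p, q; rewrite -hq; split; first exact: g0.
by move=> y Wy _; rewrite -hp -hq.
Qed.

Lemma regular_onD W f g : regular_on c W f -> regular_on c W g ->
  regular_on c W (fun x => f x + g x).
Proof.
move=> hf hg x Wx; have [P [Q [Qx hPQ]]] := hf _ Wx; have [R [S [Sx hRS]]] := hg _ Wx.
exists (P * S + R * Q), (Q * S); rewrite mevalM mulf_neq0//; split=> // y Wy.
rewrite !(mevalM, mevalD) mulf_eq0 negb_or => /andP[Qy Sy].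
by rewrite hPQ // hRS // addf_div.
Qed.

Lemma regular_onM W f g : regular_on c W f -> regular_on c W g ->
  regular_on c W (fun x => f x * g x).
Proof.
move=> hf hg x Wx; have [P [Q [Qx hPQ]]] := hf _ Wx; have [R [S [Sx hRS]]] := hg _ Wx.
exists (P * R), (Q * S); rewrite mevalM mulf_neq0//; split=> // y Wy.
rewrite !mevalM mulf_eq0 negb_or => /andP[Qy Sy].
by rewrite hPQ // hRS // mulf_div.
Qed.

Lemma regular_on_sum W I (r : seq I) (F : I -> T -> K) :
  (forall i, regular_on c W (F i)) -> regular_on c W (fun x => \sum_(i <- r) F i x).
Proof.
move=> hF; elim: r => [|i r IH].
  by under eq_fun do rewrite big_nil; apply: regular_on_polyfun; exact: polyfunC.
by under eq_fun do rewrite big_cons; exact: regular_onD.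
Qed.

Lemma closed_in_bigcap W I (Z : I -> set T) :
  (forall i, closed_in c W (Z i)) -> closed_in c W (W `&` [set x | forall i, Z i x]).
Proof.
move=> /choice[S hS]; exists [set p | exists i, S i p].
apply/seteqP; split=> x [Wx hx]; split=> //.
  by move=> p [i Sp]; have := hx i; rewrite hS => -[_ /(_ p Sp)].
by move=> i; rewrite hS; split=> // p Sp; apply: hx; exists i.
Qed.

Lemma closed_in_zero W O f : open_in c W O -> regular_on c O f ->
  (forall x, W x -> ~ O x -> f x = 0) ->
  closed_in c W (W `&` [set x | f x = 0]).
Proof.
move=> /open_inP[OW hO] hf f0; apply/closed_inP => [x []//|]; apply/open_inP; split=> [x []//|].
move=> x [Wx nx]; have fx : f x != 0 by apply/eqP => fx; apply: nx.
have Ox : O x by apply: contrapT => /(f0 _ Wx) /eqP; rewrite (negPf fx).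
have [Q [Qx hQ]] := hO _ Ox; have [P [R [Rx hPR]]] := hf _ Ox.
have Px : P.@[c x 0] != 0.
  by apply: contraNneq fx => Px; rewrite (hPR _ Ox Rx) Px mul0r.
exists (Q * P * R); rewrite !mevalM !mulf_neq0 //; split=> // y Wy.
rewrite !mevalM !mulf_eq0 !negb_or => /andP[/andP[Qy Py] Ry]; split=> // -[_] /= /eqP.
by rewrite (hPR _ (hQ _ Wy Qy) Ry) mulf_eq0 invr_eq0 (negPf Py) (negPf Ry).
Qed.

Lemma closed_in_polymx0 W m k (D : T -> 'M[K]_(m, k)) :
  polymx c D -> closed_in c W (W `&` [set x | D x = 0]).
Proof.
move=> hD; exists [set p | exists i j, forall x, D x i j = p.@[c x 0]].
apply/seteqP; split=> x [Wx hx]; split=> //.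
  by move=> p [i [j <-]]; rewrite hx mxE.
apply/matrixP => i j; have [p hp] := hD i j; rewrite mxE hp; apply: hx.
by exists i, j.
Qed.

End Regular.
End Zariski.

(* Abstract varieties in the sense of Weil and Serre: reduced separated
   schemes of finite type, described by their closed points.  [coord i] embeds
   the affine chart [dom i] as a locally closed subset of K^(chart_dim i); it
   is junk outside [dom i].  The two chart axioms say that the Zariski
   structures of the charts agree on overlaps, the last one that the diagonal
   is closed. *)
Record variety (K : closedFieldType) := Variety {
  point :> Type;
  chart : Type;
  chart_dim : chart -> nat;
  dom : chart -> set point;
  coord : forall i, point -> 'rV[K]_(chart_dim i);
  chart_finite : finite_set [set: chart];
  dom_cover : forall x, exists i, dom i x;
  coord_inj : forall i x y, dom i x -> dom i y -> coord i x = coord i y -> x = y;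
  coord_locally_closed : forall i, locally_closed (coord i @` dom i);
  dom_open : forall i j, open_in (coord i) (dom i) (dom i `&` dom j);
  coord_regular : forall i j,
    regular_map_on (coord i) (dom i `&` dom j) (coord j);
  separated : forall i j,
    closed_in (fun p => row_mx (coord i p.1) (coord j p.2)) (dom i `*` dom j)
      [set p | (dom i `*` dom j) p /\ p.1 = p.2]
}.
Arguments dom {K} v i _.
Arguments coord {K} v i _.

Section Varieties.
Variable K : closedFieldType.

Definition vclosed (X : variety K) (Z : set X) :=
  forall i, closed_in (coord X i) (dom X i) (dom X i `&` Z).

Definition vopen (X : variety K) (U : set X) := vclosed (~` U).

Definition vlocally_closed (X : variety K) (W : set X) :=
  exists U Z, [/\ vopen U, vclosed Z & W = U `&` Z].

Definition vmorphism (X Y : variety K) (f : X -> Y) := forall i j,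
  open_in (coord X i) (dom X i) (dom X i `&` f @^-1` dom Y j) /\
  regular_map_on (coord X i) (dom X i `&` f @^-1` dom Y j) (coord Y j \o f).

Definition visomorphic (X Y : variety K) :=
  exists (f : X -> Y) (g : Y -> X),
    [/\ vmorphism f, vmorphism g, cancel f g & cancel g f].

Lemma vclosedT (X : variety K) : vclosed [set: X].
Proof.
move=> i; exists set0; rewrite algebraic_set_set0.
by apply/seteqP; split=> x [].
Qed.

Lemma vclosed_locally_closed (X : variety K) (Z : set X) :
  vclosed Z -> vlocally_closed Z.
Proof.
move=> cZ; exists setT, Z; split=> //; last by rewrite setTI.
by move=> i; exists [set 1]; rewrite algebraic_set1 preimage_set0 setCT.
Qed.

Lemma vclosed_locally_closedC (X : variety K) (Z : set X) :
  vclosed Z -> vlocally_closed (~` Z).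
Proof.
move=> cZ; exists (~` Z), setT; split; last by rewrite setIT.
  by rewrite /vopen setCK.
exact: vclosedT.
Qed.

Section Subvariety.
Variables (X : variety K) (W : set X) (lcW : vlocally_closed W).
Let pt := {x : X | W x}.
Let sdom (i : chart X) : set pt := [set x | dom X i (sval x)].
Let scoord i (x : pt) := coord X i (sval x).

Let s_inj (x y : pt) : sval x = sval y -> x = y.
Proof. by case: x y => [x hx] [y hy] /= e; apply: eq_exist. Qed.

Let s_lc i : locally_closed (scoord i @` sdom i).
Proof.
have [U [Z [oU cZ eW]]] := lcW; have [S eS] := cZ i; have [S' eS'] := oU i.
have -> : scoord i @` sdom i =
    coord X i @` dom X i `&` (algebraic_set S `\` algebraic_set S').
  have hS x : dom X i x -> (algebraic_set S (coord X i x) <-> Z x).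
    move=> dx; split=> [Sx|Zx].
      by have [] : (dom X i `&` Z) x by rewrite eS.
    by have : (dom X i `&` Z) x by []; rewrite eS => -[].
  have hS' x : dom X i x -> (algebraic_set S' (coord X i x) <-> ~ U x).
    move=> dx; split=> [Sx|Zx].
      by have [] : (dom X i `&` ~` U) x by rewrite eS'.
    by have : (dom X i `&` ~` U) x by []; rewrite eS' => -[].
  apply/seteqP; split=> [_ [[x Wx] /= dx <-]|_ [[x dx <-] [/hS Sx nSx]]].
    split; first by exists x.
    have [Ux Zx] : (U `&` Z) x by rewrite -eW.
    split; first exact/hS.
    by move/(hS' _ dx).
  have Wx : W x.
    by rewrite eW; split; [apply: contrapT => /(hS' _ dx)|exact: Sx].
  by exists (exist _ x Wx).
apply: locally_closedI; first exact: coord_locally_closed.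
by exists S, S'.
Qed.

Definition subvariety : variety K.
Proof.
refine (@Variety K pt (chart X) (@chart_dim _ X) sdom scoord (chart_finite X)
  _ _ s_lc _ _ _).
- by move=> x; exact: dom_cover.
- by move=> i x y dx dy /(coord_inj dx dy) /s_inj.
- move=> i j; rewrite (_ : _ `&` _ = sdom i `&` (@sval _ _) @^-1` (dom X i `&` dom X j)); last first.
    by apply/seteqP; split=> x [] // ? [].
  apply: open_in_pull (dom_open i j) => // k l; rewrite ord1; exact: polyfunX.
- move=> i j k; apply: (@regular_on_pull _ _ _ _ _ _ _ (@sval _ _) _ _ _ _ _ (coord_regular k)).
    by move=> u v; rewrite ord1; exact: polyfunX.
  by move=> x [].
- move=> i j; rewrite (_ : [set p | _] = (sdom i `*` sdom j) `&`
     (fun p => (sval p.1, sval p.2)) @^-1` [set p | (dom X i `*` dom X j) p /\ p.1 = p.2]).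
    apply: closed_in_pull (separated i j) => // k l; rewrite ord1; exact: polyfunX.
  apply/seteqP; split=> -[x y] [[/= dx dy]] /=.
    by move=> exy; split=> //=; split=> //; rewrite exy.
  by move=> [_ /s_inj].
Defined.

End Subvariety.

Section Product.
Variables X Y : variety K.
Let pdom (i : chart X * chart Y) : set (X * Y) := dom X i.1 `*` dom Y i.2.
Let pcoord (i : chart X * chart Y) (p : X * Y) :=
  row_mx (coord X i.1 p.1) (coord Y i.2 p.2).

Let fst_poly i : polymx (pcoord i) (coord X i.1 \o fst).
Proof.
move=> k l; rewrite ord1 (_ : (fun _ => _) = fun p => pcoord i p 0 (lshift _ l)).
  exact: polyfunX.
by apply/funext => p; rewrite row_mxEl.
Qed.

Let snd_poly i : polymx (pcoord i) (coord Y i.2 \o snd).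
Proof.
move=> k l; rewrite ord1 (_ : (fun _ => _) = fun p => pcoord i p 0 (rshift _ l)).
  exact: polyfunX.
by apply/funext => p; rewrite row_mxEr.
Qed.

Definition vproduct : variety K.
Proof.
refine (@Variety K (X * Y)%type (chart X * chart Y)%type
  (fun i => (chart_dim i.1 + chart_dim i.2)%N) pdom pcoord _ _ _ _ _ _ _).
- by rewrite -setXTT; apply: finite_setX; exact: chart_finite.
- move=> [x y]; have [i ix] := dom_cover x; have [j jy] := dom_cover y.
  by exists (i, j).
- move=> [i j] [x y] [x' y'] [/= dx dy] [/= dx' dy'] /eq_row_mx[].
  by move=> /(coord_inj dx dx') -> /(coord_inj dy dy') ->.
- move=> [i j].
  have [S1 [S2 e1]] := coord_locally_closed i; have [S3 [S4 e2]] := coord_locally_closed j.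
  have lc n m (h : 'rV[K]_n -> 'rV[K]_m) S S' : polymx id h ->
      locally_closed (h @^-1` (algebraic_set S `\` algebraic_set S')).
    move=> hh.
    have cl R : exists R', h @^-1` (@algebraic_set K _ R) = algebraic_set R'.
      have : closed_in id setT (setT `&` h @^-1` (algebraic_set R)).
        apply: (@closed_in_pull _ _ _ _ _ id id h setT setT) => //.
        by exists R; rewrite setTI.
      by rewrite setTI => -[R' ->]; exists R'; rewrite setTI.
    rewrite (_ : _ @^-1` _ = h @^-1` algebraic_set S `\` h @^-1` algebraic_set S')//.
    by have [R ->] := cl S; have [R' ->] := cl S'; exists R, R'.
  rewrite (_ : _ @` _ = (fun z => lsubmx z) @^-1` (coord X i @` dom X i) `&`
     (fun z => rsubmx z) @^-1` (coord Y j @` dom Y j)).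
    rewrite e1 e2; apply: locally_closedI; apply: lc => k l.
      rewrite ord1; exists 'X_(lshift _ l) => z; by rewrite mxE mevalXU.
    rewrite ord1; exists 'X_(rshift _ l) => z; by rewrite mxE mevalXU.
  apply/seteqP; split=> [_ [[x y] [/= dx dy] <-]|z [[x /= dx ex] [y dy ey]]].
    by split; [exists x|exists y]; rewrite // ?row_mxKl ?row_mxKr.
  by exists (x, y) => //; rewrite /pcoord /= ex ey hsubmxK.
- move=> [i j] [i' j']; apply/open_inP; split=> [x []//|[x y] [[/= dx dy] [/= dx' dy']]].
  have /open_inP[_ /(_ x (conj dx dx')) [P [Px hP]]] := dom_open i i'.
  have /open_inP[_ /(_ y (conj dy dy')) [Q [Qy hQ]]] := dom_open j j'.
  have [P' hP'] := poly_pull (@fst_poly (i, j)) P.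
  have [Q' hQ'] := poly_pull (@snd_poly (i, j)) Q.
  exists (P' * Q'); rewrite mevalM -(hP' (x, y)) -(hQ' (x, y)) mulf_neq0 //.
  split=> // -[u v] [/= du dv]; rewrite mevalM -(hP' (u, v)) -(hQ' (u, v)) mulf_eq0 negb_or.
  by move=> /andP[/(hP _ du) [_ du'] /(hQ _ dv) [_ dv']].
- move=> i j k; case: (split_ordP k) => l ->.
    under eq_fun do rewrite row_mxEl.
    apply: (@regular_on_pull _ _ _ _ _ _ _ fst _ _ (@fst_poly i) _ _ (coord_regular l)).
    by move=> p [[] ? ? []].
  under eq_fun do rewrite row_mxEr.
  apply: (@regular_on_pull _ _ _ _ _ _ _ snd _ _ (@snd_poly i) _ _ (coord_regular l)).
  by move=> p [[] ? ? []].
- move=> i j; set c := (fun p => _); set W := pdom i `*` pdom j.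
  have hi k l : polyfun c (fun p => pcoord i p.1 k l).
    rewrite ord1 (_ : (fun _ => _) = fun p => c p 0 (lshift _ l)); first exact: polyfunX.
    by apply/funext => p; rewrite row_mxEl.
  have hj k l : polyfun c (fun p => pcoord j p.2 k l).
    rewrite ord1 (_ : (fun _ => _) = fun p => c p 0 (rshift _ l)); first exact: polyfunX.
    by apply/funext => p; rewrite row_mxEr.
  have h1 : polymx c ((fun q : X * X => row_mx (coord X i.1 q.1) (coord X j.1 q.2))
      \o (fun p => (p.1.1, p.2.1))).
    move=> k l; rewrite ord1; case: (split_ordP l) => l' ->.
      under eq_fun do rewrite /= row_mxEl.
      rewrite (_ : (fun _ => _) = fun p => pcoord i p.1 0 (lshift _ l')); first exact: hi.
      by apply/funext => p; rewrite row_mxEl.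
    under eq_fun do rewrite /= row_mxEr.
    rewrite (_ : (fun _ => _) = fun p => pcoord j p.2 0 (lshift _ l')); first exact: hj.
    by apply/funext => p; rewrite row_mxEl.
  have h2 : polymx c ((fun q : Y * Y => row_mx (coord Y i.2 q.1) (coord Y j.2 q.2))
      \o (fun p => (p.1.2, p.2.2))).
    move=> k l; rewrite ord1; case: (split_ordP l) => l' ->.
      under eq_fun do rewrite /= row_mxEl.
      rewrite (_ : (fun _ => _) = fun p => pcoord i p.1 0 (rshift _ l')); first exact: hi.
      by apply/funext => p; rewrite row_mxEr.
    under eq_fun do rewrite /= row_mxEr.
    rewrite (_ : (fun _ => _) = fun p => pcoord j p.2 0 (rshift _ l')); first exact: hj.
    by apply/funext => p; rewrite row_mxEr.
  have hW1 p : W p -> (dom X i.1 `*` dom X j.1) (p.1.1, p.2.1) by move=> [[] ? ? []].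
  have hW2 p : W p -> (dom Y i.2 `*` dom Y j.2) (p.1.2, p.2.2) by move=> [[] ? ? []].
  have [R1 e1] := closed_in_pull h1 hW1 (separated i.1 j.1).
  have [R2 e2] := closed_in_pull h2 hW2 (separated i.2 j.2).
  exists (R1 `|` R2); rewrite -algebraic_setI preimage_setI setIIr -e1 -e2.
  apply/seteqP; split=> -[[x y] [x' y']].
    by move=> [w /= [ex ey]]; split; split=> //=; split=> //=;
      [exact: (hW1 _ w)|exact: (hW2 _ w)].
  by move=> [[/= w [_ /= ex]] [_ [_ /= ey]]]; split=> //=; rewrite ex ey.
Defined.

End Product.

Definition affine_space (n : nat) : variety K.
Proof.
refine (@Variety K 'rV[K]_n unit (fun=> n) (fun=> setT) (fun=> id) _ _ _ _ _ _ _).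
- exact: finite_finset.
- by exists tt.
- by [].
- move=> _; rewrite image_id -(@algebraic_set_set0 K n); exact: locally_closed_algebraic.
- move=> _ _; rewrite setIT; split=> //; rewrite setDv.
  by exists [set 1]; rewrite algebraic_set1 preimage_set0 setI0.
- by move=> _ _ k; apply: regular_on_polyfun; exact: polyfunX.
- move=> _ _; exists [set p | exists k : 'I_n, p = 'X_(lshift n k) - 'X_(rshift n k)].
  apply/seteqP; split=> -[x y] [h1 h2]; split=> //=.
    move=> p [k ->]; rewrite mevalB !mevalXU /= row_mxEl row_mxEr.
    by move: h2 => /= ->; rewrite subrr.
  apply/rowP => k; apply/eqP; rewrite -subr_eq0.
  have /= := h2 _ (ex_intro _ k erefl).
  by rewrite mevalB !mevalXU /= row_mxEl row_mxEr => ->.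
Defined.

End Varieties.

(* K_0(Var_K): the commutative ring generated by the classes of varieties,
   subject to invariance under isomorphism, the scissor relations, and
   [X x Y] = [X][Y], [pt] = 1.  It is the quotient of formal ring expressions
   by the congruence generated by these relations and the ring axioms.
   A variety has an arbitrary type of points, so K_0 lies in a universe above
   the one of the MathComp structures and cannot carry them; its ring structure
   is recorded as a Stdlib [ring_theory] instead. *)
Inductive K0_expr (K : closedFieldType) :=
  | K0_gen of variety K
  | K0_0
  | K0_1
  | K0_opp of K0_expr K
  | K0_add of K0_expr K & K0_expr K
  | K0_mul of K0_expr K & K0_expr K.
Arguments K0_0 {K}.
Arguments K0_1 {K}.

Inductive K0_rel (K : closedFieldType) : K0_expr K -> K0_expr K -> Prop :=
  | K0_refl a : K0_rel a a
  | K0_sym a b : K0_rel a b -> K0_rel b a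
  | K0_trans a b c : K0_rel a b -> K0_rel b c -> K0_rel a c
  | K0_opp_congr a a' : K0_rel a a' -> K0_rel (K0_opp a) (K0_opp a')
  | K0_add_congr a a' b b' :
      K0_rel a a' -> K0_rel b b' -> K0_rel (K0_add a b) (K0_add a' b')
  | K0_mul_congr a a' b b' :
      K0_rel a a' -> K0_rel b b' -> K0_rel (K0_mul a b) (K0_mul a' b')
  | K0_addA a b c : K0_rel (K0_add a (K0_add b c)) (K0_add (K0_add a b) c)
  | K0_addC a b : K0_rel (K0_add a b) (K0_add b a)
  | K0_add0 a : K0_rel (K0_add K0_0 a) a
  | K0_addN a : K0_rel (K0_add (K0_opp a) a) K0_0
  | K0_mulA a b c : K0_rel (K0_mul a (K0_mul b c)) (K0_mul (K0_mul a b) c)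
  | K0_mulC a b : K0_rel (K0_mul a b) (K0_mul b a)
  | K0_mul1 a : K0_rel (K0_mul K0_1 a) a
  | K0_mulD a b c :
      K0_rel (K0_mul (K0_add a b) c) (K0_add (K0_mul a c) (K0_mul b c))
  | K0_iso X Y : visomorphic X Y -> K0_rel (K0_gen X) (K0_gen Y)
  | K0_scissor (X : variety K) (Z : set X) (clZ : vclosed Z) :
      K0_rel (K0_gen X)
        (K0_add (K0_gen (subvariety (vclosed_locally_closed clZ)))
                (K0_gen (subvariety (vclosed_locally_closedC clZ))))
  | K0_product X Y :
      K0_rel (K0_gen (vproduct X Y)) (K0_mul (K0_gen X) (K0_gen Y))
  | K0_point : K0_rel (K0_gen (affine_space K 0)) K0_1.


Section GrothendieckRing.
Variable K : closedFieldType.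

Definition K0 := {C : K0_expr K -> Prop | exists a, C = K0_rel a}.

Definition K0_of (a : K0_expr K) : K0 := exist _ (K0_rel a) (ex_intro _ a erefl).

Definition K0_repr (x : K0) : K0_expr K := projT1 (cid (svalP x)).

Lemma K0_ofP a b : K0_of a = K0_of b <-> K0_rel a b.
Proof.
split=> [[eab]|ab]; first by rewrite eab; exact: K0_refl.
apply: eq_exist; apply/funext => c; apply/propext; split.
  by move=> ac; exact: K0_trans (K0_sym ab) ac.
exact: K0_trans.
Qed.

Lemma K0_reprK x : K0_of (K0_repr x) = x.
Proof.
rewrite /K0_repr; case: (cid _) => a /= e; case: x e => C hC /= e.
by apply: eq_exist; rewrite -e.
Qed.

Lemma K0_ind (P : K0 -> Prop) : (forall a, P (K0_of a)) -> forall x, P x.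
Proof. by move=> h x; rewrite -(K0_reprK x). Qed.

Definition K0zero : K0 := K0_of K0_0.
Definition K0one : K0 := K0_of K0_1.
Definition K0opp (x : K0) : K0 := K0_of (K0_opp (K0_repr x)).
Definition K0add (x y : K0) : K0 := K0_of (K0_add (K0_repr x) (K0_repr y)).
Definition K0sub (x y : K0) : K0 := K0add x (K0opp y).
Definition K0mul (x y : K0) : K0 := K0_of (K0_mul (K0_repr x) (K0_repr y)).
Definition K0exp (x : K0) (n : nat) : K0 := iter n (K0mul x) K0one.

Lemma K0oppE a : K0opp (K0_of a) = K0_of (K0_opp a).
Proof. by apply/K0_ofP/K0_opp_congr/K0_ofP; rewrite K0_reprK. Qed.

Lemma K0addE a b : K0add (K0_of a) (K0_of b) = K0_of (K0_add a b).
Proof. by apply/K0_ofP/K0_add_congr; apply/K0_ofP; rewrite K0_reprK. Qed.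

Lemma K0mulE a b : K0mul (K0_of a) (K0_of b) = K0_of (K0_mul a b).
Proof. by apply/K0_ofP/K0_mul_congr; apply/K0_ofP; rewrite K0_reprK. Qed.

Lemma K0_ring_theory :
  Ring_theory.ring_theory K0zero K0one K0add K0mul K0sub K0opp eq.
Proof.
split.
- by elim/K0_ind=> a; rewrite K0addE; apply/K0_ofP/K0_add0.
- by elim/K0_ind=> a; elim/K0_ind=> b; rewrite !K0addE; apply/K0_ofP/K0_addC.
- elim/K0_ind=> a; elim/K0_ind=> b; elim/K0_ind=> c.
  by rewrite !K0addE; apply/K0_ofP/K0_addA.
- by elim/K0_ind=> a; rewrite K0mulE; apply/K0_ofP/K0_mul1.
- by elim/K0_ind=> a; elim/K0_ind=> b; rewrite !K0mulE; apply/K0_ofP/K0_mulC.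
- elim/K0_ind=> a; elim/K0_ind=> b; elim/K0_ind=> c.
  by rewrite !K0mulE; apply/K0_ofP/K0_mulA.
- elim/K0_ind=> a; elim/K0_ind=> b; elim/K0_ind=> c.
  by rewrite !(K0addE, K0mulE); apply/K0_ofP/K0_mulD.
- by [].
- elim/K0_ind=> a; rewrite K0oppE K0addE; apply/K0_ofP.
  exact: K0_trans (K0_addC _ _) (K0_addN _).
Qed.

Definition K0_class (X : variety K) : K0 := K0_of (K0_gen X).
Definition lefschetz : K0 := K0_class (affine_space K 1).

Lemma K0_class_iso X Y : visomorphic X Y -> K0_class X = K0_class Y.
Proof. by move=> XY; apply/K0_ofP/K0_iso. Qed.

Lemma K0_class_scissor (X : variety K) (Z : set X) (clZ : vclosed Z) :
  K0_class X = K0add (K0_class (subvariety (vclosed_locally_closed clZ)))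
                     (K0_class (subvariety (vclosed_locally_closedC clZ))).
Proof. by rewrite /K0_class K0addE; apply/K0_ofP/K0_scissor. Qed.

Lemma K0_class_product (X Y : variety K) :
  K0_class (vproduct X Y) = K0mul (K0_class X) (K0_class Y).
Proof. by rewrite /K0_class K0mulE; apply/K0_ofP/K0_product. Qed.

Lemma K0_class_point : K0_class (affine_space K 0) = K0one.
Proof. by apply/K0_ofP/K0_point. Qed.

End GrothendieckRing.

Declare Scope K0_scope.
Delimit Scope K0_scope with K0.
Bind Scope K0_scope with K0.
Notation "0" := (K0zero _) : K0_scope.
Notation "1" := (K0one _) : K0_scope.
Notation "x + y" := (K0add x y) : K0_scope.
Notation "x - y" := (K0sub x y) : K0_scope.
Notation "- x" := (K0opp x) : K0_scope.
Notation "x * y" := (K0mul x y) : K0_scope.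
Notation "x ^+ n" := (K0exp x n) : K0_scope.

Section RowSpace.
Variables (K : fieldType) (V : vectType K).
Local Notation n := (\dim {:V}).
Let e := vbasis {:V}.
Let be : basis_of {:V} e := vbasisP _.

(* Subspaces of V are described by matrices whose rows are coordinates of
   vectors in the basis [vbasis {:V}]. *)
Definition row_space k (A : 'M[K]_(k, n)) : {vspace V} := vsof e <<A>>%MS.

Lemma row_space_sub k l (A : 'M_(k, n)) (B : 'M_(l, n)) :
  (row_space A <= row_space B)%VS = (A <= B)%MS.
Proof. by rewrite sub_vsof // !genmxE. Qed.

Lemma row_space_eq k l (A : 'M_(k, n)) (B : 'M_(l, n)) :
  row_space A = row_space B <-> (A :=: B)%MS.
Proof.
split=> [eAB|/eqmxP/andP[h1 h2]].
  by apply/eqmxP; rewrite -!row_space_sub eAB subvv.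
by apply: subv_anti; rewrite !row_space_sub h1.
Qed.

Lemma row_space_basis (U : {vspace V}) :
  exists A : 'M_(\dim U, n), row_free A /\ row_space A = U.
Proof.
pose X := vbasis U; have bX : basis_of U X := vbasisP U.
pose A : 'M_(\dim U, n) := \matrix_i rVof e X`_i; exists A.
have AE i : row i A = rVof e X`_i by rewrite rowK.
split.
  apply: inj_row_free => u uA0; apply/rowP => i; rewrite mxE.
  have : rVof e (\sum_i u 0 i *: X`_i) = 0.
    rewrite linear_sum /= -[RHS]uA0 mulmx_sum_row; apply: eq_bigr => j _.
    by rewrite linearZ /= AE.
  move/eqP; rewrite rVof_eq0 // => /eqP h.
  by have /freeP/(_ (fun i => u 0 i) h i) := basis_free bX.
apply: subv_anti; apply/andP; split.
  rewrite -[U in (_ <= U)%VS](msofK be) /row_space sub_vsof // genmxE; apply/row_subP => i.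
  by rewrite AE rVof_sub // msofK // vbasis_mem // mem_nth // size_tuple.
rewrite -[U in (U <= _)%VS](span_basis bX); apply/span_subvP => x /tnthP[i ->].
by rewrite (tnth_nth 0) -rVof_sub // genmxE -AE row_sub.
Qed.

Lemma dim_row_space k (A : 'M_(k, n)) : \dim (row_space A) = \rank A.
Proof.
have [B [fB /row_space_eq eB]] := row_space_basis (row_space A).
by rewrite -eB (eqP fB).
Qed.

Lemma colsub_free k (A : 'M[K]_(k, n)) (f : 'I_k -> 'I_n) :
  colsub f A = 1%:M -> row_free A.
Proof.
move=> fA; apply/row_freeP; exists (colsub f 1%:M).
by rewrite mulmx_colsub mulmx1.
Qed.

Lemma colsub_eq k (A B : 'M[K]_(k, n)) (f : 'I_k -> 'I_n) :
  colsub f A = 1%:M -> colsub f B = 1%:M -> row_space A = row_space B -> A = B.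
Proof.
move=> fA fB /row_space_eq /eqmxP /andP[/submxP[D eA] _]; move: fA.
by rewrite eA -mulmx_colsub fB mulmx1 => ->; rewrite mul1mx.
Qed.

Lemma row_space_mull k (g : 'M[K]_k) (A : 'M_(k, n)) :
  g \in unitmx -> row_space (g *m A) = row_space A.
Proof. by move=> ug; apply/row_space_eq; apply: eqmxMfull; rewrite row_full_unit. Qed.

Lemma row_space_eq_free k (A B : 'M[K]_(k, n)) :
  row_free B -> row_space A = row_space B ->
  exists2 g, g \in unitmx & B = g *m A.
Proof.
move=> fB /row_space_eq eAB.
have /submxP[g eg] : (B <= A)%MS by rewrite eAB.
exists g => //; rewrite -row_free_unit; apply/row_freeP.
have /row_freeP[C hC] := fB; exists (A *m C).
by rewrite mulmxA -eg.
Qed.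

Lemma row_free_colsub k (A : 'M[K]_(k, n)) : row_free A ->
  exists f : {ffun 'I_k -> 'I_n}, colsub f A \in unitmx.
Proof.
move=> fA; have rA : row_full A^T by rewrite /row_full mxrank_tr; exact: fA.
exists (finfun (fullrankfun rA)).
have -> : colsub (finfun (fullrankfun rA)) A = colsub (fullrankfun rA) A.
  by apply/matrixP => i j; rewrite !mxE ffunE.
by have := fullrowsub_unit rA; rewrite -unitmx_tr trmx_mxsub trmxK.
Qed.

End RowSpace.

(* The Grassmannian of k-dimensional subspaces, with its standard charts: the
   chart of f : 'I_k -> 'I_n consists of the subspaces having a (unique) basis
   whose coordinate matrix A satisfies colsub f A = 1, and its coordinates are
   the entries of A. *)
Section Grassmannian.
Variables (K : closedFieldType) (V : vectType K) (k : nat).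
Local Notation n := (\dim {:V}).

Definition gr_point := {U : {vspace V} | \dim U == k}.

Definition gr_dom (f : {ffun 'I_k -> 'I_n}) : set gr_point :=
  [set U | exists A : 'M_(k, n), colsub f A = 1%:M /\ row_space A = val U].

Definition gr_mat (f : {ffun 'I_k -> 'I_n}) (U : gr_point) : 'M[K]_(k, n) :=
  xget 0 [set A | colsub f A = 1%:M /\ row_space A = val U].

Definition gr_coord f (U : gr_point) : 'rV[K]_(k * n) := mxvec (gr_mat f U).

Lemma gr_matP f U : gr_dom f U ->
  colsub f (gr_mat f U) = 1%:M /\ row_space (gr_mat f U) = val U.
Proof.
move=> [A hA].
apply: (@xgetPex _ 0 [set A | colsub f A = 1%:M /\ row_space A = val U]).
by exists A.
Qed.

Lemma gr_mat_uniq (f : {ffun 'I_k -> 'I_n}) (U : gr_point) (A : 'M_(k, n)) :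
  colsub f A = 1%:M -> row_space A = val U -> gr_mat f U = A.
Proof.
move=> fA eA; have [fM eM] := gr_matP (ex_intro _ A (conj fA eA)).
by apply: colsub_eq fM fA _; rewrite eA eM.
Qed.

Lemma gr_mat_free f U : gr_dom f U -> row_free (gr_mat f U).
Proof. by move=> /gr_matP[/colsub_free]. Qed.

Lemma gr_basis (U : gr_point) :
  exists A : 'M_(k, n), row_free A /\ row_space A = val U.
Proof. by case: U => U /= /eqP <-; exact: row_space_basis. Qed.

Lemma gr_domP (f : {ffun 'I_k -> 'I_n}) (U : gr_point) (A : 'M_(k, n)) : row_space A = val U -> row_free A ->
  gr_dom f U <-> colsub f A \in unitmx.
Proof.
move=> eA fA; split=> [[B [fB eB]]|uA].
  have [g ug ->] : exists2 g, g \in unitmx & A = g *m B.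
    by apply: row_space_eq_free; rewrite // eB.
  by rewrite -mulmx_colsub fB mulmx1.
exists (invmx (colsub f A) *m A); rewrite -mulmx_colsub mulVmx //.
by rewrite row_space_mull // unitmx_inv.
Qed.

Lemma gr_mat_change f g U : gr_dom f U -> gr_dom g U ->
  gr_mat g U = invmx (colsub g (gr_mat f U)) *m gr_mat f U.
Proof.
move=> df dg; have [_ eM] := gr_matP df.
have /(gr_domP g eM) [/(_ dg) uM _] := gr_mat_free df.
apply: gr_mat_uniq; first by rewrite -mulmx_colsub mulVmx.
by rewrite row_space_mull // unitmx_inv.
Qed.

Lemma gr_mat_poly f : polymx (gr_coord f) (gr_mat f).
Proof.
move=> i j; rewrite (_ : (fun _ => _) = fun U => gr_coord f U 0 (mxvec_index i j)).
  exact: polyfunX.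
by apply/funext => U; rewrite mxvecE.
Qed.

Lemma gr_cover (U : gr_point) : exists f, gr_dom f U.
Proof.
have [A [fA eA]] := gr_basis U; have [f uA] := row_free_colsub fA.
by exists f; apply/(gr_domP f eA fA).
Qed.

Lemma gr_coord_inj f U U' :
  gr_dom f U -> gr_dom f U' -> gr_coord f U = gr_coord f U' -> U = U'.
Proof.
move=> /gr_matP[_ eU] /gr_matP[_ eU'] /(can_inj mxvecK) eM; apply: val_inj.
by rewrite -eU -eU' eM.
Qed.

Lemma gr_locally_closed f : locally_closed (gr_coord f @` gr_dom f).
Proof.
rewrite (_ : _ @` _ = algebraic_set [set p | exists i j,
    p = 'X_(mxvec_index i (f j)) - (i == j)%:R%:MP]).
  exact: locally_closed_algebraic.
apply/seteqP; split=> [_ [U /gr_matP[fU _] <-] _ [i [j ->]]|x hx].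
  rewrite mevalB mevalXU mevalC mxvecE.
  by move/matrixP: fU => /(_ i j); rewrite !mxE => ->; rewrite subrr.
have fx : colsub f (vec_mx x) = 1%:M.
  apply/matrixP => i j; rewrite !mxE; apply/eqP; rewrite -subr_eq0; apply/eqP.
  by have := hx _ (ex_intro _ i (ex_intro _ j erefl)); rewrite mevalB mevalXU mevalC.
have dx : \dim (row_space (vec_mx x)) == k.
  by rewrite dim_row_space; exact: colsub_free fx.
pose U : gr_point := exist _ (row_space (vec_mx x)) dx.
exists U; first by exists (vec_mx x).
by rewrite /gr_coord (@gr_mat_uniq f U (vec_mx x)) // vec_mxK.
Qed.

Lemma gr_dom_open f g : open_in (gr_coord f) (gr_dom f) (gr_dom f `&` gr_dom g).
Proof.
have [p hp] := polyfun_det (polymx_sub id g (gr_mat_poly f)).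
have dg U : gr_dom f U -> gr_dom g U <-> p.@[gr_coord f U 0] != 0.
  move=> df; rewrite -hp -unitfE -unitmxE; apply: gr_domP; last exact: gr_mat_free.
  by case: (gr_matP df).
apply/open_inP; split=> [U []//|U [df dgU]]; exists p; split; first exact/dg.
by move=> U' df' /(dg _ df') dgU'; split.
Qed.

Lemma gr_regular f g :
  regular_map_on (gr_coord f) (gr_dom f `&` gr_dom g) (gr_coord g).
Proof.
move=> k0; case/mxvec_indexP: k0 => i j.
pose M U := colsub g (gr_mat f U).
have hM : polymx (gr_coord f) M by apply: polymx_sub; exact: gr_mat_poly.
have uM U : (gr_dom f `&` gr_dom g) U -> M U \in unitmx.
  move=> [df dg]; have [_ eM] := gr_matP df.
  exact/(gr_domP g eM (gr_mat_free df)).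
apply: (@eq_regular_on _ _ _ _ _ (fun U => (\adj (M U) *m gr_mat f U) i j / \det (M U))).
  move=> U hU; have [df dg] := hU.
  rewrite mxvecE (gr_mat_change df dg) /invmx uM // -scalemxAl [RHS]mxE.
  by rewrite mulrC.
apply: regular_on_div.
- by apply: polymxM; [exact: polymx_adj|exact: gr_mat_poly].
- exact: polyfun_det.
- by move=> U /uM; rewrite unitmxE unitfE.
Qed.

Lemma gr_separated f g :
  closed_in (fun p => row_mx (gr_coord f p.1) (gr_coord g p.2))
    (gr_dom f `*` gr_dom g) [set p | (gr_dom f `*` gr_dom g) p /\ p.1 = p.2].
Proof.
set c := (fun p => _).
have h1 : polymx c (gr_mat f \o fst).
  move=> i j; rewrite (_ : (fun _ => _) = fun p => c p 0 (lshift _ (mxvec_index i j))).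
    exact: polyfunX.
  by apply/funext => p; rewrite row_mxEl mxvecE.
have h2 : polymx c (gr_mat g \o snd).
  move=> i j; rewrite (_ : (fun _ => _) = fun p => c p 0 (rshift _ (mxvec_index i j))).
    exact: polyfunX.
  by apply/funext => p; rewrite row_mxEr mxvecE.
have h3 : polymx c (fun p => gr_mat f p.1 - colsub g (gr_mat f p.1) *m gr_mat g p.2).
  have h4 := polymxM (polymx_sub id g h1) h2.
  move=> i j; under eq_fun do rewrite mxE [X in _ + X]mxE.
  by apply: polyfunD; [exact: h1|apply: polyfunN; exact: h4].
have := closed_in_polymx0 (gr_dom f `*` gr_dom g) h3.
congr (closed_in _ _ _); apply/seteqP; split=> -[U U'] [[/= df dg]] /=.
  move=> /eqP; rewrite subr_eq0 => /eqP eU; split=> //.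
  have [_ eM] := gr_matP df; have [_ eM'] := gr_matP dg.
  apply: val_inj; rewrite -eM -eM' eU; apply: row_space_mull.
  rewrite -row_free_unit; have /row_freeP[C hC] := gr_mat_free df.
  by apply/row_freeP; exists (gr_mat g U' *m C); rewrite mulmxA -eU.
move=> eU; subst U'; split=> //; rewrite (gr_mat_change df dg) mulmxA mulmxV ?mul1mx ?subrr //.
have [_ eM] := gr_matP df.
exact/(gr_domP g eM (gr_mat_free df)).
Qed.

Definition grassmannian : variety K :=
  @Variety K gr_point {ffun 'I_k -> 'I_n} (fun=> (k * n)%N) gr_dom gr_coord
    finite_finset gr_cover gr_coord_inj gr_locally_closed gr_dom_open gr_regular
    gr_separated.

End Grassmannian.

(* The Zariski topology of a finite-dimensional vector space E: a polynomial
   function on E is a polynomial in finitely many linear forms. *)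
Definition zariski_open (K : closedFieldType) (E : lmodType K) (U : set E) :=
  forall s, U s -> exists (N : nat) (l : 'I_N -> {scalar E}) (p : {mpoly K[N]}),
    p.@[fun i => l i s] != 0 /\ forall t, p.@[fun i => l i t] != 0 -> U t.

Definition generic (K : closedFieldType) (E : lmodType K) (P : E -> Prop) :=
  exists U : set E, [/\ zariski_open U, U !=set0 & forall s, U s -> P s].

(* Let F = {(U, W) in G(2,V) x G(3,V) : U c W}.  The pairs (A, B) of bases of
   the two universal subspaces form a principal GL_2 x GL_3-bundle over F, a
   locally closed subset of an affine space.  As O(1) on G(k,V) is the dual of
   the determinant of the universal subbundle, a section of O(1,1) over F is a
   regular function on this bundle which is multiplied by det g * det h when
   the bases are changed by (g, h).  It is extended by 0. *)
Section FlagSections.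
Variables (K : closedFieldType) (V : vectType K).
Local Notation n := (\dim {:V}).

Definition flag_frame : set ('M[K]_(2, n) * 'M[K]_(3, n)) :=
  [set P | [/\ row_free P.1, row_free P.2
             & (row_space P.1 <= row_space P.2)%VS]].

Definition frame_coord (P : 'M[K]_(2, n) * 'M[K]_(3, n)) :
  'rV[K]_(2 * n + 3 * n) := row_mx (mxvec P.1) (mxvec P.2).

Definition is_section11 (s : 'M[K]_(2, n) * 'M[K]_(3, n) -> K^o) : Prop :=
  [/\ regular_on frame_coord flag_frame s,
      forall A B (g : 'M_2) (h : 'M_3), g \in unitmx -> h \in unitmx ->
        s (g *m A, h *m B) = \det g * \det h * s (A, B)
    & forall P, ~ flag_frame P -> s P = 0].

Definition section11_pred : {pred 'M[K]_(2, n) * 'M[K]_(3, n) -> K^o} :=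
  fun s => `[< is_section11 s >].

Lemma section11_submod : submod_closed section11_pred.
Proof.
split; first by apply/asboolP; split=> [|A B g h _ _|P _];
  rewrite ?mulr0 //; apply: regular_on_polyfun; exact: polyfunC.
move=> a s t /asboolP[rs es s0] /asboolP[rt et t0]; apply/asboolP.
have E P : (a *: s + t) P = a * s P + t P by [].
split.
- apply: regular_onD => //; apply: regular_onM => //.
  by apply: regular_on_polyfun; exact: polyfunC.
- move=> A B g h ug uh.
  by rewrite !E es // et // mulrDr mulrCA.
- by move=> P nP; rewrite E s0 // t0 // mulr0 addr0.
Qed.

HB.instance Definition _ :=
  GRing.isSubmodClosed.Build K _ section11_pred section11_submod.

Record section11 := Section11 {
  section11_fun :> 'M[K]_(2, n) * 'M[K]_(3, n) -> K^o;
  section11_in : section11_fun \in section11_pred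
}.

HB.instance Definition _ := [isSub for section11_fun].
HB.instance Definition _ := [Choice of section11 by <:].
HB.instance Definition _ := [SubChoice_isSubZmodule of section11 by <:].
HB.instance Definition _ := [SubZmodule_isSubLmodule of section11 by <:].

Lemma section11P (s : section11) : is_section11 s.
Proof. by have /asboolP := section11_in s. Qed.

(* The fibre of p over [U] is P(V/U), and (p_* s)[U] is the restriction of s
   to it.  Evaluated on a basis A of U, the section p_* s of Q_2^vee(2) is the
   linear form v |-> s(A, (A, v)) on V, which vanishes on U and is multiplied
   by (det g)^2 when A is replaced by gA. *)
Definition p_push (s : section11) (A : 'M[K]_(2, n)) (v : 'rV[K]_n) : K :=
  s (A, col_mx A v).

(* The fibre of q over [W] is P(W^vee), and (q_* s)[W] is the restriction of s
   to it.  Evaluated on a basis B = (b_0, b_1, b_2) of W, the section q_* s of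
   U_3(2) is the vector w of W whose coordinates in B are the values of
   s(-, B) on (b_1, b_2), (b_2, b_0) and (b_0, b_1) (indices are modulo 3);
   equivalently A /\ w = s(A, B) b_0 /\ b_1 /\ b_2 for every A in W. *)
Definition q_push (s : section11) (B : 'M[K]_(3, n)) : 'rV[K]_n :=
  \sum_(i < 3) s (rowsub (fun j : 'I_2 => i + lift ord0 j) B, B) *: row i B.

Lemma p_push_mull s g A v : g \in unitmx ->
  p_push s (g *m A) v = \det g ^+ 2 * p_push s A v.
Proof.
move=> ug; have [_ es _] := section11P s.
have ub : (block_mx g 0 0 1%:M : 'M[K]_(2 + 1)) \in unitmx.
  by rewrite unitmxE det_ublock det1 mulr1 -unitmxE.
have -> : p_push s (g *m A) v = s (g *m A, block_mx g 0 0 1%:M *m col_mx A v).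
  by rewrite mul_block_col !mul0mx mul1mx addr0 add0r.
rewrite (es A _ g _ ug ub) expr2; congr (_ * _ * _).
by rewrite [LHS](det_ublock (n1 := 2) (n2 := 1)) det1 mulr1.
Qed.

Lemma p_push_sub0 s A v : (v <= A)%MS -> p_push s A v = 0.
Proof.
move=> vA; have [_ _ s0] := section11P s; apply: s0 => -[_ /= fC _].
have : (\rank (col_mx A v) <= 2)%N.
  by rewrite -addsmxE (addsmx_idPl vA) rank_leq_row.
by rewrite (eqP fC).
Qed.

Lemma q_push_sub s B : (q_push s B <= B)%MS.
Proof. by apply: summx_sub => i _; rewrite scalemx_sub // row_sub. Qed.

Definition p_zero_locus (s : section11) : set (grassmannian V 2) :=
  [set U | forall A, row_free A -> row_space A = val U -> forall v, p_push s A v = 0].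

Definition q_zero_locus (s : section11) : set (grassmannian V 3) :=
  [set W | forall B, row_free B -> row_space B = val W -> q_push s B = 0].

Lemma row_free_open T m (c : T -> 'rV[K]_m) W k l (D : T -> 'M[K]_(k, l)) :
  polymx c D -> open_in c W (W `&` [set x | row_free (D x)]).
Proof.
move=> hD; apply/open_inP; split=> [x []//|x [Wx /= /row_freeP[C hC]]].
have [p hp] := polyfun_det (polymxM hD (polymxC c C)).
exists p; rewrite -hp hC det1 oner_eq0; split=> // y Wy; rewrite -hp => dy.
split=> //; apply/row_freeP; exists (C *m invmx (D y *m C)).
by rewrite mulmxA mulmxV // unitmxE unitfE.
Qed.

Lemma frame_row_free k (M A : 'M[K]_(k, n)) (U : {vspace V}) :
  row_free M -> row_space M = U ->
  row_free A /\ row_space A = U <-> exists2 g, g \in unitmx & A = g *m M.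
Proof.
move=> fM eM; split=> [[fA eA]|[g ug ->]].
  by apply: row_space_eq_free; rewrite // eM.
by rewrite row_space_mull // /row_free eqmxMfull // row_full_unit.
Qed.

Lemma p_zero_locus_closed s : vclosed (p_zero_locus s).
Proof.
move=> f; have [rs _ s0] := section11P s.
pose I := ({g : 'M[K]_2 | g \in unitmx} * 'rV[K]_n)%type.
pose D (i : I) (U : grassmannian V 2) := val i.1 *m gr_mat f U.
pose sig (i : I) (U : grassmannian V 2) : K := p_push s (D i U) i.2.
have hD i : polymx (gr_coord f) (D i).
  by apply: polymxM; [exact: polymxC|exact: gr_mat_poly].
have hC i : polymx (gr_coord f) (fun U => col_mx (D i U) i.2).
  by apply: polymx_col => //; exact: polymxC.
have cl i : closed_in (gr_coord f) (gr_dom f) (gr_dom f `&` [set U | sig i U = 0]).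
  apply: closed_in_zero (row_free_open _ (hC i)) _ _.
    apply: (@regular_on_pull _ _ _ _ _ _ _ (fun U => (D i U, col_mx (D i U) i.2))
              _ flag_frame _ _ _ rs).
      by apply: polymx_row; apply: polymx_mxvec; [exact: hD|exact: hC].
    move=> U [dU /= fC]; split=> //=.
      apply: (proj1 (proj2 (frame_row_free _ (gr_mat_free dU) erefl) _)).
      by exists (val i.1); [exact: (valP i.1)|].
    by rewrite row_space_sub (submx_trans (addsmxSl _ i.2)) // addsmxE.
  move=> U dU nO; apply: s0 => -[_ fC _]; exact: nO.
have := closed_in_bigcap cl; congr (closed_in _ _ _).
apply/seteqP; split=> U [dU hU]; split=> //.
  move=> A fA eA v; have [_ eM] := gr_matP dU.
  have [g ug ->] := proj1 (frame_row_free _ (gr_mat_free dU) eM) (conj fA eA).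
  by have [_] := hU (exist _ g ug, v).
move=> [[g ug] v]; split=> //=; have [_ eM] := gr_matP dU.
have [fA eA] := proj2 (frame_row_free _ (gr_mat_free dU) eM) (ex_intro2 _ _ g ug erefl).
exact: hU.
Qed.

Lemma q_zero_locus_closed s : vclosed (q_zero_locus s).
Proof.
move=> f; have [rs _ s0] := section11P s.
pose I := ({h : 'M[K]_3 | h \in unitmx} * 'I_n)%type.
pose D (i : I) (U : grassmannian V 3) := val i.1 *m gr_mat f U.
pose sig (i : I) (U : grassmannian V 3) : K := q_push s (D i U) 0 i.2.
have hD i : polymx (gr_coord f) (D i).
  by apply: polymxM; [exact: polymxC|exact: gr_mat_poly].
have cl i : closed_in (gr_coord f) (gr_dom f) (gr_dom f `&` [set U | sig i U = 0]).
  apply: (closed_in_zero (open_in_refl _ _)) => //.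
  rewrite /sig /q_push; under eq_fun do rewrite summxE.
  apply: regular_on_sum => j; under eq_fun do rewrite mxE [X in _ * X]mxE.
  apply: regular_onM; last by apply: regular_on_polyfun; exact: hD.
  apply: (@regular_on_pull _ _ _ _ _ _ _ (fun U => (rowsub (fun k : 'I_2 => j + lift ord0 k) (D i U), D i U))
            _ flag_frame _ _ _ rs).
    by apply: polymx_row; apply: polymx_mxvec; [apply: polymx_sub|]; exact: hD.
  move=> U dU; have fD : row_free (D i U).
    apply: (proj1 (proj2 (frame_row_free _ (gr_mat_free dU) erefl) _)).
    by exists (val i.1); [exact: (valP i.1)|].
  split=> //=; last by rewrite row_space_sub rowsub_sub.
  have /row_freeP[C hC] := fD; apply/row_freeP.
  exists (C *m colsub (fun k : 'I_2 => j + lift ord0 k) 1%:M).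
  rewrite mulmxA mul_rowsub_mx hC mulmx_colsub mulmx1; apply/matrixP => a b.
  by rewrite !mxE (inj_eq (addrI _)) (inj_eq lift_inj).
have := closed_in_bigcap cl; congr (closed_in _ _ _).
apply/seteqP; split=> U [dU hU]; split=> //.
  move=> A fA eA; have [_ eM] := gr_matP dU; apply/rowP => j.
  have [g ug ->] := proj1 (frame_row_free _ (gr_mat_free dU) eM) (conj fA eA).
  by have [_] := hU (exist _ g ug, j); rewrite mxE.
move=> [[g ug] v]; split=> //=; have [_ eM] := gr_matP dU.
have [fA eA] := proj2 (frame_row_free _ (gr_mat_free dU) eM) (ex_intro2 _ _ g ug erefl).
by rewrite /sig /D /= hU // mxE.
Qed.

Definition p_zero_variety (s : section11) : variety K :=
  subvariety (vclosed_locally_closed (p_zero_locus_closed s)).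

Definition q_zero_variety (s : section11) : variety K :=
  subvariety (vclosed_locally_closed (q_zero_locus_closed s)).

End FlagSections.

(* Main.v *)
Require Import Defs.
From Stdlib Require Import Ring.
From mathcomp Require Import all_boot all_order all_algebra.
From mathcomp Require Import mpoly.
From mathcomp Require Import boolp classical_sets.
From mathcomp Require Import reals complex.
Import Defs.

(** The locus D of flags U c W of F(2,3,V) where s vanishes is computed in two
ways.  The fibre of F over U is the projective plane P(V/U), on which s
restricts to a linear form.  This form is zero exactly when U lies in X, so
the fibre of D is a projective plane over X and a projective line elsewhere:
[D] = [G(2,V)] (1 + L) + [X] L^2.  In the same way the fibre of F over W is the
plane P(W^vee), on which s restricts to the linear form (q_* s)(W), and
[D] = [G(3,V)] (1 + L) + [Y] L^2.  Since dim V = 5, taking orthogonal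
complements identifies G(2,V) with G(3,V), and the difference of the two
formulas is ([X] - [Y]) L^2 = 0.

The formulas for [D] are two instances of [K0_hyperplane_fibration]: if D is
cut out in a locally trivial bundle of projective m-spaces by a linear form
phi depending on the base point, then [D] = [base] [P^(m-1)] + [phi = 0] L^m.
Its proof is a cell decomposition: where the coordinate phi_t does not vanish,
forgetting the t-th homogeneous coordinate makes D a trivial bundle of
projective (m-1)-spaces ([trivial_bundle_hyperplane]), and a trivial bundle of
projective spaces is cut into products of the base with affine spaces
([K0_trivial_bundle]).  Charts of the Grassmannians give the trivializations
([trivial_superspace_bundle], [trivial_subspace_bundle]).

A section of O(1,1) is only given as an equivariant regular function on
frames, so its linearity along the fibres has to be proved.  On a line of the
fibre this is the fact that the global sections of O(1) on P^1 are the linear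
forms ([homogeneous_plane_linear]): a regular function on the affine line is a
polynomial, and homogeneity compares the two charts of P^1.  Any two vectors
span such a line ([regular_homogeneous_additive]). *)

Set Implicit Arguments.
Unset Strict Implicit.
Unset Printing Implicit Defensive.
Import GRing.Theory passmx.
Local Open Scope ring_scope.
Local Open Scope classical_set_scope.

(** * Regularity near a point *)

Section RegularMeval.
Variables (K : fieldType) (T : Type) (n : nat) (c : T -> 'rV[K]_n).

Lemma regular_on_exp W f e : regular_on c W f -> regular_on c W (fun x => f x ^+ e).
Proof.
move=> rf; elim: e => [|e IH].
  by under eq_fun do rewrite expr0; apply: regular_on_polyfun; exact: polyfunC.
by under eq_fun do rewrite exprS; exact: regular_onM.
Qed.

Lemma regular_on_prod W I (r : seq I) (F : I -> T -> K) :
  (forall i, regular_on c W (F i)) -> regular_on c W (fun x => \prod_(i <- r) F i x).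
Proof.
move=> hF; elim: r => [|i r IH].
  by under eq_fun do rewrite big_nil; apply: regular_on_polyfun; exact: polyfunC.
by under eq_fun do rewrite big_cons; exact: regular_onM.
Qed.

Lemma regular_on_meval W m (g : T -> 'rV[K]_m) (p : {mpoly K[m]}) :
  regular_map_on c W g -> regular_on c W (fun x => p.@[g x 0]).
Proof.
move=> hg; under eq_fun do rewrite mevalE.
apply: regular_on_sum => a; apply: regular_onM.
  by apply: regular_on_polyfun; exact: polyfunC.
by apply: regular_on_prod => i; apply: regular_on_exp; exact: hg.
Qed.

End RegularMeval.

Section Germs.
Variable K : closedFieldType.
Implicit Types X Y : variety K.

(** [N] contains a distinguished neighbourhood of [x] in [W].  The point [x] is not
required to lie in [W].  One chart suffices because of [near_chart]. *)
Definition near_in X (W : set X) (x : X) (N : set X) :=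
  exists i, dom X i x /\ exists Q : {mpoly K[chart_dim i]},
    Q.@[coord X i x 0] != 0 /\
    forall y, W y -> dom X i y -> Q.@[coord X i y 0] != 0 -> N y.

(** Neighbourhoods do not depend on the chart: the inequation that defines one in
the chart j pulls back along the transition map to a regular function of the
chart i, whose numerator defines a neighbourhood there. *)
Lemma near_chart X (W N : set X) x i : dom X i x -> near_in W x N ->
  exists Q : {mpoly K[chart_dim i]}, Q.@[coord X i x 0] != 0 /\
    forall y, W y -> dom X i y -> Q.@[coord X i y 0] != 0 -> N y.
Proof.
move=> dix [j [djx [Q [Qx hQ]]]].
have [P [R [Rx hPR]]] := regular_on_meval Q (@coord_regular _ X i j) (conj dix djx).
have /open_inP[_ /(_ x (conj dix djx)) [S [Sx hS]]] := dom_open i j.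
have Px : P.@[coord X i x 0] != 0.
  by apply: contraNneq Qx => Px; rewrite (hPR _ (conj dix djx) Rx) Px mul0r.
exists (P * R * S); rewrite !mevalM !mulf_neq0 //; split=> // y Wy dy;
  rewrite !mevalM !mulf_eq0 !negb_or => /andP[/andP[Py Ry] Sy].
have [_ djy] := hS _ dy Sy; apply: hQ => //.
by rewrite (hPR _ (conj dy djy) Ry) mulf_neq0 // invr_eq0.
Qed.

Lemma near_sub X (W W' N N' : set X) x : W' `<=` W -> (forall y, W' y -> N y -> N' y) ->
  near_in W x N -> near_in W' x N'.
Proof.
move=> WW NN [i [dx [Q [Qx hQ]]]]; exists i; split=> //; exists Q; split=> //.
by move=> y Wy dy Qy; apply: NN => //; apply: hQ => //; exact: WW.
Qed.

Lemma near_mono X (W N N' : set X) x : (forall y, W y -> N y -> N' y) ->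
  near_in W x N -> near_in W x N'.
Proof. exact: near_sub. Qed.

Lemma near_all X (W N : set X) x : (forall y, W y -> N y) -> near_in W x N.
Proof.
move=> h; have [i dx] := dom_cover x; exists i; split=> //.
by exists 1; rewrite meval1 oner_eq0; split=> // y /h.
Qed.

Lemma near_and X (W N N' : set X) x :
  near_in W x N -> near_in W x N' -> near_in W x (N `&` N').
Proof.
move=> [i [dx [Q [Qx hQ]]]] /(near_chart dx)[R [Rx hR]].
exists i; split=> //; exists (Q * R); rewrite mevalM mulf_neq0 //; split=> // y Wy dy.
by rewrite mevalM mulf_eq0 negb_or => /andP[Qy Ry]; split; [exact: hQ|exact: hR].
Qed.

Lemma near_self X (W N : set X) x : W x -> near_in W x N -> N x.
Proof. by move=> Wx [i [dx [Q [Qx hQ]]]]; exact: hQ. Qed.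

Lemma near_dom X (W : set X) i x : dom X i x -> near_in W x (dom X i).
Proof.
move=> dx; exists i; split=> //; exists 1; rewrite meval1 oner_eq0; split=> //.
Qed.

Lemma near_meval X (W : set X) i x (Q : {mpoly K[chart_dim i]}) : dom X i x ->
  Q.@[coord X i x 0] != 0 -> near_in W x [set y | dom X i y /\ Q.@[coord X i y 0] != 0].
Proof. by move=> dx Qx; exists i; split=> //; exists Q; split. Qed.

(** Distinguished neighbourhoods are open, hence neighbourhoods of all their points. *)
Lemma near_near X (W N : set X) x : near_in W x N ->
  near_in setT x (fun y => near_in W y N).
Proof.
move=> [i [dx [Q [Qx hQ]]]]; exists i; split=> //; exists Q; split=> // y _ dy Qy.
by exists i; split=> //; exists Q.
Qed.

Lemma vclosedP X (Z : set X) :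
  vclosed Z <-> forall x, ~ Z x -> near_in setT x (~` Z).
Proof.
split=> [cZ x nZx|h i].
  have [i dx] := dom_cover x; exists i; split=> //; have [S eS] := cZ i.
  have nS : ~ algebraic_set S (coord X i x).
    by move=> Sx; apply: nZx; have [] : (dom X i `&` Z) x by rewrite eS.
  move: nS => /existsNP[Q] /not_implyP[SQ /eqP Qx]; exists Q; split=> // y _ dy Qy Zy.
  have : (dom X i `&` Z) y by []. 
  by rewrite eS => -[_ /(_ _ SQ)] /eqP; rewrite (negPf Qy).
apply/closed_inP => [x []//|]; apply/open_inP; split=> [x []//|x [dx nZ]].
have nZx : ~ Z x by move=> Zx; exact: nZ.
have [Q [Qx hQ]] := near_chart dx (h _ nZx).
by exists Q; split=> // y dy Qy; split=> // -[_]; exact: hQ.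
Qed.

Lemma vopenP X (U : set X) : vopen U <-> forall x, U x -> near_in setT x U.
Proof.
split=> [/vclosedP h x Ux|h]; first by have := h x; rewrite setCK; apply.
by apply/vclosedP => x /contrapT/h; rewrite setCK.
Qed.

(** The germ at [x] of the restriction of [f] to [W] is regular.  Working with germs
makes all later arguments independent of charts ([reg_chart]). *)
Definition regular_at X (W : set X) (x : X) (f : X -> K) :=
  exists i, dom X i x /\ exists P Q : {mpoly K[chart_dim i]},
    Q.@[coord X i x 0] != 0 /\
    near_in W x [set y | f y = P.@[coord X i y 0] / Q.@[coord X i y 0]].

Lemma reg_near X (W : set X) x f g :
  near_in W x [set y | f y = g y] -> regular_at W x f -> regular_at W x g.
Proof.
move=> nfg [i [dx [P [Q [Qx h]]]]]; exists i; split=> //; exists P, Q; split=> //.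
by apply: near_mono (near_and nfg h) => y _ /= [<-].
Qed.

Lemma reg_sub X (W W' : set X) x f : W' `<=` W -> regular_at W x f -> regular_at W' x f.
Proof.
move=> WW [i [dx [P [Q [Qx h]]]]]; exists i; split=> //; exists P, Q; split=> //.
exact: near_sub h.
Qed.

Lemma reg_chart X (W : set X) x f i : dom X i x -> regular_at W x f ->
  exists P Q : {mpoly K[chart_dim i]}, Q.@[coord X i x 0] != 0 /\
    near_in W x [set y | f y = P.@[coord X i y 0] / Q.@[coord X i y 0]].
Proof.
move=> dx [j [djx [P [Q [Qx hf]]]]].
have d := conj dx djx.
have [P1 [R1 [R1x h1]]] := regular_on_meval P (@coord_regular _ X i j) d.
have [P2 [R2 [R2x h2]]] := regular_on_meval Q (@coord_regular _ X i j) d.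
have P2x : P2.@[coord X i x 0] != 0.
  by apply: contraNneq Qx => Px; rewrite (h2 _ d R2x) Px mul0r.
exists (P1 * R2), (R1 * P2); rewrite mevalM mulf_neq0 //; split=> //.
have := near_and (near_and (near_meval W dx R1x) (near_meval W dx R2x)) (near_and hf
  (near_dom W djx)).
apply: near_mono => y _ /= [[[dy R1y] [_ R2y]] [-> djy]].
by rewrite (h1 _ (conj dy djy) R1y) (h2 _ (conj dy djy) R2y) invf_div mulf_div !mevalM.
Qed.

Lemma regC X (W : set X) x a : regular_at W x (fun=> a).
Proof.
have [i dx] := dom_cover x; exists i; split=> //; exists a%:MP, 1.
by rewrite meval1 oner_eq0; split=> //; apply: near_all => y _ /=; rewrite mevalC meval1 divr1.
Qed.

Lemma reg_coord X (W : set X) x i k : dom X i x -> regular_at W x (fun y => coord X i y 0 k).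
Proof.
move=> dx; exists i; split=> //; exists 'X_k, 1.
by rewrite meval1 oner_eq0; split=> //; apply: near_all => y _ /=; rewrite mevalXU meval1 divr1.
Qed.

Lemma regD X (W : set X) x f g : regular_at W x f -> regular_at W x g ->
  regular_at W x (fun y => f y + g y).
Proof.
move=> [i [dx [P [Q [Qx hf]]]]] /(reg_chart dx)[R [S [Sx hg]]].
exists i; split=> //; exists (P * S + R * Q), (Q * S); rewrite mevalM mulf_neq0//; split=> //.
apply: near_mono (near_and (near_and hf hg) (near_and (near_meval W dx Qx) (near_meval W dx Sx))).
move=> y _ [/= [-> ->] [[_ Qy] [_ Sy]]].
by rewrite !(mevalM, mevalD) addf_div.
Qed.

Lemma regM X (W : set X) x f g : regular_at W x f -> regular_at W x g ->
  regular_at W x (fun y => f y * g y).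
Proof.
move=> [i [dx [P [Q [Qx hf]]]]] /(reg_chart dx)[R [S [Sx hg]]].
exists i; split=> //; exists (P * R), (Q * S); rewrite mevalM mulf_neq0//; split=> //.
apply: near_mono (near_and hf hg) => y _ [/= -> ->].
by rewrite !mevalM mulf_div.
Qed.

Lemma regN X (W : set X) x f : regular_at W x f -> regular_at W x (fun y => - f y).
Proof.
move=> rf; have := regM (regC W x (-1)) rf.
by apply: reg_near; apply: near_all => y _ /=; rewrite mulN1r.
Qed.

Lemma reg_neq0 X (W : set X) x f : W x -> regular_at W x f -> f x != 0 ->
  near_in W x [set y | f y != 0].
Proof.
move=> Wx [i [dx [P [Q [Qx hf]]]]] fx.
have Px : P.@[coord X i x 0] != 0.
  by apply: contraNneq fx => Px; rewrite (near_self Wx hf) Px mul0r.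
apply: near_mono (near_and hf (near_and (near_meval W dx Px) (near_meval W dx Qx))).
by move=> y _ /= [-> [[_ Py] [_ Qy]]]; rewrite mulf_neq0 // invr_eq0.
Qed.

Lemma regV X (W : set X) x f : W x -> regular_at W x f -> f x != 0 ->
  regular_at W x (fun y => (f y)^-1).
Proof.
move=> Wx [i [dx [P [Q [Qx hf]]]]] fx; exists i; split=> //; exists Q, P; split.
  by apply: contraNneq fx => Px; rewrite (near_self Wx hf) Px mul0r.
by apply: near_mono hf => y _ /= ->; rewrite invf_div.
Qed.

Lemma reg_sum X (W : set X) x I (r : seq I) (P : pred I) (F : I -> X -> K) :
  (forall i, regular_at W x (F i)) -> regular_at W x (fun y => \sum_(i <- r | P i) F i y).
Proof.
move=> hF; elim: r => [|i r IH]; first by under eq_fun do rewrite big_nil; exact: regC.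
by under eq_fun do rewrite big_cons; case: (P i) => //; exact: regD.
Qed.

Lemma reg_prod X (W : set X) x I (r : seq I) (P : pred I) (F : I -> X -> K) :
  (forall i, regular_at W x (F i)) -> regular_at W x (fun y => \prod_(i <- r | P i) F i y).
Proof.
move=> hF; elim: r => [|i r IH]; first by under eq_fun do rewrite big_nil; exact: regC.
by under eq_fun do rewrite big_cons; case: (P i) => //; exact: regM.
Qed.

Lemma reg_meval X (W : set X) x m (g : X -> 'I_m -> K) (p : {mpoly K[m]}) :
  (forall k, regular_at W x (g^~ k)) -> regular_at W x (fun y => p.@[g y]).
Proof.
move=> hg; under eq_fun do rewrite mevalE.
apply: reg_sum => a; apply: regM; first exact: regC.
apply: reg_prod => i; elim: (a i) => [|e IH].
  by under eq_fun do rewrite expr0; exact: regC.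
by under eq_fun do rewrite exprS; apply: regM => //; exact: hg.
Qed.

Definition regular_mx_at X (W : set X) x m k (M : X -> 'M[K]_(m, k)) :=
  forall i j, regular_at W x (fun y => M y i j).

Section Regmx.
Variables (X : variety K) (W : set X) (x : X).

Lemma regmxC m k (M : 'M[K]_(m, k)) : regular_mx_at W x (fun=> M).
Proof. by move=> i j; exact: regC. Qed.

Lemma regmx_sub W' m k (M : X -> 'M[K]_(m, k)) : W' `<=` W -> regular_mx_at W x M ->
  regular_mx_at W' x M.
Proof. by move=> WW h i j; apply: reg_sub WW _; exact: h. Qed.

Lemma regmx_near m k (M N : X -> 'M[K]_(m, k)) :
  near_in W x [set y | M y = N y] -> regular_mx_at W x M -> regular_mx_at W x N.
Proof.
move=> h hM i j; apply: reg_near (hM i j); apply: near_mono h => y _ /=.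
by move=> ->.
Qed.

Lemma regmxM m k l (A : X -> 'M[K]_(m, k)) (B : X -> 'M[K]_(k, l)) :
  regular_mx_at W x A -> regular_mx_at W x B -> regular_mx_at W x (fun y => A y *m B y).
Proof.
move=> hA hB i j; under eq_fun do rewrite mxE.
by apply: reg_sum => k'; exact: regM.
Qed.

Lemma regmxD m k (A B : X -> 'M[K]_(m, k)) :
  regular_mx_at W x A -> regular_mx_at W x B -> regular_mx_at W x (fun y => A y + B y).
Proof. by move=> hA hB i j; under eq_fun do rewrite mxE; exact: regD. Qed.

Lemma regmxB m k (A B : X -> 'M[K]_(m, k)) :
  regular_mx_at W x A -> regular_mx_at W x B -> regular_mx_at W x (fun y => A y - B y).
Proof.
move=> hA hB i j; under eq_fun do rewrite mxE [X in _ + X]mxE.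
by apply: regD => //; exact: regN.
Qed.

Lemma regmxZ m k f (A : X -> 'M[K]_(m, k)) :
  regular_at W x f -> regular_mx_at W x A -> regular_mx_at W x (fun y => f y *: A y).
Proof. by move=> hf hA i j; under eq_fun do rewrite mxE; exact: regM. Qed.

Lemma regmxT m k (A : X -> 'M[K]_(m, k)) :
  regular_mx_at W x A -> regular_mx_at W x (fun y => (A y)^T).
Proof. by move=> hA i j; under eq_fun do rewrite mxE; exact: hA. Qed.

Lemma regmx_mxsub m k m' k' (f : 'I_m' -> 'I_m) (g : 'I_k' -> 'I_k) (A : X -> 'M[K]_(m, k)) :
  regular_mx_at W x A -> regular_mx_at W x (fun y => mxsub f g (A y)).
Proof. by move=> hA i j; under eq_fun do rewrite mxE; exact: hA. Qed.

Lemma regmx_col m1 m2 k (A : X -> 'M[K]_(m1, k)) (B : X -> 'M[K]_(m2, k)) :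
  regular_mx_at W x A -> regular_mx_at W x B -> regular_mx_at W x (fun y => col_mx (A y) (B y)).
Proof.
move=> hA hB i j; case: (split_ordP i) => i' ->.
  by under eq_fun do rewrite col_mxEu; exact: hA.
by under eq_fun do rewrite col_mxEd; exact: hB.
Qed.

Lemma regmx_row m k1 k2 (A : X -> 'M[K]_(m, k1)) (B : X -> 'M[K]_(m, k2)) :
  regular_mx_at W x A -> regular_mx_at W x B -> regular_mx_at W x (fun y => row_mx (A y) (B y)).
Proof.
move=> hA hB i j; case: (split_ordP j) => j' ->.
  by under eq_fun do rewrite row_mxEl; exact: hA.
by under eq_fun do rewrite row_mxEr; exact: hB.
Qed.

Lemma regmx_lsub m k1 k2 (A : X -> 'M[K]_(m, k1 + k2)) :
  regular_mx_at W x A -> regular_mx_at W x (fun y => lsubmx (A y)).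
Proof. by move=> hA i j; under eq_fun do rewrite mxE; exact: hA. Qed.

Lemma regmx_rsub m k1 k2 (A : X -> 'M[K]_(m, k1 + k2)) :
  regular_mx_at W x A -> regular_mx_at W x (fun y => rsubmx (A y)).
Proof. by move=> hA i j; under eq_fun do rewrite mxE; exact: hA. Qed.

Lemma regmx_mxvec m k (A : X -> 'M[K]_(m, k)) :
  regular_mx_at W x A -> regular_mx_at W x (fun y => mxvec (A y)).
Proof.
move=> hA i j; case/mxvec_indexP: j => i' j'.
by rewrite ord1; under eq_fun do rewrite mxvecE; exact: hA.
Qed.

Lemma reg_det m (A : X -> 'M[K]_m) : regular_mx_at W x A -> regular_at W x (fun y => \det (A y)).
Proof.
move=> hA; apply: reg_sum => s; apply: regM; first exact: regC.
by apply: reg_prod => i; exact: hA.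
Qed.

Lemma regmx_adj m (A : X -> 'M[K]_m) :
  regular_mx_at W x A -> regular_mx_at W x (fun y => \adj (A y)).
Proof.
move=> hA i j; under eq_fun do rewrite mxE.
apply: regM; first exact: regC; apply: reg_det => i' j'.
by under eq_fun do rewrite !mxE; exact: hA.
Qed.

Lemma near_unitmx m (A : X -> 'M[K]_m) : W x -> regular_mx_at W x A -> A x \in unitmx ->
  near_in W x [set y | A y \in unitmx].
Proof.
move=> Wx hA uA; rewrite unitmxE unitfE in uA.
by apply: near_mono (reg_neq0 Wx (reg_det hA) uA) => y _ /=; rewrite unitmxE unitfE.
Qed.

Lemma regmx_inv m (A : X -> 'M[K]_m) : W x -> regular_mx_at W x A -> A x \in unitmx ->
  regular_mx_at W x (fun y => invmx (A y)).
Proof.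
move=> Wx hA uA.
apply: (@regmx_near _ _ (fun y => (\det (A y))^-1 *: \adj (A y))).
  by apply: near_mono (near_unitmx Wx hA uA) => y _ /= uy; rewrite /invmx uy.
apply: regmxZ; last exact: regmx_adj.
by apply: regV => //; [exact: reg_det|move: uA; rewrite unitmxE unitfE].
Qed.

End Regmx.

(** Regularity of a map defined on all of [X], but only looked at on [W] near [x].
Since [h] may be arbitrary outside of [W], morphisms between subvarieties are
handled without dependent types. *)
Definition regular_map_at X Y (W : set X) (x : X) (h : X -> Y) :=
  exists j, [/\ dom Y j (h x), near_in W x (h @^-1` dom Y j)
              & regular_mx_at W x (fun y => coord Y j (h y))].

Lemma near_comp X Y (W : set X) (W' N : set Y) x h : W x ->
  (forall y, W y -> W' (h y)) -> regular_map_at W x h ->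
  near_in W' (h x) N -> near_in W x (h @^-1` N).
Proof.
move=> Wx hW [j [dj ndj hr]] /(near_chart dj)[Q [Qx hQ]].
have rQ : regular_at W x (fun y => Q.@[coord Y j (h y) 0]) by apply: reg_meval => k; exact: hr.
apply: near_mono (near_and ndj (reg_neq0 Wx rQ Qx)) => y Wy [/= dy Qy].
by apply: hQ => //; exact: hW.
Qed.

Lemma reg_comp X Y (W : set X) (W' : set Y) x h f : W x ->
  (forall y, W y -> W' (h y)) -> regular_map_at W x h ->
  regular_at W' (h x) f -> regular_at W x (fun y => f (h y)).
Proof.
move=> Wx hW hh; have := hh => -[j [dj ndj hr]] /(reg_chart dj)[P [Q [Qx hf]]].
have rm R : regular_at W x (fun y => R.@[coord Y j (h y) 0]) by apply: reg_meval => k; exact: hr.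
apply: reg_near (regM (rm P) (regV Wx (rm Q) Qx)).
by apply: near_mono (near_comp Wx hW hh hf) => y _ /= ->.
Qed.

Lemma regmx_comp X Y (W : set X) (W' : set Y) x h m k (M : Y -> 'M[K]_(m, k)) : W x ->
  (forall y, W y -> W' (h y)) -> regular_map_at W x h ->
  regular_mx_at W' (h x) M -> regular_mx_at W x (fun y => M (h y)).
Proof. by move=> Wx hW hh hM i j; exact: (reg_comp Wx hW hh (hM i j)). Qed.

Lemma regmap_comp X Y (Z : variety K) (W : set X) (W' : set Y) x (h : X -> Y) (k : Y -> Z) : W x ->
  (forall y, W y -> W' (h y)) -> regular_map_at W x h -> regular_map_at W' (h x) k ->
  regular_map_at W x (fun y => k (h y)).
Proof.
move=> Wx hW hh [l [dl ndl hr]]; exists l; split=> //.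
  exact: (near_comp Wx hW hh ndl).
exact: (regmx_comp Wx hW hh hr).
Qed.

Lemma regmap_sub X Y (W W' : set X) x (h : X -> Y) : W' `<=` W -> regular_map_at W x h ->
  regular_map_at W' x h.
Proof.
move=> WW [j [dj ndj hr]]; exists j; split=> //; last exact: regmx_sub hr.
exact: near_sub ndj.
Qed.

(** Being a morphism is a condition on germs: the chart-wise definition follows by
changing charts in the source and in the target. *)
Lemma vmorphismP X Y (h : X -> Y) : (forall x, regular_map_at setT x h) -> vmorphism h.
Proof.
move=> hh i j; split.
  apply/open_inP; split=> [x []//|x [dx dhx]].
  have nj := near_comp (W' := setT) Logic.I (fun=> id) (hh x) (near_dom setT dhx).
  have [Q [Qx hQ]] := near_chart dx nj; exists Q; split=> // y dy Qy; split=> //.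
  exact: hQ.
move=> k x [dx dhx].
have rj := reg_comp (W' := setT) Logic.I (fun=> id) (hh x) (reg_coord setT k dhx).
have [P [Q [Qx hf]]] := reg_chart dx rj; have [S [Sx hS]] := near_chart dx hf.
exists (P * S), (Q * S); rewrite mevalM mulf_neq0 //; split=> // y [dy _].
rewrite !mevalM mulf_eq0 negb_or => /andP[Qy Sy].
by rewrite [LHS](hS y Logic.I dy Sy) -mulf_div divff // mulr1.
Qed.

Lemma regmap_id X (W : set X) x : regular_map_at W x id.
Proof.
have [i dx] := dom_cover x; exists i; split=> //; first exact: near_dom.
by move=> k l; rewrite ord1; exact: reg_coord.
Qed.

Lemma regmap_fst X Y (W : set (vproduct X Y)) x : regular_map_at W x (fst : vproduct X Y -> X).
Proof.
case: x => x y; have [i dx] := dom_cover x; have [j dy] := dom_cover y.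
exists i; split=> //; first by apply: near_mono (@near_dom (vproduct X Y) W (i, j)
  (x, y) _) => // -[a b] _ [].
move=> k l; rewrite ord1.
have := @reg_coord (vproduct X Y) W (x, y) (i, j) (lshift _ l) (conj dx dy).
by apply: reg_near; apply: near_all => p _ /=; rewrite row_mxEl.
Qed.

Lemma regmap_snd X Y (W : set (vproduct X Y)) x : regular_map_at W x (snd : vproduct X Y -> Y).
Proof.
case: x => x y; have [i dx] := dom_cover x; have [j dy] := dom_cover y.
exists j; split=> //; first by apply: near_mono (@near_dom (vproduct X Y) W (i, j)
  (x, y) _) => // -[a b] _ [].
move=> k l; rewrite ord1.
have := @reg_coord (vproduct X Y) W (x, y) (i, j) (rshift _ l) (conj dx dy).
by apply: reg_near; apply: near_all => p _ /=; rewrite row_mxEr.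
Qed.

Lemma regmap_pair X Y (Z : variety K) (W : set X) x (h : X -> Y) (k : X -> Z) :
  regular_map_at W x h -> regular_map_at W x k ->
    regular_map_at W x (fun y => (h y, k y) : vproduct Y Z).
Proof.
move=> [i [di ni ri]] [j [dj nj rj]]; exists (i, j); split=> //=.
  exact: near_and ni nj.
exact: regmx_row.
Qed.

Lemma regmap_affine X (W : set X) x n (M : X -> 'rV[K]_n) :
  regular_mx_at W x M -> regular_map_at W x (M : X -> affine_space K n).
Proof. by move=> rM; exists (tt : chart (affine_space K n)); split=> //;
  exact: (near_all (N := setT)). Qed.

Lemma regmx_affine n (W : set (affine_space K n)) x :
  regular_mx_at W x (fun z : affine_space K n => z : 'rV[K]_n).
Proof. by move=> k l; rewrite ord1; exact: (@reg_coord (affine_space K n) _ _ tt). Qed.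

Lemma regmap_sval X (W : set X) (lcW : vlocally_closed W) (S : set (subvariety lcW)) x :
  regular_map_at S x (@sval _ _ : subvariety lcW -> X).
Proof.
have [i dx] := dom_cover (sval x); exists i; split=> //.
  exact: (near_dom (X := subvariety lcW) S dx).
by move=> k l; rewrite ord1; exact: (@reg_coord (subvariety lcW)).
Qed.

Lemma regmap_into X Y (W : set X) (W' : set Y) (lcW' : vlocally_closed W')
    x (h : X -> subvariety lcW') :
  regular_map_at W x (fun y => sval (h y)) -> regular_map_at W x h.
Proof. by move=> [i [d n r]]; exists i; split. Qed.

Lemma near_open X (W N : set X) x :
  vopen W -> W x -> near_in W x N -> near_in setT x N.
Proof.
move=> /vopenP oW Wx [i [dx [Q [Qx hQ]]]].
apply: near_mono (near_and (oW x Wx) (near_meval setT dx Qx)) => y _ [Wy [dy Qy]].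
exact: hQ.
Qed.

Lemma near_imp X (W N : set X) x :
  near_in W x N -> near_in setT x [set y | W y -> N y].
Proof.
move=> [i [dx [Q [Qx hQ]]]]; exists i; split=> //; exists Q; split=> // y _ dy Qy Wy.
exact: hQ.
Qed.

End Germs.

(** * Classes of locally closed subsets *)

Section Classes.
Variable K : closedFieldType.
Implicit Types X Y Z : variety K.
Local Notation L := (lefschetz K).

Add Ring K0_ring : (K0_ring_theory K).

Lemma K0_cancel (G P x y T : K0 K) :
  (G * P + x * T = G * P + y * T)%K0 -> ((x - y) * T = 0)%K0.
Proof.
move=> e; have -> : ((x - y) * T = (G * P + x * T) - (G * P + y * T))%K0 by ring.
by rewrite e; ring.
Qed.

Lemma vopenT X : vopen [set: X].
Proof. by apply/vopenP => x _; apply: near_all. Qed.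

Lemma vopenI X (U U' : set X) : vopen U -> vopen U' -> vopen (U `&` U').
Proof.
move=> /vopenP oU /vopenP oU'; apply/vopenP => x [/oU nU /oU' nU'].
exact: near_and.
Qed.

Lemma vclosedI X (Z Z' : set X) : vclosed Z -> vclosed Z' -> vclosed (Z `&` Z').
Proof.
move=> /vclosedP cZ /vclosedP cZ'; apply/vclosedP => x /not_andP[/cZ|/cZ'];
  by apply: near_mono => y _ h [? ?]; exact: h.
Qed.

Lemma vopen_lc X (U : set X) : vopen U -> vlocally_closed U.
Proof. by move=> oU; exists U, setT; split=> //; [exact: vclosedT|rewrite setIT]. Qed.

Lemma vlcI X (W W' : set X) :
  vlocally_closed W -> vlocally_closed W' -> vlocally_closed (W `&` W').
Proof.
move=> [U [Z [oU cZ ->]]] [U' [Z' [oU' cZ' ->]]]; exists (U `&` U'), (Z `&` Z').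
by split; [exact: vopenI|exact: vclosedI|rewrite setIACA].
Qed.

Lemma vclosed_preimage X Y (h : X -> Y) (Z : set Y) : (forall x, regular_map_at setT x h) ->
  vclosed Z -> vclosed (h @^-1` Z).
Proof.
move=> hh /vclosedP cZ; apply/vclosedP => x /cZ.
exact: (near_comp (W' := setT) Logic.I (fun=> id) (hh x)).
Qed.

Lemma vlc_preimage X Y (h : X -> Y) (W : set Y) : (forall x, regular_map_at setT x h) ->
  vlocally_closed W -> vlocally_closed (h @^-1` W).
Proof.
move=> hh [U [Z [oU cZ ->]]]; exists (h @^-1` U), (h @^-1` Z); split=> //.
  by rewrite /vopen preimage_setC; exact: vclosed_preimage.
exact: vclosed_preimage.
Qed.

Lemma eq_sval X (W : set X) (lcW : vlocally_closed W) (x y : subvariety lcW) :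
  sval x = sval y -> x = y.
Proof. by case: x y => [x hx] [y hy] /= e; apply: eq_exist. Qed.

(** The value 0 on sets that are not locally closed makes the class a total function
of the set, independent of a proof of local closedness. *)
Definition K0_locus X (W : set X) : K0 K :=
  match pselect (vlocally_closed W) with
  | left lcW => K0_class (subvariety lcW)
  | right _ => 0%K0
  end.

Lemma K0_locusE X (W : set X) (lcW : vlocally_closed W) : K0_locus W = K0_class (subvariety lcW).
Proof. by rewrite /K0_locus; case: pselect => // h; rewrite (Prop_irrelevance h lcW). Qed.

Lemma K0_class_regmap X Y (h : X -> Y) (k : Y -> X) :
  (forall x, regular_map_at setT x h) -> (forall y, regular_map_at setT y k) ->
  cancel h k -> cancel k h -> K0_class X = K0_class Y.
Proof.
by move=> hh hk c1 c2; apply: K0_class_iso; exists h, k; split=> //; exact: vmorphismP.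
Qed.

Lemma K0_classE X : K0_class X = K0_locus [set: X].
Proof.
have lT : vlocally_closed [set: X] by exact: vopen_lc (@vopenT X).
rewrite (K0_locusE lT).
apply: (@K0_class_regmap X (subvariety lT) (fun x => exist _ x Logic.I) (@sval _ _)).
- by move=> x; apply: regmap_into; exact: regmap_id.
- exact: regmap_sval.
- by [].
- by move=> x; exact: eq_sval.
Qed.

(** The maps [h] and [k] live on the ambient varieties, but they only have to be
regular and mutually inverse on the two subsets. *)
Lemma K0_locus_iso X Y (W : set X) (W' : set Y) (h : X -> Y) (k : Y -> X) :
  vlocally_closed W -> vlocally_closed W' ->
  (forall x, W x -> [/\ W' (h x), regular_map_at W x h & k (h x) = x]) ->
  (forall y, W' y -> [/\ W (k y), regular_map_at W' y k & h (k y) = y]) ->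
  K0_locus W = K0_locus W'.
Proof.
move=> lW lW' hW hW'; rewrite (K0_locusE lW) (K0_locusE lW').
pose H (x : subvariety lW) : subvariety lW' :=
  let: And3 a _ _ := hW _ (svalP x) in exist _ (h (sval x)) a.
pose H' (x : subvariety lW') : subvariety lW :=
  let: And3 a _ _ := hW' _ (svalP x) in exist _ (k (sval x)) a.
have EH x : sval (H x) = h (sval x) by rewrite /H; case: (hW _ _).
have EH' x : sval (H' x) = k (sval x) by rewrite /H'; case: (hW' _ _).
apply: (@K0_class_regmap _ _ H H').
- move=> x; apply: regmap_into; rewrite (_ : (fun _ => _) = fun y => h (sval y)); last exact/funext.
  have [_ hh _] := hW _ (svalP x).
  by apply: (regmap_comp (W' := W) Logic.I _ (regmap_sval _ _) hh) => y _; exact: (svalP y).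
- move=> x; apply: regmap_into; rewrite (_ : (fun _ => _) = fun y => k (sval y)); last exact/funext.
  have [_ hh _] := hW' _ (svalP x).
  by apply: (regmap_comp (W' := W') Logic.I _ (regmap_sval _ _) hh) => y _; exact: (svalP y).
- by move=> x; apply: eq_sval; rewrite EH' EH; case: (hW _ (svalP x)).
- by move=> x; apply: eq_sval; rewrite EH EH'; case: (hW' _ (svalP x)).
Qed.

(** A subvariety of a subvariety is a subvariety: this is what turns the scissor
relation inside [subvariety lcW] into a relation between subsets of [X]. *)
Lemma K0_locus_subvariety X (W : set X) (lcW : vlocally_closed W) (S : set (subvariety lcW))
  (T : set X) :
  vlocally_closed S -> vlocally_closed T -> T `<=` W ->
  (forall x, S x <-> T (sval x)) -> K0_locus S = K0_locus T.
Proof.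
move=> lS lT TW ST; rewrite (K0_locusE lT) (K0_locusE lS).
pose H (x : subvariety lS) : subvariety lT := exist _ (sval (sval x)) (proj1 (ST _) (svalP x)).
pose H' (x : subvariety lT) : subvariety lS :=
  let y : subvariety lcW := exist _ (sval x) (TW _ (svalP x)) in
  exist _ y (proj2 (ST y) (svalP x)).
apply: (@K0_class_regmap _ _ H H').
- move=> x; apply: regmap_into.
  exact: (regmap_comp (W' := setT) Logic.I (fun _ _ => Logic.I) (regmap_sval _ _)
    (regmap_sval _ _)).
- by move=> x; apply: regmap_into; apply: regmap_into; exact: regmap_sval.
- by move=> x; do 2 apply: eq_sval.
- by move=> x; exact: eq_sval.
Qed.

(** A relatively open subset of [E] is the trace of an open subset of [X], namely of
the set of points near which [E] is contained in [O]. *)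
Lemma vlc_cut X (E O : set X) : vlocally_closed E ->
  (forall x, E x -> O x -> near_in E x O) ->
  vlocally_closed (E `&` O) /\ vlocally_closed (E `\` O).
Proof.
move=> lE nO; pose U := [set x | near_in setT x [set y | E y -> O y]].
have oU : vopen U by apply/vopenP => x; exact: near_near.
have UE x : E x -> U x <-> O x.
  move=> Ex; split=> [/(near_self Logic.I)/(_ Ex)//|/(nO _ Ex)].
  by move=> [i [dx [Q [Qx hQ]]]]; exists i; split=> //; exists Q; split=> // y _ dy Qy Ey;
    exact: hQ.
have -> : E `&` O = E `&` U by apply/seteqP; split=> x [Ex]; move/(UE _ Ex).
have -> : E `\` O = E `&` ~` U.
  by apply/seteqP; split=> x [Ex nx]; split=> //; move/(UE _ Ex).
split; apply: vlcI => //; first exact: vopen_lc.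
exact: vclosed_locally_closed.
Qed.

(** The scissor relation for a relatively open subset of a locally closed set. *)
Lemma K0_locus_cut X (E O : set X) : vlocally_closed E ->
  (forall x, E x -> O x -> near_in E x O) ->
  K0_locus E = (K0_locus (E `&` O) + K0_locus (E `\` O))%K0.
Proof.
move=> lE nO; have [l1 l2] := vlc_cut lE nO.
pose Z : set (subvariety lE) := ~` ((@sval _ _) @^-1` O).
have cZ : vclosed Z.
  apply/vclosedP => x /contrapT Ox; rewrite /Z setCK.
  apply: (near_comp (W' := E) Logic.I _ (regmap_sval _ _)) => [y _|]; first exact: svalP.
  by apply: nO => //; exact: svalP.
rewrite (K0_locusE lE) (K0_class_scissor cZ) -!K0_locusE.
have -> : K0_locus Z = K0_locus (E `\` O).
  apply: K0_locus_subvariety => //; first exact: vclosed_locally_closed.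
  by move=> x; split=> [h|[]//]; split=> //; exact: svalP.
have -> : K0_locus (~` Z) = K0_locus (E `&` O).
  apply: K0_locus_subvariety => //; first exact: vclosed_locally_closedC.
  move=> x; rewrite /Z setCK; split=> [h|[]//]; split=> //; exact: svalP.
ring.
Qed.

Lemma K0_locus0 X : K0_locus (set0 : set X) = 0%K0.
Proof.
have l0 : vlocally_closed (set0 : set X).
  by apply: vopen_lc; apply/vopenP.
have := @K0_locus_cut X set0 set0 l0 (fun x (h : set0 x) => False_ind _ h).
rewrite setI0 set0D => h.
have -> : K0_locus (set0 : set X) = (K0_locus (set0 : set X) + K0_locus
  (set0 : set X) - K0_locus (set0 : set X))%K0 by ring.
rewrite -h; ring.
Qed.

Lemma vlcX X Y (W : set X) (W' : set Y) : vlocally_closed W -> vlocally_closed W' ->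
  vlocally_closed (W `*` W' : set (vproduct X Y)).
Proof.
move=> lW lW'.
rewrite (_ : _ `*` _ = (fst : vproduct X Y -> X) @^-1` W `&` (snd : vproduct X Y -> Y) @^-1` W')//.
by apply: vlcI; [apply: vlc_preimage lW => x; exact: regmap_fst|apply: vlc_preimage lW' => x;
  exact: regmap_snd].
Qed.

Lemma K0_locusX X Y (W : set X) (W' : set Y) : vlocally_closed W -> vlocally_closed W' ->
  K0_locus (W `*` W' : set (vproduct X Y)) = (K0_locus W * K0_locus W')%K0.
Proof.
move=> lW lW'; have lX := vlcX lW lW'; rewrite (K0_locusE lX) (K0_locusE lW) (K0_locusE lW').
rewrite -K0_class_product.
apply: (@K0_class_regmap (subvariety lX) (vproduct (subvariety lW) (subvariety lW'))
  (fun x => (exist _ (sval x).1 (proj1 (svalP x)), exist _ (sval x).2 (proj2 (svalP x))))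
  (fun y => exist _ (sval y.1, sval y.2) (conj (svalP y.1) (svalP y.2)))).
- move=> x; apply: regmap_pair; apply: regmap_into.
    exact: (regmap_comp (W' := setT) Logic.I (fun _ _ => Logic.I) (regmap_sval _ _)
      (regmap_fst _ _)).
  exact: (regmap_comp (W' := setT) Logic.I (fun _ _ => Logic.I) (regmap_sval _ _) (regmap_snd _ _)).
- move=> x; apply: regmap_into; apply: regmap_pair.
    exact: (regmap_comp (W' := setT) Logic.I (fun _ _ => Logic.I) (regmap_fst _ _)
      (regmap_sval _ _)).
  exact: (regmap_comp (W' := setT) Logic.I (fun _ _ => Logic.I) (regmap_snd _ _) (regmap_sval _ _)).
- by move=> x; apply: eq_sval => /=; case: (sval x).
- by move=> [x y] /=; congr (_, _); exact: eq_sval.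
Qed.

Lemma K0_class_affine n : K0_class (affine_space K n) = (L ^+ n)%K0.
Proof.
elim: n => [|n IH]; first exact: K0_class_point.
rewrite -[(L ^+ n.+1)%K0]/(L * L ^+ n)%K0 -IH -K0_class_product.
apply: (@K0_class_regmap (affine_space K (1 + n)) (vproduct (affine_space K 1) (affine_space K n))
  (fun z => (lsubmx (z : 'rV[K]_(1 + n)), rsubmx (z : 'rV[K]_(1 + n))))
  (fun p => row_mx (p.1 : 'rV[K]_1) p.2)).
- move=> x; apply: regmap_pair; apply: regmap_affine; [apply: regmx_lsub|apply: regmx_rsub];
    exact: (@regmx_affine _ (1 + n)).
- move=> x; apply: regmap_affine; apply: regmx_row.
    apply: (regmx_comp (W' := setT) Logic.I (fun _ _ => Logic.I) (regmap_fst _ _)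
      (regmx_affine _ _)).
  apply: (regmx_comp (W' := setT) Logic.I (fun _ _ => Logic.I) (regmap_snd _ _) (regmx_affine _ _)).
- by move=> z /=; rewrite hsubmxK.
- by move=> [a b] /=; rewrite row_mxKl row_mxKr.
Qed.

End Classes.

(** * Hyperplane sections of projective bundles *)

Section LinearAlgebra.
Variable K : fieldType.

Lemma entry_neq0 m (u : 'rV[K]_m) a : u 0 a != 0 -> u != 0.
Proof. by apply: contraNneq => ->; rewrite mxE eqxx. Qed.

Lemma exists_entry_neq0 m (u : 'rV[K]_m) : u != 0 -> exists a, u 0 a != 0.
Proof.
move=> u0; apply: contrapT => /forallNP h; case/eqP: u0; apply/rowP => a; rewrite [RHS]mxE.
by apply/eqP/negPn/negP; exact: h.
Qed.

Lemma exists_row_neq0 m p (A : 'M[K]_(m, p)) : A != 0 -> exists i, row i A != 0.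
Proof.
move=> A0; apply: contrapT => /forallNP h; case/eqP: A0; apply/row_matrixP => i.
by rewrite row0; apply/eqP/negPn/negP; exact: h.
Qed.

(** A free family of the right size in the left kernel of [A] is a basis of it. *)
Lemma eqmx_kermx k m n (A : 'M[K]_(n, m)) (B : 'M[K]_(k, n)) :
  row_free B -> (n - \rank A = k)%N -> B *m A = 0 -> (kermx A :=: B)%MS.
Proof.
move=> fB rA BA; have BK : (B <= kermx A)%MS by apply/sub_kermxP.
apply/eqmxP/andP; split=> //; have := mxrank_leqif_sup BK.
by rewrite mxrank_ker rA (eqP fB) => h; rewrite -h.2.
Qed.

End LinearAlgebra.

Section Hyperplane.
Variables (K : fieldType) (m : nat).

Definition pairing (phi u : 'rV[K]_m) : K := \sum_j phi 0 j * u 0 j.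

Lemma pairingZ phi a u : pairing phi (a *: u) = a * pairing phi u.
Proof. by rewrite /pairing mulr_sumr; apply: eq_bigr => j _; rewrite mxE mulrCA. Qed.

Lemma pairing0 u : pairing 0 u = 0.
Proof. by rewrite /pairing big1 // => j _; rewrite mxE mul0r. Qed.
End Hyperplane.

Section Solve.
Variables (K : fieldType) (m : nat) (t : 'I_m.+1).
Implicit Types phi v : 'rV[K]_m.+1.

(** The point of the hyperplane [phi = 0] with given coordinates other than the
t-th one, which is obtained by solving the equation. *)
Definition hyperplane_lift phi (u : 'rV[K]_m) : 'rV[K]_m.+1 :=
  \row_j if unlift t j is Some a then u 0 a
         else - (pairing (colsub (lift t) phi) u / phi 0 t).

Lemma colsub_hyperplane_lift phi u : colsub (lift t) (hyperplane_lift phi u) = u.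
Proof. by apply/rowP => a; rewrite !mxE liftK. Qed.

Lemma pairing_lift phi v :
  pairing phi v = phi 0 t * v 0 t + pairing (colsub (lift t) phi) (colsub (lift t) v).
Proof.
rewrite /pairing (bigD1_ord t) //=; congr (_ + _).
by apply: eq_bigr => a _; rewrite !mxE.
Qed.

Lemma pairing_hyperplane_lift phi u : phi 0 t != 0 -> pairing phi (hyperplane_lift phi u) = 0.
Proof.
move=> p0; rewrite pairing_lift colsub_hyperplane_lift mxE unlift_none.
by rewrite mulrN mulrC divfK // addNr.
Qed.

Lemma hyperplane_liftK phi v : phi 0 t != 0 -> pairing phi v = 0 ->
  hyperplane_lift phi (colsub (lift t) v) = v.
Proof.
move=> p0 /eqP; rewrite pairing_lift addrC addr_eq0 => /eqP e.
apply/rowP => j; rewrite mxE; case: unliftP => [a ->|->]; first by rewrite mxE.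
by rewrite e mulNr opprK mulrC mulKf.
Qed.

Lemma hyperplane_lift_neq0 phi u : u != 0 -> hyperplane_lift phi u != 0.
Proof.
apply: contraNneq => e; rewrite -(colsub_hyperplane_lift phi u) e.
by apply/eqP/rowP => a; rewrite !mxE.
Qed.

End Solve.

Section ProjectiveBundles.
Variable K : closedFieldType.
Implicit Types X Y : variety K.
Local Notation L := (lefschetz K).

Add Ring K0_ring_bundles : (K0_ring_theory K).

Definition nonzero m : set (affine_space K m) := [set u : 'rV[K]_m | u != 0].

(** [p : E -> T] is a trivial bundle of projective (m-1)-spaces.  The product of [T]
with a projective space is described by homogeneous coordinates, which avoids
introducing the projective space as a variety: [R x u] is the point over [x]
with homogeneous coordinates [u], [Om a] is the open set where the a-th
coordinate does not vanish, and [N a y] are the coordinates of [y] normalized by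
[u 0 a = 1], the only representatives that can be regular on [Om a]. *)
Record trivial_bundle X Y m (T : set X) (E : set Y) (p : Y -> X)
    (Om : 'I_m -> set Y) (N : 'I_m -> Y -> 'rV[K]_m) (R : X -> 'rV[K]_m -> Y) : Prop := {
  tb_proj : forall y, E y -> T (p y) /\ regular_map_at E y p;
  tb_cover : forall y, E y -> exists a, Om a y;
  tb_open : forall a y, E y -> Om a y -> near_in E y (Om a);
  tb_norm : forall a y, E y -> Om a y -> regular_mx_at E y (N a);
  tb_norm1 : forall a y, E y -> Om a y -> N a y 0 a = 1;
  tb_normK : forall a y, E y -> Om a y -> R (p y) (N a y) = y;
  tb_in : forall x (u : 'rV[K]_m), T x -> u != 0 -> E (R x u) /\ p (R x u) = x;
  tb_dom : forall x (u : 'rV[K]_m) a, T x -> u != 0 -> Om a (R x u) <-> u 0 a != 0;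
  tb_coord : forall x (u : 'rV[K]_m) a, T x -> u 0 a != 0 -> N a (R x u) = (u 0 a)^-1 *: u;
  tb_hom : forall x (u : 'rV[K]_m), T x -> u != 0 ->
    regular_map_at (T `*` @nonzero m : set (vproduct X (affine_space K m))) (x, u)
      (fun q => R q.1 q.2)
}.

Section Theory.
Variables (X Y : variety K) (m : nat) (T : set X) (E : set Y) (p : Y -> X).
Variables (Om : 'I_m -> set Y) (N : 'I_m -> Y -> 'rV[K]_m) (R : X -> 'rV[K]_m -> Y).
Hypothesis tb : trivial_bundle T E p Om N R.

Lemma tb_norm_neq0 a y : E y -> Om a y -> N a y != 0.
Proof. by move=> Ey Oy; apply: (@entry_neq0 _ _ _ a); rewrite (tb_norm1 tb) // oner_eq0. Qed.

Lemma tb_domE a b y : E y -> Om a y -> Om b y <-> N a y 0 b != 0.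
Proof.
move=> Ey Oy; have [Tp _] := tb_proj tb Ey.
by rewrite -{1}(tb_normK tb Ey Oy); exact: (tb_dom tb b Tp (tb_norm_neq0 Ey Oy)).
Qed.

Lemma trivial_bundle_restrict (T' : set X) : T' `<=` T ->
  trivial_bundle T' (E `&` p @^-1` T') p Om N R.
Proof.
move=> TT; split.
- move=> y [Ey Ty]; split=> //; have [_] := tb_proj tb Ey.
  by apply: regmap_sub => z [].
- by move=> y [Ey _]; exact: (tb_cover tb Ey).
- by move=> a y [Ey _] Oy; apply: near_sub (tb_open tb Ey Oy) => // z [].
- by move=> a y [Ey _] Oy; apply: regmx_sub (tb_norm tb Ey Oy) => // z [].
- by move=> a y [Ey _] Oy; exact: (tb_norm1 tb Ey Oy).
- by move=> a y [Ey _] Oy; exact: (tb_normK tb Ey Oy).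
- move=> x u Tx u0; have [Ex px] := tb_in tb (TT _ Tx) u0.
  by split=> //; split=> //=; rewrite px.
- by move=> x u a /TT Tx u0; exact: (tb_dom tb a Tx u0).
- by move=> x u a /TT Tx u0; exact: (tb_coord tb Tx u0).
- move=> x u /TT Tx u0; apply: regmap_sub (tb_hom tb Tx u0) => -[y v] [/= /TT ? ?].
  by split.
Qed.

End Theory.

(** Where [phi] has a nonzero t-th coefficient, the projection from the t-th
coordinate point is an isomorphism from the hyperplane [phi = 0] to a projective
space of one dimension less.  Hence the coordinates other than the t-th one
trivialize [D]. *)
Lemma trivial_bundle_hyperplane X Y m (T : set X) (E D : set Y) (p : Y -> X)
    (Om : 'I_m.+1 -> set Y) N R (phi : X -> 'rV[K]_m.+1) (t : 'I_m.+1) :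
  trivial_bundle T E p Om N R ->
  (forall x, T x -> regular_mx_at T x phi) -> (forall x, T x -> phi x 0 t != 0) ->
  D `<=` E ->
  (forall a y, E y -> Om a y -> D y <-> pairing (phi (p y)) (N a y) = 0) ->
  trivial_bundle T D p (fun a => Om (lift t a))
    (fun a y => colsub (lift t) (N (lift t a) y))
    (fun x u => R x (hyperplane_lift t (phi x) u)).
Proof.
move=> tb rphi phit DE DP.
have ext0 x (u : 'rV[K]_m) : u != 0 ->
  hyperplane_lift t (phi x) u != 0 by exact: hyperplane_lift_neq0.
have extE x (u : 'rV[K]_m) a : hyperplane_lift t (phi x) u 0 (lift t a) = u 0 a.
  by rewrite mxE liftK.
split.
- move=> y Dy; have [Ty hy] := tb_proj tb (DE _ Dy); split=> //.
  exact: regmap_sub hy.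
- move=> y Dy; have Ey := DE _ Dy; have [b Oy] := tb_cover tb Ey.
  case: (unliftP t b) => [a eb|eb]; first by exists a; rewrite -eb.
  subst b; have [a Na] : exists a, N t y 0 (lift t a) != 0.
    apply: contrapT => /forallNP h.
    have Na a : N t y 0 (lift t a) = 0 by apply/eqP/negPn/negP; exact: h.
    have /eqP := proj1 (DP t y Ey Oy) Dy.
    rewrite (pairing_lift t) (tb_norm1 tb) // mulr1 /pairing big1 ?addr0; last first.
      by move=> a _; rewrite !mxE Na mulr0.
    by apply/negP; apply: phit; case: (tb_proj tb Ey).
  by exists a; apply/(tb_domE tb _ Ey Oy).
- move=> a y Dy Oy; apply: near_sub (tb_open tb (DE _ Dy) Oy) => //.
- move=> a y Dy Oy; apply: regmx_mxsub.
  exact: regmx_sub (tb_norm tb (DE _ Dy) Oy).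
- by move=> a y Dy Oy; rewrite mxE (tb_norm1 tb) //; exact: DE.
- move=> a y Dy Oy; have Ey := DE _ Dy; have [Ty _] := tb_proj tb Ey.
  rewrite hyperplane_liftK; [exact: (tb_normK tb Ey Oy)|exact: phit|].
  exact/(DP _ _ Ey Oy).
- move=> x u Tx u0; have [Ex px] := tb_in tb Tx (ext0 x u u0); split=> //.
  have [b Ob] := tb_cover tb Ex; apply/(DP _ _ Ex Ob).
  have ub := proj1 (tb_dom tb b Tx (ext0 x u u0)) Ob.
  rewrite px (tb_coord tb Tx ub) pairingZ pairing_hyperplane_lift ?mulr0 //.
  exact: phit.
- by move=> x u a Tx u0; rewrite -(extE x); exact: (tb_dom tb (lift t a) Tx (ext0 x u u0)).
- move=> x u a Tx u0; rewrite (tb_coord tb Tx) extE //.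
  by apply/rowP => j; rewrite !mxE liftK.
- move=> x u Tx u0; pose W : set (vproduct X (affine_space K m)) := T `*` @nonzero m.
  rewrite -[regular_map_at _ _ _]/(regular_map_at W (x, u) (fun q => R q.1 (hyperplane_lift t
    (phi q.1) q.2))).
  pose h (q : vproduct X (affine_space K m)) : vproduct X (affine_space K m.+1) :=
    (q.1, hyperplane_lift t (phi q.1) q.2).
  have hW q : W q -> (T `*` @nonzero m.+1) (h q) by move=> [Tq uq]; split=> //; exact: ext0.
  have Wq : W (x, u) by [].
  apply: (regmap_comp (h := h) Wq hW _ (tb_hom tb Tx (ext0 x u u0))).
  have rphi' : regular_mx_at W (x, u) (fun q => phi q.1).
    have WT (q : vproduct X (affine_space K m)) : W q -> T q.1 by case.
    exact: (@regmx_comp _ _ _ W T (x, u) fst _ _ phi Wq WT (regmap_fst _ _) (rphi x Tx)).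
  have ru : regular_mx_at W (x, u) (fun q : vproduct X (affine_space K m) => q.2 : 'rV[K]_m).
    exact: (regmx_comp (W' := setT) Wq (fun _ _ => Logic.I) (regmap_snd _ _) (regmx_affine _ _)).
  apply: regmap_pair; first exact: regmap_fst.
  apply: regmap_affine => i j; rewrite ord1; case: (unliftP t j) => [a ->|->].
    by apply: reg_near (ru 0 a); apply: near_all => q _ /=; rewrite extE.
  have rp : regular_at W (x, u) (fun q => pairing (colsub (lift t) (phi q.1)) q.2).
    apply: reg_sum => a; apply: regM; last exact: ru.
    by under eq_fun do rewrite mxE; exact: rphi'.
  have := regN (regM rp (regV Wq (rphi' 0 t) (phit x Tx))).
  by apply: reg_near; apply: near_all => q _ /=; rewrite mxE unlift_none.
Qed.

(** The class of the projective (m-1)-space, which is empty for m = 0. *)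
Fixpoint projective_class m : K0 K :=
  if m is m'.+1 then (L ^+ m' + projective_class m')%K0 else 0%K0.

(** The cell where the first coordinate does not vanish is the product of [T] with an
affine space, and its complement is the hyperplane section by that coordinate,
to which the induction hypothesis applies. *)
Lemma K0_trivial_bundle X Y m (T : set X) (E : set Y) (p : Y -> X)
    (Om : 'I_m -> set Y) N R :
  trivial_bundle T E p Om N R -> vlocally_closed T -> vlocally_closed E ->
  K0_locus E = (K0_locus T * projective_class m)%K0.
Proof.
elim: m => [|m IH] in E Om N R *; move=> tb lT lE.
  rewrite (_ : E = set0); first by rewrite K0_locus0 /=; ring.
  by apply/seteqP; split=> y // Ey; have [[]] := tb_cover tb Ey.
have nO y : E y -> Om ord0 y -> near_in E y (Om ord0) by move=> ??; exact: (tb_open tb).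
have [lO lnO] := vlc_cut lE nO; rewrite (K0_locus_cut lE nO).
have -> : K0_locus (E `\` Om ord0) = (K0_locus T * projective_class m)%K0.
  (* the linear form u_0 *)
  pose phi : X -> 'rV[K]_m.+1 := fun=> delta_mx 0 ord0.
  have e1 x : phi x 0 ord0 = 1 by rewrite mxE !eqxx.
  have e2 x u : pairing (phi x) u = u 0 ord0.
    rewrite (pairing_lift ord0) e1 mul1r /pairing big1 ?addr0 // => a _.
    by rewrite !mxE /= mul0r.
  apply: (IH (E `\` Om ord0) _ _ _ _ lT lnO).
  apply: (@trivial_bundle_hyperplane _ _ _ _ _ _ _ _ _ _ phi ord0 tb).
  - by move=> x _; exact: regmxC.
  - by move=> x _; rewrite e1 oner_eq0.
  - by move=> y [].
  - move=> a y Ey Oy; rewrite e2; split=> [[_]|/eqP N0].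
      by move/(tb_domE tb ord0 Ey Oy)/negP/negPn/eqP.
    by split=> // /(tb_domE tb ord0 Ey Oy); rewrite N0.
have -> : K0_locus (E `&` Om ord0) = (K0_locus T * L ^+ m)%K0; last by rewrite /=; ring.
have lA : vlocally_closed [set: affine_space K m] by apply: vopen_lc; exact: vopenT.
rewrite -K0_class_affine K0_classE -K0_locusX //.
pose one z : 'rV[K]_(1 + m) := row_mx (const_mx 1) z.
have e1 z : one z 0 ord0 = 1.
  have := row_mxEl (const_mx 1 : 'rV[K]_1) z 0 0; rewrite [RHS]mxE => <-.
  by congr (one z _ _); exact: val_inj.
have oneK (v : 'rV[K]_(1 + m)) : v 0 ord0 = 1 -> one (rsubmx v) = v.
  move=> v1; rewrite -[RHS]hsubmxK /one; congr row_mx; apply/rowP => i.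
  by rewrite ord1 !mxE -v1; congr (v _ _); exact: val_inj.
have one0 z : one z != 0 by apply: (@entry_neq0 _ _ _ ord0); rewrite e1 oner_eq0.
apply: (@K0_locus_iso _ _ (vproduct X (affine_space K m)) _ _
   (fun y => (p y, rsubmx (N ord0 y : 'rV[K]_(1 + m))))
   (fun q => R q.1 (one q.2))) => //.
- exact: vlcX.
- move=> y [Ey Oy]; have [Ty hy] := tb_proj tb Ey; split=> //.
    apply: regmap_pair; first by apply: regmap_sub hy => z [].
    apply: regmap_affine; apply: (@regmx_rsub _ _ _ _ _ 1 m).
    by apply: regmx_sub (tb_norm tb Ey Oy) => z [].
  by rewrite /= oneK ?(tb_normK tb) ?(tb_norm1 tb).
- move=> [x z] [/= Tx _]; have [Ex px] := tb_in tb Tx (one0 z).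
  have Ox : Om ord0 (R x (one z)).
    by apply/(tb_dom tb ord0 Tx (one0 z)); rewrite e1 oner_eq0.
  split=> //.
    have Wq : (T `*` setT : set (vproduct X (affine_space K m))) (x, z) by [].
    apply: (regmap_comp (h := fun q : vproduct X (affine_space K m) =>
      (q.1, one q.2) : vproduct X (affine_space K m.+1)) Wq _ _ (tb_hom tb Tx (one0 z))).
      by move=> [x' z'] [Tx' _]; split=> //; exact: one0.
    apply: regmap_pair; first exact: regmap_fst.
    apply: regmap_affine; apply: (@regmx_row _ _ _ _ 1 1 m); first exact: regmxC.
    exact: (regmx_comp (W' := setT) Wq (fun _ _ => Logic.I) (regmap_snd _ _) (regmx_affine _ _)).
  rewrite px (tb_coord tb Tx) ?e1 ?oner_eq0 // invr1 scale1r.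
  by rewrite /one row_mxKr.
Qed.

(** Multiplicativity of classes may be checked locally on the base: the base is cut
along the members of a finite open cover, one after the other. *)
Lemma K0_fibration X Y (p : Y -> X) (D : set Y) (T0 : set X) (c : K0 K)
    (J : finType) (O : J -> set X) :
  (forall y, regular_map_at setT y p) -> vlocally_closed D -> (forall i, vopen (O i)) ->
  (forall i T, vlocally_closed T -> T `<=` T0 -> T `<=` O i ->
    K0_locus (D `&` p @^-1` T) = (K0_locus T * c)%K0) ->
  vlocally_closed T0 -> (forall x, T0 x -> exists i, O i x) ->
  K0_locus (D `&` p @^-1` T0) = (K0_locus T0 * c)%K0.
Proof.
move=> hp lD oO loc lT0 cov.
have ind (s : seq J) T : vlocally_closed T -> T `<=` T0 ->
    (forall x, T x -> exists2 i, i \in s & O i x) ->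
    K0_locus (D `&` p @^-1` T) = (K0_locus T * c)%K0; last first.
  apply: (ind (enum J)) => // x /cov[i Oi]; exists i => //; exact: mem_enum.
elim: s T => [|i s IH] T lT TT covT.
  have -> : T = set0 by apply/seteqP; split=> x // /covT[].
  by rewrite preimage_set0 setI0 !K0_locus0; ring.
have nO x : T x -> O i x -> near_in T x (O i).
  by move=> Tx Ox; apply: near_sub (proj1 (vopenP _) (oO i) x Ox).
have [lTO lTnO] := vlc_cut lT nO; rewrite (K0_locus_cut lT nO).
have lDT : vlocally_closed (D `&` p @^-1` T) by apply: vlcI => //; exact: vlc_preimage.
have nDO y : (D `&` p @^-1` T) y -> (p @^-1` O i) y ->
    near_in (D `&` p @^-1` T) y (p @^-1` O i).
  move=> [Dy Ty] Oy; apply: (near_comp (W' := T)) (nO _ Ty Oy) => //; first by move=> z [].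
  exact: regmap_sub (hp y).
rewrite (K0_locus_cut lDT nDO).
rewrite (_ : _ `&` _ `&` _ = D `&` p @^-1` (T `&` O i)); last by rewrite preimage_setI setIA.
rewrite (_ : _ `\` _ = D `&` p @^-1` (T `\` O i)); last first.
  by apply/seteqP; split=> y [] => [[? ?] ?|? []].
rewrite (loc i) //; last by move=> x [/TT].
rewrite IH //; first by ring.
  by move=> x [/TT].
move=> x [/covT[j]]; rewrite inE => /orP[/eqP->//|js Ojx] _.
by exists j.
Qed.

(** Over [T], the map [p] makes [E] a trivial projective bundle, in which [D] is cut
out by the linear form [phi x] on the fibre over [x]; [Z] is the set of base
points where this form is zero. *)
Definition local_hyperplane X Y (p : Y -> X) m (E D : set Y) (Z T : set X)
    (phi : X -> 'rV[K]_m) :=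
  [/\ forall x, T x -> regular_mx_at T x phi,
      forall x, T x -> Z x <-> phi x = 0
    & exists Om N R, trivial_bundle T (E `&` p @^-1` T) p Om N R /\
        forall (a : 'I_m) y, E y -> T (p y) -> Om a y ->
          D y <-> pairing (phi (p y)) (N a y) = 0].

(** Over [Z] the fibre of [D] is the whole fibre of [E], elsewhere it is a hyperplane
in it, and the classes of these two projective spaces differ by L^m. *)
Lemma K0_hyperplane_fibration X Y (p : Y -> X) m (E D : set Y) (Z : set X)
    (J : finType) (O : J -> set X) :
  (forall y, regular_map_at setT y p) -> vlocally_closed E -> vlocally_closed D -> D `<=` E ->
  vclosed Z -> (forall i, vopen (O i)) -> (forall x, exists i, O i x) ->
  (forall i, exists phi, @local_hyperplane X Y p m.+1 E D Z (O i) phi) ->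
  K0_locus D = (K0_class X * projective_class m + K0_locus Z * L ^+ m)%K0.
Proof.
move=> hp lE lD DE cZ oO cov /choice[phi loc].
have lZ := vclosed_locally_closed cZ; have lnZ := vclosed_locally_closedC cZ.
have nZ x : setT x -> (~` Z) x -> near_in setT x (~` Z).
  by move=> _ nZx; apply: (proj1 (vclosedP _) cZ).
have lX : vlocally_closed [set: X] by apply: vopen_lc; exact: vopenT.
rewrite K0_classE (K0_locus_cut lX nZ) setTI setTD setCK.
have npZ y : D y -> (p @^-1` (~` Z)) y -> near_in D y (p @^-1` (~` Z)).
  move=> _ ny; apply: near_sub (near_comp (W' := setT) Logic.I (fun _ _ => Logic.I) (hp y)
    (nZ _ Logic.I ny)) => //.
rewrite (K0_locus_cut lD npZ).
rewrite (_ : D `\` _ = D `&` p @^-1` Z); last by rewrite setDE -preimage_setC setCK.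
have -> : K0_locus (D `&` p @^-1` Z) = (K0_locus Z * projective_class m.+1)%K0.
  apply: (K0_fibration (O := O)) => // i T lT TZ TO.
  have [_ Zphi [Om [N [R [tb DP]]]]] := loc i.
  have -> : D `&` p @^-1` T = (E `&` p @^-1` O i) `&` p @^-1` T.
    apply/seteqP; split=> y; first by move=> [/DE Ey Ty]; split=> //; split=> //; exact: TO.
    move=> [[Ey Oy] Ty]; split=> //; have [a Oa] := tb_cover tb (conj Ey Oy).
    apply/(DP a) => //; rewrite (proj1 (Zphi _ Oy)) ?pairing0 //; exact: TZ.
  apply: (K0_trivial_bundle (trivial_bundle_restrict tb TO)) => //.
  apply: vlcI; last exact: vlc_preimage.
  by apply: vlcI => //; apply: vlc_preimage => //; exact: vopen_lc.
have -> : K0_locus (D `&` p @^-1` (~` Z)) = (K0_locus (~` Z) * projective_class m)%K0.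
  (* some coefficient of the linear form is nonzero outside of Z *)
  pose O' (it : J * 'I_m.+1) : set X := [set x | O it.1 x /\ phi it.1 x 0 it.2 != 0].
  apply: (K0_fibration (O := O')) => //.
  - move=> [i t]; apply/vopenP => x [/= Ox phix].
    have [rphi _ _] := loc i.
    have := near_open (oO i) Ox (reg_neq0 Ox (rphi x Ox 0 t) phix).
    move=> h; apply: near_mono (near_and h (proj1 (vopenP _) (oO i) x Ox)) => z _ [? ?].
    by split.
  - move=> [i t] T lT TZ TO; have [rphi Zphi [Om [N [R [tb DP]]]]] := loc i.
    have TOi : T `<=` O i by move=> x /TO[].
    have lDT : vlocally_closed (D `&` p @^-1` T) by apply: vlcI => //; exact: vlc_preimage.
    apply: (K0_trivial_bundle _ lT lDT).
    apply: (trivial_bundle_hyperplane (phi := phi i) (t := t) (trivial_bundle_restrict tb TOi)).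
    + by move=> x Tx; exact: (regmx_sub TOi (rphi x (TOi x Tx))).
    + by move=> x /TO[].
    + move=> y [Dy Ty]; split=> //; split; [exact: DE|exact: TOi].
    + move=> a y [[Ey Oy] Ty] Oa; split=> [[Dy _]|]; first exact/DP.
      by move=> e; split=> //; exact/(DP a).
  - move=> x nZx; have [i Oi] := cov x; have [_ Zphi _] := loc i.
    apply: contrapT => /forallNP h; apply: nZx; apply/(Zphi _ Oi)/rowP => t.
    by rewrite mxE; apply/eqP/negPn/negP => pt; apply: (h (i, t)).
rewrite /=; ring.
Qed.

End ProjectiveBundles.

(** * Grassmannians and duality *)

Section Complementary.
Variables (K : fieldType) (n k l : nat) (f : 'I_k -> 'I_n) (g : 'I_l -> 'I_n).

Definition complementary :=
  [/\ injective f, injective g, forall i j, f i != g j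
    & forall c, (exists i, c = f i) \/ (exists j, c = g j)].

Hypothesis fg : complementary.

Lemma mxsub1_inj m (h : 'I_m -> 'I_n) : injective h -> mxsub h h 1%:M = 1%:M :> 'M[K]_m.
Proof. by move=> hi; apply/matrixP => i j; rewrite !mxE (inj_eq hi). Qed.

Lemma mxsub1_disjoint : mxsub f g 1%:M = 0 :> 'M[K]_(k, l).
Proof. by case: fg => _ _ d _; apply/matrixP => i j; rewrite !mxE (negPf (d i j)). Qed.

Lemma mxsub1_disjointC : mxsub g f 1%:M = 0 :> 'M[K]_(l, k).
Proof. by case: fg => _ _ d _; apply/matrixP => i j; rewrite !mxE eq_sym (negPf (d j i)). Qed.

Lemma mul_colsub_rowsub m p q (A : 'M[K]_(m, p)) (h : 'I_p -> 'I_n) (h' : 'I_q -> 'I_n) :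
  colsub h' (A *m rowsub h 1%:M) = A *m mxsub h h' 1%:M.
Proof.
rewrite -mulmx_colsub; congr (_ *m _); apply/matrixP => i j; by rewrite !mxE.
Qed.

(** Reconstruction of a matrix from two complementary sets of columns. *)
Lemma complementary_decomp m (A : 'M[K]_(m, n)) :
  A = colsub f A *m rowsub f 1%:M + colsub g A *m rowsub g 1%:M.
Proof.
case: fg => fi gi d c; apply/matrixP => i j.
have S p (h : 'I_p -> 'I_n) : (colsub h A *m rowsub h 1%:M) i j =
    \sum_a A i (h a) * (h a == j)%:R.
  by rewrite mxE; apply: eq_bigr => a _; rewrite !mxE.
rewrite mxE !S; case: (c j) => -[a ->].
  rewrite (bigD1 a) //= eqxx mulr1 !big1 ?addr0 // => b.
    by move=> _; rewrite eq_sym (negPf (d a b)) mulr0.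
  by move=> ab; rewrite (inj_eq fi) (negPf ab) mulr0.
rewrite addrC (bigD1 a) //= eqxx mulr1 !big1 ?addr0 // => b.
  by move=> _; rewrite (negPf (d b a)) mulr0.
by move=> ab; rewrite (inj_eq gi) (negPf ab) mulr0.
Qed.

End Complementary.

Lemma exists_complementary n k l (f : 'I_k -> 'I_n) : injective f -> (k + l = n)%N ->
  exists g : {ffun 'I_l -> 'I_n}, complementary f g.
Proof.
move=> fi kln; pose C := ~: (f @: 'I_k).
have cC : l = #|C|.
  have := cardsC (f @: 'I_k); rewrite card_imset // !card_ord => e.
  exact: (@addnI k _ _ (etrans kln (esym e))).
exists [ffun j => enum_val (cast_ord cC j)]; split=> //.
- by move=> i j; rewrite !ffunE => /enum_val_inj/cast_ord_inj.
- move=> i j; rewrite ffunE; apply/eqP => e.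
  have := enum_valP (cast_ord cC j); rewrite -e inE => /negP; apply.
  by apply/imsetP; exists i.
- move=> c; case: (boolP (c \in C)) => [cc|nc]; [right|left].
    exists (cast_ord (esym cC) (enum_rank_in cc c)).
    by rewrite ffunE cast_ordKV enum_rankK_in.
  by move: nc; rewrite inE negbK => /imsetP[i _ ->]; exists i.
Qed.

Section Grassmannians.
Variables (K : closedFieldType) (V : vectType K).
Local Notation n := (\dim {:V}).
Local Notation Gr k := (grassmannian V k).

Lemma row_space_rank k l (A : 'M[K]_(k, n)) (U : Gr l) :
  row_space A = val U -> \rank A = l.
Proof. by move=> eA; rewrite -dim_row_space eA (eqP (valP U)). Qed.

Lemma row_space_free k (A : 'M[K]_(k, n)) (U : Gr k) : row_space A = val U -> row_free A.
Proof. by move=> /row_space_rank rA; rewrite /row_free rA. Qed.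

Lemma gr_dom_inj k (f : {ffun 'I_k -> 'I_n}) (U : Gr k) : gr_dom f U -> injective f.
Proof.
move=> [A [fA _]] i j eij; apply/eqP.
have E a : A i (f a) = (i == a)%:R by have /matrixP/(_ i a) := fA; rewrite !mxE.
have := E j; rewrite -eij E eqxx; case: (i == j) => // /eqP.
by rewrite oner_eq0.
Qed.

Lemma gr_dom_vopen k (f : {ffun 'I_k -> 'I_n}) :
  @vopen K (Gr k) (gr_dom f).
Proof. by apply/vopenP => U dU; exact: (near_dom (X := Gr k)). Qed.

Lemma regmx_gr_mat k (f : {ffun 'I_k -> 'I_n}) (W : set (Gr k)) U :
  gr_dom f U -> regular_mx_at W U (gr_mat f).
Proof.
move=> dU i j; have := @reg_coord _ (Gr k) W U f (mxvec_index i j) dU.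
by apply: reg_near; apply: near_all => y _ /=; rewrite mxvecE.
Qed.

(** A map to a Grassmannian is regular as soon as it is locally given by regular
frames: normalizing a frame to the coordinates of a chart only takes the inverse
of one of its square blocks. *)
Lemma regmap_gr k (X : variety K) (W : set X) x (h : X -> Gr k) (M : X -> 'M[K]_(k, n)) :
  W x -> near_in W x [set y | row_space (M y) = val (h y)] -> regular_mx_at W x M ->
    regular_map_at W x h.
Proof.
move=> Wx hM rM; have [f uf] := row_free_colsub (row_space_free (near_self Wx hM)).
have rf : regular_mx_at W x (fun y => colsub f (M y)) by exact: regmx_mxsub.
have nu := near_unitmx Wx rf uf.
have dE y : row_space (M y) = val (h y) -> colsub f (M y) \in unitmx -> gr_dom f (h y).
  by move=> e u; apply/(gr_domP f e (row_space_free e)).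
exists f; split; first exact: dE (near_self Wx hM) uf.
  by apply: near_mono (near_and hM nu) => y _ [/= e u]; exact: dE.
apply: regmx_mxvec.
apply: regmx_near (regmxM (regmx_inv Wx rf uf) rM).
apply: near_mono (near_and hM nu) => y _ [/= e u]; apply/esym/gr_mat_uniq.
  by rewrite -mulmx_colsub mulVmx.
by rewrite row_space_mull // unitmx_inv.
Qed.

Lemma gr_inhabited k : (k <= n)%N -> inhabited (Gr k).
Proof.
move=> kn; have d : \dim (row_space (pid_mx k : 'M[K]_(k, n))) == k.
  by rewrite dim_row_space rank_pid_mx.
by constructor; exists (row_space (pid_mx k : 'M[K]_(k, n))).
Qed.

(** [h] is the orthogonal complement for the standard bilinear form of the coordinates
on [V]: a frame [B] with [B *m A^T = 0] spans the complement of the span of [A]. *)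
Definition orthogonal_map k l (h : Gr k -> Gr l) :=
  forall U (A : 'M[K]_(k, n)) (B : 'M[K]_(l, n)),
    row_space A = val U -> row_free B -> B *m A^T = 0 -> row_space B = val (h U).

Lemma exists_orthogonal_map k l : (k + l = n)%N ->
  exists h : Gr k -> Gr l, orthogonal_map h.
Proof.
move=> kl; have P (U : Gr k) : exists W : Gr l, forall (A : 'M[K]_(k, n)) (B : 'M[K]_(l, n)),
    row_space A = val U -> row_free B -> B *m A^T = 0 -> row_space B = val W.
  have [A [fA eA]] := gr_basis U.
  have rA : (n - \rank A^T = l)%N by rewrite mxrank_tr (eqP fA) -kl addKn.
  have d : \dim (row_space (kermx A^T)) == l by rewrite dim_row_space mxrank_ker rA.
  exists (exist (fun U : {vspace V} => \dim U == l) _ d) => A' B' eA' fB' BA' /=.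
  apply/esym/row_space_eq; apply: (eqmx_kermx fB' rA).
  have [g ug ->] : exists2 g, g \in unitmx & A = g *m A'.
    by apply: row_space_eq_free => //; rewrite eA eA'.
  by rewrite trmx_mul mulmxA BA' mul0mx.
by have [h hP] := choice P; exists h.
Qed.

(** If the columns [f] of the frame M of U form the identity matrix, and M' denotes
the remaining columns, then the matrix with identity columns in the complementary
positions and [- M'^T] in the columns [f] is a frame of the complement of U. *)
Lemma orthogonal_frame k l (f : {ffun 'I_k -> 'I_n}) (U : Gr k) :
  (k + l = n)%N -> gr_dom f U ->
  exists2 B : Gr k -> 'M[K]_(l, n), regular_mx_at setT U B &
    forall U', gr_dom f U' -> row_free (B U') /\ B U' *m (gr_mat f U')^T = 0.
Proof.
move=> kl df; have [g fg] := exists_complementary (gr_dom_inj df) kl.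
exists (fun U' => rowsub g 1%:M - (colsub g (gr_mat f U'))^T *m rowsub f 1%:M).
  apply: regmxB; first exact: regmxC.
  apply: regmxM; last exact: regmxC.
  apply: regmxT; apply: regmx_mxsub; exact: regmx_gr_mat.
move=> U' dU'; have [fM _] := gr_matP dU'; have [fi gi _ _] := fg.
split.
  apply: (@colsub_free _ _ _ _ g).
  rewrite linearB /= mul_colsub_rowsub (mxsub1_disjoint _ fg) mulmx0 subr0.
  by rewrite -(mxsub1_inj K gi); apply/matrixP => i j; rewrite !mxE.
rewrite mulmxBl -mulmxA.
have E p (h : 'I_p -> 'I_n) : rowsub h 1%:M *m (gr_mat f U')^T = (colsub h (gr_mat f U'))^T.
  by rewrite mul_rowsub_mx mul1mx; apply/matrixP => i j; rewrite !mxE.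
by rewrite !E fM trmx1 mulmx1 subrr.
Qed.

Lemma orthogonal_map_regular k l (h : Gr k -> Gr l) : (k + l = n)%N ->
  orthogonal_map h -> forall U, regular_map_at setT U h.
Proof.
move=> kl hP U; have [f df] := gr_cover U; have [B rB BP] := orthogonal_frame kl df.
apply: (regmap_gr (M := B)) => //.
apply: near_mono (near_dom (X := Gr k) (i := f) setT df) => U' _ dU' /=.
have [fB BA] := BP _ dU'; have [_ eM] := gr_matP dU'; exact: hP eM fB BA.
Qed.

Lemma orthogonal_mapK k l (h : Gr k -> Gr l) (h' : Gr l -> Gr k) : (k + l = n)%N ->
  orthogonal_map h -> orthogonal_map h' -> cancel h h'.
Proof.
move=> kl hP hP' U; have [f df] := gr_cover U; have [B rB BP] := orthogonal_frame kl df.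
have [fB BA] := BP _ df; have [_ eM] := gr_matP df.
apply/esym/val_inj; apply: (etrans (esym eM)); apply: (hP' (h U) (B U)).
- exact: hP eM fB BA.
- exact: row_space_free eM.
- by rewrite -[LHS]trmxK trmx_mul trmxK BA trmx0.
Qed.

(** The orthogonal complement is an isomorphism, with inverse of the same kind. *)
Lemma grassmannian_dual k l : (k + l = n)%N -> K0_class (Gr k) = K0_class (Gr l).
Proof.
move=> kl; have lk : (l + k = n)%N by rewrite addnC.
have [h hP] := exists_orthogonal_map kl; have [h' hP'] := exists_orthogonal_map lk.
apply: (@K0_class_regmap _ (Gr k) (Gr l) h h').
- exact: orthogonal_map_regular.
- exact: orthogonal_map_regular.
- exact: orthogonal_mapK.
- exact: orthogonal_mapK.
Qed.

End Grassmannians.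

(** * Linearity of regular homogeneous functions *)

Section RegularOnLine.
Variable K : closedFieldType.
Implicit Types (p q : {poly K}) (k : K -> K).

(** If [p] vanishes everywhere then [p + 1] has no root, hence is constant over an
algebraically closed field. *)
Lemma poly_eq0_closed p : (forall x, p.[x] = 0) -> p = 0.
Proof.
move=> p0; have : size (p + 1) == 1%N.
  apply/negPn/negP => /closed_rootP[x]; rewrite rootE hornerD p0 hornerC add0r.
  by rewrite oner_eq0.
move=> /size_poly1P[c _ ec].
have ep : p = (c - 1)%:P by rewrite polyCB -ec addrK.
by have := p0 0; rewrite ep hornerC => ->.
Qed.

Lemma poly_eq_dense p q r : r != 0 -> (forall x, r.[x] != 0 -> p.[x] = q.[x]) -> p = q.
Proof.
move=> r0 h; apply/eqP; rewrite -subr_eq0.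
have /eqP : (p - q) * r = 0.
  apply: poly_eq0_closed => x; rewrite hornerM hornerD hornerN.
  by case: (eqVneq r.[x] 0) => [->|/h ->]; rewrite ?mulr0 // subrr mul0r.
by rewrite mulf_eq0 (negPf r0) orbF.
Qed.

(** In a representation [k = p / q] with [q] of minimal size, [q] has no root: at a
root of [q], comparison with a local representation of [k] shows that [p] vanishes
as well, and a linear factor can be cancelled. *)
Lemma regular_line_poly k :
  (forall x0, exists p q, q.[x0] != 0 /\ forall x, q.[x] != 0 -> k x = p.[x] / q.[x]) ->
  exists p, forall x, k x = p.[x].
Proof.
move=> hk.
have nz q x : q.[x] != 0 -> q != 0 by apply: contraNneq => ->; rewrite horner0.
suff ind m q p : (size q <= m)%N -> q != 0 ->
    (forall x, q.[x] != 0 -> k x * q.[x] = p.[x]) -> exists p, forall x, k x = p.[x].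
  have [p [q [q0 h]]] := hk 0; apply: (ind (size q) q p) => //; first exact: nz q0.
  by move=> x qx; rewrite h // divfK.
elim: m q p => [|m IH] q p; first by rewrite leqn0 size_poly_eq0 => /eqP->; rewrite eqxx.
move=> sq q0 hq; case: (boolP (size q == 1%N)) => [/size_poly1P[c c0 ec]|].
  exists (c^-1 *: p) => x; rewrite hornerZ -hq ec hornerC //.
  by rewrite mulrC mulfK.
move=> /closed_rootP[x1 rx1]; have [p1 [q1 [q1x h1]]] := hk x1.
have e : p * q1 = p1 * q.
  apply: (@poly_eq_dense _ _ (q * q1)); first by rewrite mulf_neq0 // (nz _ _ q1x).
  move=> x; rewrite !hornerM mulf_eq0 negb_or => /andP[qx q1x'].
  by rewrite -hq // h1 // mulrAC divfK // mulrC mulrA mulrC.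
have rp : root p x1.
  have /(congr1 (fun r => r.[x1])) := e; rewrite !hornerM (rootP rx1) mulr0 => /eqP.
  by rewrite mulf_eq0 (negPf q1x) orbF.
have /factor_theorem[q' eq'] := rx1; have /factor_theorem[p' ep'] := rp.
have X0 : 'X - x1%:P != 0 by rewrite polyXsubC_eq0.
have q'0 : q' != 0 by apply: contraNneq q0 => q'0; rewrite eq' q'0 mul0r.
have e' : p' * q1 = p1 * q'.
  by apply: (mulIf X0); rewrite -[RHS]mulrA -eq' -e ep' mulrAC.
apply: (IH q' p') => // [|x q'x].
  by move: sq; rewrite eq' size_Mmonic ?monicXsubC // size_XsubC addnC.
case: (eqVneq x x1) => [exx|xx1].
  rewrite exx h1 // mulrAC; apply: (mulIf q1x); rewrite divfK //.
  by rewrite -!hornerM e'.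
have xx0 : x - x1 != 0 by rewrite subr_eq0.
apply: (mulIf xx0).
have E r : (r * ('X - x1%:P)).[x] = r.[x] * (x - x1) by rewrite hornerM hornerXsubC.
by rewrite -mulrA -!E -eq' -ep' hq // eq' E mulf_neq0.
Qed.

(** Global sections of O(1) on P^1 are linear forms.  In the two standard charts [F]
is given by polynomials p(x) and p'(y), and homogeneity means p'(y) = y p(1/y),
which bounds the degree of p by 1. *)
Lemma homogeneous_plane_linear (F : K -> K -> K) :
  (forall a x y, a != 0 -> F (a * x) (a * y) = a * F x y) ->
  (exists p, forall x, F x 1 = p.[x]) -> (exists p, forall y, F 1 y = p.[y]) ->
  forall x y, (x != 0) || (y != 0) -> F x y = x * F 1 0 + y * F 0 1.
Proof.
move=> hF [p hp] [p' hp'].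
have inv y : y != 0 -> p'.[y] = y * p.[y^-1].
  by move=> y0; rewrite -hp -hp' -hF // divff // mulr1.
have sp : (size p <= 2)%N.
  rewrite leqNgt; apply/negP => sp.
  (* the reversed polynomial, whose constant term is the leading coefficient of p *)
  pose rp := \poly_(i < size p) p`_((size p).-1 - i).
  have rpE y : y != 0 -> rp.[y] = y ^+ (size p).-1 * p.[y^-1].
    move=> y0; rewrite horner_poly horner_coef mulr_sumr (reindex_inj rev_ord_inj) /=.
    apply: eq_bigr => i _; have li : (i <= (size p).-1)%N by rewrite -ltnS (ltn_predK sp).
    rewrite (_ : (size p - i.+1)%N = ((size p).-1 - i)%N); last first.
      by rewrite -subn1 -subnDA add1n.
    rewrite subKn // exprVn [RHS]mulrCA; congr (_ * _).
    by rewrite -[in RHS](subnK li) exprD mulfK // expf_neq0.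
  have E : p' * 'X^((size p).-2) = rp.
    apply: (@poly_eq_dense _ _ 'X); first by rewrite polyX_eq0.
    move=> y; rewrite hornerX => y0; rewrite hornerM hornerXn inv // rpE //.
    rewrite mulrAC -exprS; congr (_ ^+ _ * _).
    by case: (size p) sp => [|[|[]]].
  have := congr1 (fun r => r.[0]) E; rewrite hornerM hornerXn expr0n.
  have -> : ((size p).-2 == 0)%N = false by case: (size p) sp => [|[|[]]].
  rewrite mulr0 => /esym; rewrite horner_coef0 coef_poly (ltn_trans _ sp) // subn0.
  by move/eqP; rewrite -/(lead_coef p) lead_coef_eq0 => /eqP p0; rewrite p0 size_poly0 in sp.
have pE x : p.[x] = p`_0 + p`_1 * x.
  by rewrite (horner_coef_wide _ sp) big_ord_recl big_ord1 /= expr0 mulr1 expr1.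
have p'E : p' = p`_0 *: 'X + (p`_1)%:P.
  apply: (@poly_eq_dense _ _ 'X); first by rewrite polyX_eq0.
  move=> y; rewrite hornerX => y0; rewrite inv // pE hornerD hornerZ hornerX hornerC.
  by rewrite mulrDr mulrCA divff // mulr1 mulrC.
have F10 : F 1 0 = p`_1 by rewrite hp' p'E hornerD hornerZ hornerX hornerC mulr0 add0r.
have F01 : F 0 1 = p`_0 by rewrite hp pE mulr0 addr0.
move=> x y; case: (eqVneq y 0) => [->|y0] /=.
  rewrite orbF => x0; rewrite mul0r addr0 -hF //; congr F; by rewrite ?mulr1 ?mulr0.
move=> _; have := hF y (x / y) 1 y0; rewrite mulr1 mulrCA divff // mulr1 => ->.
by rewrite hp pE F10 F01 mulrDr [y * (_ * _)]mulrCA [y *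
  (_ / _)]mulrCA divff // mulr1 addrC [x * _]mulrC.
Qed.

Lemma mpoly1_poly (P : {mpoly K[1]}) :
  exists p, forall x : 'rV[K]_1, P.@[x 0] = p.[x 0 0].
Proof.
exists (\sum_(m <- msupp P) (P@_m)%:P * \prod_i 'X^(m i)) => x.
rewrite mevalE horner_sum; apply: eq_bigr => m _; rewrite hornerM hornerC; congr (_ * _).
by rewrite horner_prod; apply: eq_bigr => i _; rewrite hornerXn ord1.
Qed.

Lemma regular_affine_line (f : affine_space K 1 -> K) :
  (forall x, regular_at setT x f) -> exists p, forall x, f (const_mx x : 'rV[K]_1) = p.[x].
Proof.
move=> rf; apply: regular_line_poly => x0.
have [P [Q [Qx h]]] := @reg_chart _ (affine_space K 1) _ _ _ tt Logic.I (rf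
  (const_mx x0 : 'rV[K]_1)).
have [S [Sx hS]] := @near_chart _ (affine_space K 1) _ _ _ tt Logic.I h.
have [p ep] := mpoly1_poly P; have [q eq] := mpoly1_poly Q; have [s es] := mpoly1_poly S.
move: Qx Sx; rewrite /= eq es !mxE => qx sx.
exists (p * s), (q * s); rewrite hornerM mulf_neq0 //; split=> // x.
rewrite !hornerM mulf_eq0 negb_or => /andP[qx' sx'].
rewrite [LHS](hS (const_mx x : 'rV[K]_1) Logic.I Logic.I) ?es ?mxE //=.
by rewrite ep eq !mxE -mulf_div divff // mulr1.
Qed.

End RegularOnLine.

Section Additive.
Variables (K : closedFieldType) (k N : nat) (A : 'M[K]_(k, N)) (F : 'rV[K]_N -> K).
Hypothesis fA : row_free A.
Hypothesis F_shift : forall v w : 'rV_N, (w <= A)%MS -> F (v + w) = F v.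
Hypothesis F_scale : forall a v, a != 0 -> F (a *: v) = a * F v.
Hypothesis F_sub : forall v : 'rV_N, (v <= A)%MS -> F v = 0.
Hypothesis F_reg : forall r : affine_space K 1 -> 'rV[K]_N,
  (forall z, regular_mx_at setT z r) -> (forall z, row_free (col_mx A (r z))) ->
  forall z, regular_at setT z (fun z => F (r z)).

Lemma row_free_col_mx m (B : 'M[K]_(m, N)) (v : 'rV[K]_N) :
  row_free B -> ~~ (v <= B)%MS -> row_free (col_mx B v).
Proof.
move=> fB nv; apply: inj_row_free => u; rewrite -[u]hsubmxK mul_row_col => e.
have d0 : rsubmx u = 0.
  apply/eqP; apply: contraNT nv => d0.
  have d00 : rsubmx u 0 0 != 0.
    by apply: contraNneq d0 => d0; apply/eqP/rowP => i; rewrite ord1 d0 mxE.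
  rewrite (_ : v = (- (rsubmx u 0 0)^-1 *: lsubmx u) *m B) ?submxMl //.
  have er : rsubmx u *m v = rsubmx u 0 0 *: v by rewrite {1}[rsubmx u]mx11_scalar mul_scalar_mx.
  move/eqP: e; rewrite addr_eq0 er => /eqP e.
  by rewrite -scalemxAl e scalerN scaleNr opprK scalerA mulVf // scale1r.
move: e; rewrite d0 mul0mx addr0 => /eqP; rewrite mulmx_free_eq0 // => /eqP ->.
by rewrite row_mx0.
Qed.

Lemma row_free_pencil (v1 v2 : 'rV[K]_N) x y : row_free (col_mx (col_mx A v1) v2) ->
  (x != 0) || (y != 0) -> row_free (col_mx A (x *: v1 + y *: v2)).
Proof.
move=> f12 xy; apply: inj_row_free => u; rewrite -[u]hsubmxK mul_row_col.
set r := rsubmx u; rewrite mulmxDr -!scalemxAr !scalemxAl => e.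
have /eqP : row_mx (row_mx (lsubmx u) (x *: r)) (y *: r) *m col_mx (col_mx A v1) v2 = 0.
  by rewrite !mul_row_col -[RHS]e addrA.
rewrite mulmx_free_eq0 // => /eqP e0.
have := e0; rewrite -[0 in RHS]row_mx0 => /eq_row_mx[];
  rewrite -[0 in RHS]row_mx0 => /eq_row_mx[-> xr yr].
suff -> : r = 0 by rewrite row_mx0.
by case/orP: xy => z0; apply: (scalerI z0); rewrite scaler0.
Qed.

Lemma additive_on_pencil (v1 v2 : 'rV[K]_N) : row_free (col_mx (col_mx A v1) v2) ->
  F (v1 + v2) = F v1 + F v2.
Proof.
move=> f12; pose G x y := F (x *: v1 + y *: v2).
have := @homogeneous_plane_linear _ G _ _ _ 1 1.
rewrite /G !scale1r !scale0r addr0 add0r !mul1r; apply; rewrite ?oner_eq0 //.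
- by move=> a x y a0; rewrite -!scalerA -scalerDr F_scale.
- have [|p hp] := @regular_affine_line _ (fun z => F ((z : 'rV_1) 0 0 *: v1 + 1 *: v2)).
    apply: (F_reg (r := fun z => (z : 'rV_1) 0 0 *: v1 + 1 *: v2)) => z.
      apply: regmxD; last exact: regmxC.
      by apply: regmxZ; [exact: regmx_affine|exact: regmxC].
    by apply: row_free_pencil => //; rewrite oner_eq0 orbT.
  by exists p => x; rewrite -hp mxE scale1r.
- have [|p hp] := @regular_affine_line _ (fun z => F (1 *: v1 + (z : 'rV_1) 0 0 *: v2)).
    apply: (F_reg (r := fun z => 1 *: v1 + (z : 'rV_1) 0 0 *: v2)) => z.
      apply: regmxD; first exact: regmxC.
      by apply: regmxZ; [exact: regmx_affine|exact: regmxC].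
    by apply: row_free_pencil => //; rewrite oner_eq0.
  by exists p => x; rewrite -hp mxE scale1r.
Qed.

Lemma homogeneous_scale a v : F (a *: v) = a * F v.
Proof.
case: (eqVneq a 0) => [->|/F_scale//].
by rewrite scale0r mul0r F_sub // sub0mx.
Qed.

(** If [v1] and [v2] are independent modulo the span of [A], they span a pencil to
which [additive_on_pencil] applies; otherwise additivity is a formal consequence
of homogeneity and of invariance under translation by the span of [A]. *)
Lemma regular_homogeneous_additive v1 v2 : F (v1 + v2) = F v1 + F v2.
Proof.
case: (boolP (v1 <= A)%MS) => [v1A|nv1].
  by rewrite addrC F_shift // (F_sub v1A) add0r.
have f1 := row_free_col_mx fA nv1.
case: (boolP (v2 <= col_mx A v1)%MS) => [/submxP[D]|nv2]; last first.
  by apply: additive_on_pencil; exact: row_free_col_mx.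
rewrite -[D]hsubmxK mul_row_col [rsubmx D]mx11_scalar mul_scalar_mx => ->.
rewrite [_ + _ *: v1]addrC addrA !(F_shift _ (submxMl _ _)).
by rewrite -{1}[v1]scale1r -scalerDl !homogeneous_scale mulrDl mul1r.
Qed.

End Additive.

(** * Linearity of sections of O(1,1) along the fibres *)

Section KernelBasis.
Variables (K : fieldType) (k : nat).

(** If [u 0 a != 0], the rows are a basis of the hyperplane orthogonal to [u], which
depends polynomially on [u]. *)
Definition kernel_basis (a : 'I_k.+1) (u : 'rV[K]_k.+1) : 'M[K]_(k, k.+1) :=
  \matrix_(j, i) (u 0 a * (lift a j == i)%:R - u 0 (lift a j) * (a == i)%:R).

Lemma kermx_vector (C : 'M[K]_(k, k.+1)) (u : 'rV[K]_k.+1) :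
  row_free C -> u != 0 -> C *m u^T = 0 -> (kermx u^T :=: C)%MS.
Proof.
move=> fC u0; apply: eqmx_kermx => //.
by rewrite mxrank_tr rank_rV u0 subn1.
Qed.

Lemma mulmx_trE p (C : 'M[K]_(p, k.+1)) (u : 'rV[K]_k.+1) j a :
  (C *m u^T) j 0 = C j a * u 0 a + \sum_i C j (lift a i) * u 0 (lift a i).
Proof.
rewrite mxE (bigD1_ord a) //= mxE; congr (_ + _).
by apply: eq_bigr => i _; rewrite mxE.
Qed.

(** A hyperplane in echelon form determines its orthogonal vector up to a scalar. *)
Lemma kernel_vector_coord (C : 'M[K]_(k, k.+1)) (u : 'rV[K]_k.+1) a :
  colsub (lift a) C = 1%:M -> C *m u^T = 0 ->
  forall j, u 0 (lift a j) = - C j a * u 0 a.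
Proof.
move=> C1 Cu j; have /matrixP/(_ j 0) := Cu; rewrite (mulmx_trE _ _ _ a) mxE.
rewrite (bigD1 j) //= big1 => [|i ij]; last first.
  have /matrixP/(_ j i) := C1; rewrite !mxE [j == i]eq_sym (negPf ij) => ->.
  by rewrite mul0r.
have /matrixP/(_ j j) := C1; rewrite !mxE eqxx => ->.
by rewrite addr0 mul1r mulNr => /eqP; rewrite addrC addr_eq0 => /eqP.
Qed.

Lemma kernel_basis_colsub (u : 'rV[K]_k.+1) a : colsub (lift a) (kernel_basis a u) = (u 0 a)%:M.
Proof.
apply/matrixP => i j; rewrite !mxE (inj_eq lift_inj) (negPf (neq_lift a j)) mulr0 subr0.
by rewrite mulr_natr.
Qed.

Lemma kernel_basis_mul (u : 'rV[K]_k.+1) a : kernel_basis a u *m u^T = 0.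
Proof.
apply/matrixP => j i; rewrite ord1 (mulmx_trE _ _ _ a) [RHS]mxE.
rewrite mxE eqxx mulr1 [lift a j == a]eq_sym (negPf (neq_lift a j)) mulr0 sub0r.
rewrite (bigD1 j) //= big1 => [|l lj]; last first.
  by rewrite mxE (inj_eq lift_inj) eq_sym (negPf lj) (negPf (neq_lift a l)) !mulr0 subr0 mul0r.
by rewrite mxE eqxx (negPf (neq_lift a j)) mulr0 subr0 mulr1 addr0 mulNr mulrC addNr.
Qed.

Lemma kernel_basis_free (u : 'rV[K]_k.+1) a : u 0 a != 0 -> row_free (kernel_basis a u).
Proof.
move=> ua; apply/row_freeP; exists (colsub (lift a) 1%:M *m (u 0 a)^-1%:M).
rewrite mulmxA mulmx_colsub mulmx1 kernel_basis_colsub -scalar_mxM divff //.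
Qed.

Lemma exists_kernel_vector (C : 'M[K]_(k, k.+1)) : row_free C ->
  exists u : 'rV[K]_k.+1, u != 0 /\ C *m u^T = 0.
Proof.
move=> fC; have [i ui] : exists i, row i (kermx C^T) != 0.
  by apply: exists_row_neq0; rewrite -mxrank_eq0 mxrank_ker mxrank_tr (eqP fC) subSnn.
exists (row i (kermx C^T)); split=> //.
by rewrite -[LHS]trmxK trmx_mul trmxK -row_mul mulmx_ker row0 trmx0.
Qed.

End KernelBasis.

Section Sections.
Variables (K : closedFieldType) (V : vectType K) (s : section11 V).
Local Notation n := (\dim {:V}).

Lemma section_equivariant A B (g : 'M_2) (h : 'M_3) : g \in unitmx -> h \in unitmx ->
  s (g *m A, h *m B) = \det g * \det h * s (A, B).
Proof. by case: (section11P s) => _ es _; exact: es. Qed.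

Lemma section_nonfree A B : ~~ row_free A -> s (A, B) = 0.
Proof. by case: (section11P s) => _ _ s0 /negP nA; apply: s0 => -[]. Qed.

(** Sections are given on frames, so they are evaluated on any variety along regular
families of frames. *)
Lemma reg_section (X : variety K) (W : set X) x (A : X -> 'M_(2, n)) (B : X -> 'M_(3, n)) :
  W x -> regular_mx_at W x A -> regular_mx_at W x B ->
  near_in W x [set y | flag_frame (A y, B y)] -> regular_at W x (fun y => s (A y, B y)).
Proof.
move=> Wx rA rB nF; have [rs _ _] := section11P s.
have [P [Q [Qx h]]] := rs _ (near_self Wx nF).
have rm R : regular_at W x (fun y => R.@[frame_coord (A y, B y) 0]).
  by apply: reg_meval => k; apply: regmx_row; exact: regmx_mxvec.
apply: reg_near (regM (rm P) (regV Wx (rm Q) Qx)).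
apply: near_mono (near_and nF (reg_neq0 Wx (rm Q) Qx)) => y _ [Fy Qy] /=.
by rewrite h.
Qed.

Lemma unitmx_lblock k (c : 'rV[K]_k) a : a != 0 ->
  (block_mx 1%:M 0 c a%:M : 'M_(k + 1)) \in unitmx.
Proof. by move=> a0; rewrite unitmxE det_lblock det1 mul1r det_scalar1 unitfE. Qed.

Lemma det_lblock1 k (c : 'rV[K]_k) a : \det (block_mx 1%:M 0 c a%:M : 'M_(k + 1)) = a.
Proof. by rewrite det_lblock det1 mul1r det_scalar1. Qed.

Lemma mul_lblock_col k m (A : 'M[K]_(k, m)) (v : 'rV_m) c a :
  block_mx 1%:M 0 c a%:M *m col_mx A v = col_mx A (a *: v + c *m A).
Proof. by rewrite mul_block_col mul1mx mul0mx addr0 mul_scalar_mx addrC. Qed.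

(** The change of basis of W that fixes the basis of U has determinant [a]. *)
Lemma p_push_affine A c a v : a != 0 ->
  p_push s A (a *: v + c *m A) = a * p_push s A v.
Proof.
move=> a0; rewrite /p_push -{1}[A]mul1mx -mul_lblock_col.
rewrite section_equivariant ?unitmx1 //; last exact: (@unitmx_lblock 2).
by rewrite det1 mul1r (@det_lblock1 2).
Qed.

Lemma flag_frame_col A v : row_free (col_mx A v : 'M_(2 + 1, n)) ->
  flag_frame (V := V) (A, col_mx A v).
Proof.
move=> f; have Acol : (A <= col_mx A v)%MS by rewrite -addsmxE addsmxSl.
split=> //=; last by rewrite row_space_sub.
apply: inj_row_free => u uA.
have : row_mx u 0 *m col_mx A v = 0 by rewrite mul_row_col uA mul0mx addr0.
by move/eqP; rewrite mulmx_free_eq0 // => /eqP; rewrite -[0 in RHS]row_mx0 => /eq_row_mx[].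
Qed.

(** The linear form [p_push s A] on V: regularity and equivariance of [s] are exactly
the hypotheses of [regular_homogeneous_additive]. *)
Lemma p_pushD A v1 v2 : row_free A -> p_push s A (v1 + v2) = p_push s A v1 + p_push s A v2.
Proof.
move=> fA; apply: (regular_homogeneous_additive fA).
- by move=> v w /submxP[c ->]; have := p_push_affine A c v (oner_neq0 K); rewrite scale1r mul1r.
- by move=> a v a0; have := p_push_affine A 0 v a0; rewrite mul0mx addr0.
- exact: p_push_sub0.
- move=> r rr fr z; apply: reg_section => //; first exact: regmxC.
    by apply: (@regmx_col _ _ _ _ 2 1); [exact: regmxC|exact: rr].
  by apply: near_all => y _; exact: flag_frame_col.
Qed.

Lemma p_pushZ A a v : row_free A -> p_push s A (a *: v) = a * p_push s A v.
Proof.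
move=> fA; case: (eqVneq a 0) => [->|a0].
  by rewrite scale0r mul0r p_push_sub0 // sub0mx.
by have := p_push_affine A 0 v a0; rewrite mul0mx addr0.
Qed.

Lemma p_push_sum A m (u : 'rV[K]_m) (G : 'M[K]_(m, n)) : row_free A ->
  p_push s A (u *m G) = \sum_j p_push s A (row j G) * u 0 j.
Proof.
move=> fA; rewrite mulmx_sum_row.
elim/big_rec2: _ => [|j y1 y2 _ IH]; first by rewrite p_push_sub0 // sub0mx.
by rewrite p_pushD // p_pushZ // IH mulrC.
Qed.

Section QSide.
Variable B : 'M[K]_(3, n).
Hypothesis fB : row_free B.

(** For a fixed basis [B] of W, the section as a function of a basis of U in the
coordinates of W.  It turns out to be bilinear and alternating. *)
Definition bisection (r1 r2 : 'rV[K]_3) : K := s ((col_mx r1 r2 : 'M_(2, 3)) *m B, B).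

Lemma bisection_mul (g : 'M_2) (C : 'M_(2, 3)) : g \in unitmx ->
  s (g *m C *m B, B) = \det g * s (C *m B, B).
Proof.
move=> ug; rewrite -mulmxA -{2}[B]mul1mx section_equivariant ?unitmx1 //.
by rewrite det1 mulr1.
Qed.

Lemma bisection_nonfree r1 r2 : ~~ row_free (col_mx r1 r2 : 'M_(1 + 1, 3)) -> bisection r1 r2 = 0.
Proof.
move=> nf; apply: section_nonfree; apply: contra nf => f; apply: inj_row_free => u e.
by apply/eqP; rewrite -(mulmx_free_eq0 _ f) mulmxA e mul0mx.
Qed.

Lemma bisection_affine r1 r2 c a : a != 0 ->
  bisection r1 (a *: r2 + c *m r1) = a * bisection r1 r2.
Proof.
move=> a0; rewrite /bisection -(@mul_lblock_col 1) bisection_mul ?(@unitmx_lblock 1) //.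
by rewrite (@det_lblock1 1).
Qed.

Lemma bisection_sub r1 r2 : (r2 <= r1)%MS -> bisection r1 r2 = 0.
Proof.
move=> r21; apply: bisection_nonfree; rewrite /row_free.
have : (\rank (col_mx r1 r2) <= 1)%N by rewrite -addsmxE (addsmx_idPl r21) rank_leq_row.
by case: eqP => // ->.
Qed.

Lemma bisectionD r1 r2 r3 : bisection r1 (r2 + r3) = bisection r1 r2 + bisection r1 r3.
Proof.
case: (eqVneq r1 0) => [->|r10].
  have z r : bisection 0 r = 0.
    apply: bisection_nonfree; rewrite /row_free -addsmxE adds0mx neq_ltn.
    by rewrite ltnS rank_leq_row.
  by rewrite !z addr0.
have f1 : row_free r1 by rewrite /row_free rank_rV r10.
apply: (regular_homogeneous_additive f1).
- by move=> v w /submxP[c ->]; have := bisection_affine r1 v c (oner_neq0 K); rewrite scale1r mul1r.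
- by move=> a v a0; have := bisection_affine r1 v 0 a0; rewrite mul0mx addr0.
- exact: bisection_sub.
- move=> r rr fr z; apply: reg_section => //; last 1 first.
  + apply: near_all => y _; split=> //=; last by rewrite row_space_sub submxMl.
    apply: inj_row_free => u /eqP; rewrite mulmxA mulmx_free_eq0 //.
    by rewrite (mulmx_free_eq0 _ (fr y)) => /eqP.
  + apply: regmxM; last exact: regmxC.
    by apply: (@regmx_col _ _ _ _ 1 1); [exact: regmxC|exact: rr].
  + exact: regmxC.
Qed.

Lemma bisection_shiftl r1 r2 : bisection (r1 + r2) r2 = bisection r1 r2.
Proof.
have d : \det (block_mx 1%:M 1%:M 0 1%:M : 'M[K]_(1 + 1)) = 1.
  by rewrite det_ublock !det1 mul1r.
have e : col_mx (r1 + r2) r2 = block_mx 1%:M 1%:M 0 1%:M *m col_mx r1 r2.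
  by rewrite mul_block_col !mul1mx mul0mx add0r.
by rewrite /bisection e bisection_mul ?unitmxE d ?unitr1 // mul1r.
Qed.

Lemma bisectionZ r1 r2 a : bisection r1 (a *: r2) = a * bisection r1 r2.
Proof.
case: (eqVneq a 0) => [->|a0].
  by rewrite scale0r mul0r bisection_sub // sub0mx.
by have := bisection_affine r1 r2 0 a0; rewrite mul0mx addr0.
Qed.

Lemma bisection_shift r1 r2 a : bisection r1 (r2 + a *: r1) = bisection r1 r2.
Proof.
by have := bisection_affine r1 r2 a%:M (oner_neq0 K); rewrite mul_scalar_mx scale1r mul1r.
Qed.

(** Antisymmetry: exchanging two vectors amounts to three transvections, of
determinant 1, and a change of sign. *)
Lemma bisectionC r1 r2 : bisection r1 r2 = - bisection r2 r1.
Proof.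
rewrite -bisection_shiftl -(bisection_shift _ r2 (-1)).
rewrite (_ : r2 + -1 *: (r1 + r2) = -1 *: r1); last first.
  by rewrite scaleN1r opprD addrCA addrN addr0 scaleN1r.
by rewrite bisectionZ mulN1r addrC bisection_shiftl.
Qed.

(** The coordinates in [B] of the vector [q_push s B] of W. *)
Definition q_coords : 'rV[K]_3 :=
  \row_i s (rowsub (fun j : 'I_2 => i + lift ord0 j) B, B).

Lemma q_pushE : q_push s B = q_coords *m B.
Proof. by rewrite mulmx_sum_row; apply: eq_bigr => i _; rewrite mxE. Qed.

Lemma q_push_eq0 : q_push s B = 0 <-> q_coords = 0.
Proof.
rewrite q_pushE; split=> [/eqP|->]; last by rewrite mul0mx.
by rewrite mulmx_free_eq0 // => /eqP.
Qed.

Local Notation e i := (delta_mx 0 i : 'rV[K]_3).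

Lemma rowsub1_pair (f : 'I_2 -> 'I_3) :
  rowsub f 1%:M = col_mx (e (f ord0)) (e (f ord_max)) :> 'M[K]_(1 + 1, 3).
Proof.
apply/matrixP => i j; rewrite mxE; case: (split_ordP i) => i' ->.
  by rewrite col_mxEu !mxE !ord1 eqxx /= eq_sym; congr ((_ == f _)%:R); exact: val_inj.
by rewrite col_mxEd !mxE !ord1 eqxx /= eq_sym; congr ((_ == f _)%:R); exact: val_inj.
Qed.

Lemma q_coordsE (i j k : 'I_3) : i + 1 = j -> j + 1 = k ->
  q_coords 0 i = bisection (e j) (e k).
Proof.
move=> <- <-; rewrite mxE -[X in rowsub _ X]mul1mx -mul_rowsub_mx rowsub1_pair /bisection.
have -> : lift ord0 (ord0 : 'I_2) = 1 :> 'I_3 by exact: val_inj.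
have -> : lift ord0 (ord_max : 'I_2) = 1 + 1 :> 'I_3 by exact: val_inj.
by rewrite addrA.
Qed.

Lemma kernel_basis_rows (a : 'I_3) (u : 'rV[K]_3) :
  kernel_basis a u = col_mx (u 0 a *: e (lift a ord0) - u 0 (lift a ord0) *: e a)
                            (u 0 a *: e (lift a ord_max) - u 0 (lift a ord_max) *: e a)
  :> 'M[K]_(1 + 1, 3).
Proof.
apply/matrixP => i j; rewrite mxE; case: (split_ordP i) => i' ->.
  rewrite col_mxEu !mxE !ord1 eqxx /= [j == a]eq_sym [j == _]eq_sym.
  by rewrite (_ : lshift 1 0 = ord0) //; exact: val_inj.
rewrite col_mxEd !mxE !ord1 eqxx /= [j == a]eq_sym [j == _]eq_sym.
by rewrite (_ : rshift 1 0 = ord_max) //; exact: val_inj.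
Qed.

Lemma bisection_diag r : bisection r r = 0.
Proof. exact: bisection_sub. Qed.

Lemma bisectionDl r1 r2 r3 : bisection (r1 + r2) r3 = bisection r1 r3 + bisection r2 r3.
Proof. by rewrite bisectionC bisectionD opprD -!bisectionC. Qed.

Lemma bisectionZl r1 r2 a : bisection (a *: r1) r2 = a * bisection r1 r2.
Proof. by rewrite bisectionC bisectionZ -mulrN -bisectionC. Qed.

(** Evaluated at the hyperplane of W with equation [u], the section is, up to an
invertible factor, the linear form in [u] with coefficients [q_coords].  This is
the expansion of the alternating form [bisection] on [kernel_basis a u]. *)
Lemma section_kernel_basis (a : 'I_3) (u : 'rV[K]_3) :
  s (kernel_basis a u *m B, B) = (-1) ^+ a * u 0 a * pairing q_coords u.
Proof.
set p := lift a ord0; set q := lift a ord_max.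
have -> : s (kernel_basis a u *m B, B) = u 0 a * (u 0 a * bisection (e p) (e q)
    + u 0 q * bisection (e a) (e p) + u 0 p * bisection (e q) (e a)).
  rewrite kernel_basis_rows -/(bisection _ _) -/p -/q -!scaleNr.
  rewrite !(bisectionD, bisectionDl, bisectionZ, bisectionZl) bisection_diag.
  rewrite (bisectionC (e p) (e a)) (bisectionC (e a) (e q)).
  by rewrite !mulr0 addr0 !mulNr !mulrN !opprK !mulrDr mulrCA -!addrA; congr (_ + _);
    rewrite addrC; congr (_ + _); rewrite mulrCA.
have pE : pairing q_coords u = \sum_i q_coords 0 i * u 0 i by [].
have w0 : q_coords 0 0 = bisection (e 1) (e ord_max) by apply: q_coordsE; exact: val_inj.
have w1 : q_coords 0 1 = bisection (e ord_max) (e 0) by apply: q_coordsE; exact: val_inj.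
have w2 : q_coords 0 ord_max = bisection (e 0) (e 1) by apply: q_coordsE; exact: val_inj.
have -> : pairing q_coords u = bisection (e 1) (e ord_max) * u 0 0
    + bisection (e ord_max) (e 0) * u 0 1 + bisection (e 0) (e 1) * u 0 ord_max.
  rewrite -w0 -w1 -w2 /pairing big_ord_recl big_ord_recr big_ord1 /= addrA.
  by congr (_ + q_coords 0 _ * u 0 _ + q_coords 0 _ * u 0 _); exact: val_inj.
rewrite [(-1) ^+ a * _]mulrC -[RHS]mulrA; congr (_ * _).
have [[-> -> ->]|[-> -> ->]|[-> -> ->]] : [\/ [/\ a = 0, p = 1 & q = ord_max],
    [/\ a = 1, p = 0 & q = ord_max] | [/\ a = ord_max, p = 0 & q = 1]].
- rewrite {}/p {}/q; case: a => -[|[|[|//]]] ha; [apply: Or31|apply: Or32|apply: Or33];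
    by split; exact: val_inj.
- by rewrite expr0 mul1r addrAC ![_ * bisection _ _]mulrC.
- rewrite expr1 mulN1r (bisectionC (e 0) (e ord_max)) (bisectionC (e 1) (e 0)) (bisectionC
  (e ord_max) (e 1)).
  by rewrite !mulrN -!opprD ![_ * bisection _ _]mulrC; congr (- _); rewrite addrC addrA.
by rewrite -signr_odd expr0 mul1r ![_ * bisection _ _]mulrC addrC [X in _ + X]addrC addrA.
Qed.

End QSide.
End Sections.

(** * Projective bundle structures on the flag variety *)

Section Span.
Variables (K : closedFieldType) (V : vectType K).
Local Notation n := (\dim {:V}).
Local Notation Gr k := (grassmannian V k).

(** The point [U0] is a default value, taken when the rank of [A] is not [k]. *)
Definition gr_span k m (U0 : Gr k) (A : 'M[K]_(m, n)) : Gr k :=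
  insubd (U0 : gr_point V k) (row_space A).

Lemma gr_spanE k m (U0 : Gr k) (A : 'M[K]_(m, n)) : \rank A = k ->
  row_space A = val (gr_span U0 A).
Proof. by move=> rA; rewrite insubdK // -topredE /= dim_row_space rA. Qed.

Lemma gr_span_uniq k m (U0 U : Gr k) (A : 'M[K]_(m, n)) :
  row_space A = val U -> gr_span U0 A = U.
Proof. by move=> e; apply: val_inj; rewrite -(gr_spanE U0 (row_space_rank e)). Qed.

Lemma row_space_free_eq k m (A : 'M[K]_(k, n)) (B : 'M[K]_(m, n)) (U : Gr k) :
  row_free A -> (A <= B)%MS -> row_space B = val U -> row_space A = val U.
Proof.
move=> fA AB eB; rewrite -eB; apply/row_space_eq/eqmxP/andP; split=> //.
have := mxrank_leqif_sup AB; rewrite (eqP fA) (row_space_rank eB) => h.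
by rewrite -h.2.
Qed.

Definition incident k l : set (vproduct (Gr k) (Gr l)) :=
  [set y | (val y.1 <= val y.2)%VS].

Lemma incidentE k l (y : vproduct (Gr k) (Gr l)) p q (A : 'M[K]_(p, n)) (B : 'M[K]_(q, n)) :
  row_space A = val y.1 -> row_space B = val y.2 -> incident y <-> (A <= B)%MS.
Proof. by rewrite /incident /= => <- <-; rewrite row_space_sub. Qed.

(** In charts where the columns [g] of the frame B of W form the identity matrix, a
frame A of U lies in W exactly when A equals its columns [g] times B, a regular
equation. *)
Lemma vclosed_incident k l : vclosed (@incident k l).
Proof.
apply/vclosedP => y ny; have [f df] := gr_cover y.1; have [g dg] := gr_cover y.2.
pose D (z : vproduct (Gr k) (Gr l)) := gr_mat f z.1 - colsub g (gr_mat f z.1) *m gr_mat g z.2.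
have DP z : gr_dom f z.1 -> gr_dom g z.2 -> incident z <-> D z = 0.
  move=> df' dg'; have [_ eA] := gr_matP df'; have [gB eB] := gr_matP dg'.
  rewrite (incidentE eA eB); split=> [/submxP[C eC]|/eqP].
    by rewrite /D eC -mulmx_colsub gB mulmx1 subrr.
  by rewrite subr_eq0 => /eqP ->; exact: submxMl.
have rD : regular_mx_at setT y D.
  have rA : regular_mx_at setT y (fun z => gr_mat f z.1).
    exact: (regmx_comp (W' := setT) Logic.I (fun _ _ => Logic.I) (regmap_fst _ _)
      (regmx_gr_mat _ df)).
  have rB : regular_mx_at setT y (fun z => gr_mat g z.2).
    exact: (regmx_comp (W' := setT) Logic.I (fun _ _ => Logic.I) (regmap_snd _ _)
      (regmx_gr_mat _ dg)).
  by apply: regmxB => //; apply: regmxM => //; exact: regmx_mxsub.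
have [i [j Dij]] : exists i j, D y i j != 0.
  apply: contrapT => h; apply: ny; apply/(DP _ df dg)/matrixP => i j; rewrite [RHS]mxE.
  by apply/eqP/negPn/negP => Dij; apply: h; exists i, j.
have nf := near_comp (W' := setT) Logic.I (fun _ _ => Logic.I) (regmap_fst setT y) (near_dom
  (X := Gr k) (i := f) setT df).
have ng := near_comp (W' := setT) Logic.I (fun _ _ => Logic.I) (regmap_snd setT y) (near_dom
  (X := Gr l) (i := g) setT dg).
apply: near_mono (near_and (near_and nf ng) (reg_neq0 Logic.I (rD i j) Dij)).
move=> z _ [[/= df' dg'] Dz] /(DP _ df' dg') Dz0.
by move: Dz; rewrite Dz0 mxE eqxx.
Qed.

End Span.

Section SuperspaceBundle.
Variables (K : closedFieldType) (V : vectType K) (k m : nat).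
Local Notation n := (\dim {:V}).
Local Notation Gr k := (grassmannian V k).
Variables (f : {ffun 'I_k -> 'I_n}) (g : {ffun 'I_m -> 'I_n}) (W0 : Gr (k + 1)).
Hypothesis fg : complementary f g.

Let Y := vproduct (Gr k) (Gr (k + 1)).

(** The chart of W obtained from the chart [f] of U by adding the coordinate [g a];
the flags in it are those for which the vector of W that vanishes in the
coordinates [f] has a nonzero coordinate [g a]. *)
Definition extend_chart (a : 'I_m) : {ffun 'I_(k + 1) -> 'I_n} :=
  [ffun i : 'I_(k + 1) => match fintype.split i with inl j => f j | inr _ => g a end].

Definition super_dom (a : 'I_m) : set Y := [set y | gr_dom (extend_chart a) y.2].
(** The last vector of the normalized frame of W represents the line W/U in V/U. *)
Definition super_coord (a : 'I_m) (y : Y) : 'rV[K]_m :=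
  mxsub (fun=> rshift k ord0) g (gr_mat (extend_chart a) y.2).
Definition super_frame (U : Gr k) (u : 'rV[K]_m) : 'M[K]_(k + 1, n) :=
  col_mx (gr_mat f U) (u *m rowsub g 1%:M).
Definition super_point (U : Gr k) (u : 'rV[K]_m) : Y := (U, gr_span W0 (super_frame U u)).

Lemma colsub_extend p (A : 'M[K]_(p, n)) a :
  colsub (extend_chart a) A = row_mx (colsub f A) (colsub (fun _ : 'I_1 => g a) A).
Proof.
apply/matrixP => i j; rewrite mxE ffunE; case: (split_ordP j) => j' ->.
  by rewrite row_mxEl [RHS]mxE.
by rewrite row_mxEr [RHS]mxE.
Qed.

Lemma super_frame_colsub U u a : gr_dom f U ->
  colsub (extend_chart a) (super_frame U u) =
  block_mx 1%:M (colsub (fun _ => g a) (gr_mat f U)) 0 (u 0 a)%:M.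
Proof.
move=> dU; have [fM _] := gr_matP dU; have [fi gi _ _] := fg.
rewrite colsub_extend /super_frame block_mxEh; congr row_mx.
  apply/matrixP => i j; rewrite mxE; case: (split_ordP i) => i' ->.
    by rewrite !col_mxEu; have /matrixP/(_ i' j) := fM; rewrite mxE.
  rewrite !col_mxEd; have /matrixP/(_ i' j) := mul_colsub_rowsub u g f.
  by rewrite (mxsub1_disjointC _ fg) mulmx0 mxE => ->.
apply/matrixP => i j; rewrite mxE; case: (split_ordP i) => i' ->.
  by rewrite !col_mxEu !mxE.
rewrite !col_mxEd; have /matrixP/(_ i' a) := mul_colsub_rowsub u g g.
by rewrite (mxsub1_inj K gi) mulmx1 mxE => ->; rewrite !ord1 mxE eqxx.
Qed.

Lemma super_frame_unit U u a : gr_dom f U ->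
  (colsub (extend_chart a) (super_frame U u) \in unitmx) = (u 0 a != 0).
Proof.
by move=> dU; rewrite super_frame_colsub // unitmxE det_ublock det1 mul1r det_scalar1 unitfE.
Qed.

Lemma super_frame_free U u : gr_dom f U -> u != 0 -> row_free (super_frame U u).
Proof.
move=> dU u0; have [a ua] := exists_entry_neq0 u0.
have := super_frame_unit u a dU; rewrite ua => uc.
apply: inj_row_free => v vA; apply/eqP;
  rewrite -(mulmx_free_eq0 v (B := colsub (extend_chart a) (super_frame U u))).
  by rewrite mulmx_colsub vA; apply/eqP/matrixP => i j; rewrite !mxE.
by rewrite row_free_unit.
Qed.

Lemma super_pointE U u : gr_dom f U -> u != 0 ->
  row_space (super_frame U u) = val (super_point U u).2.
Proof. by move=> dU u0; apply: gr_spanE; apply/eqP; exact: super_frame_free. Qed.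

Lemma super_point_eq (y : Y) u q (B : 'M[K]_(q, n)) : gr_dom f y.1 -> incident y -> u != 0 ->
  row_space B = val y.2 -> (u *m rowsub g 1%:M <= B)%MS -> super_point y.1 u = y.
Proof.
move=> dU iy u0 eB uB; have [_ eA] := gr_matP dU.
rewrite /super_point; case: y dU iy eB eA => U W /= dU iy eB eA; congr (_, _).
apply: gr_span_uniq; apply: (row_space_free_eq (super_frame_free dU u0) _ eB).
by rewrite col_mx_sub uB andbT; apply/(incidentE (y := (U, W)) eA eB).
Qed.

Lemma super_coordE (y : Y) a : super_dom a y ->
  [/\ super_coord a y *m rowsub g 1%:M = row (rshift k ord0) (gr_mat (extend_chart a) y.2),
      super_coord a y 0 a = 1 &
      forall p (A : 'M[K]_(p, n)), row_space A = val y.2 ->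
        (super_coord a y *m rowsub g 1%:M <= A)%MS].
Proof.
move=> dW; have [B1 eB] := gr_matP dW; set B := gr_mat _ _ in B1 eB *.
have E : super_coord a y *m rowsub g 1%:M = row (rshift k ord0) B.
  rewrite [RHS](complementary_decomp fg) [X in X *m _ + _](_ : _ = 0).
    by rewrite mul0mx add0r; congr (_ *m _); apply/matrixP => i j; rewrite !mxE.
  apply/rowP => j; have /matrixP/(_ (rshift k ord0) (lshift 1 j)) := B1.
  rewrite colsub_extend row_mxEl !mxE => ->.
  by rewrite eq_rlshift.
split=> //.
  have /matrixP/(_ (rshift k ord0) (rshift k ord0)) := B1.
  by rewrite colsub_extend row_mxEr mxE [RHS]mxE eqxx => h; rewrite mxE h.
move=> p A eA; have /row_space_eq BA : row_space B = row_space A by rewrite eA eB.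
by rewrite E -BA row_sub.
Qed.

(** Over the chart [f] of Gr(k,V), the coordinates [g] identify V/U with a fixed
vector space, so the flags with first term in the chart form the product of the
chart with the projective space of that vector space. *)
Lemma trivial_superspace_bundle :
  @trivial_bundle K (Gr k) Y m (gr_dom f) (@incident _ V k (k + 1) `&` fst @^-1` gr_dom f) fst
    super_dom super_coord super_point.
Proof.
have [fi gi _ _] := fg.
split.
- by move=> y [_ dU]; split=> //; exact: regmap_fst.
- move=> y [iy dU]; have [fA eA] := gr_matP dU; have [B [fB eB]] := gr_basis y.2.
  (* reduce the frame of W modulo U: some row stays nonzero, for dimension reasons *)
  pose v := B - colsub f B *m gr_mat f y.1.
  have fv : colsub f v = 0 by rewrite linearB /= -mulmx_colsub fA mulmx1 subrr.
  have [i vi] : exists i, row i v != 0.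
    apply: exists_row_neq0; apply/eqP => /eqP; rewrite subr_eq0 => /eqP v0.
    have : (\rank B <= k)%N.
      by rewrite v0; exact: leq_trans (mxrankM_maxr _ _) (rank_leq_row _).
    by rewrite (eqP fB) addn1 ltnn.
  have vE : row i v = colsub g (row i v) *m rowsub g 1%:M.
    rewrite {1}(complementary_decomp fg (row i v)) [X in X *m _ + _](_ : _ = 0) ?mul0mx ?add0r //.
    by apply/matrixP => i' j; have /matrixP/(_ i j) := fv; rewrite !mxE.
  have u0 : colsub g (row i v) != 0 by apply: contraNneq vi => e; rewrite vE e mul0mx.
  have vB : (colsub g (row i v) *m rowsub g 1%:M <= B)%MS.
    rewrite -vE; apply: submx_trans (row_sub _ _) _.
    have AB := proj1 (incidentE eA eB) iy.
    by rewrite addmx_sub // eqmx_opp (submx_trans (submxMl _ _)).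
  have [a ua] := exists_entry_neq0 u0.
  exists a; rewrite -(super_point_eq dU iy u0 eB vB).
  apply/(gr_domP _ (super_pointE dU u0) (super_frame_free dU u0)).
  by rewrite super_frame_unit.
- move=> a y iy da; apply: (near_comp (W' := setT) iy (fun _ _ => Logic.I) (regmap_snd _ _)).
  exact: (near_dom (X := Gr (k + 1))).
- move=> a y iy da; apply: regmx_mxsub.
  exact: (regmx_comp (W' := setT) iy (fun _ _ => Logic.I) (regmap_snd _ _) (regmx_gr_mat _ da)).
- by move=> a y _ /super_coordE[].
- move=> a y [iy dU] /super_coordE[_ s1 sB]; have [B [fB eB]] := gr_basis y.2.
  apply: (super_point_eq dU iy _ eB (sB _ _ eB)).
  by apply: (@entry_neq0 _ _ _ a); rewrite s1 oner_eq0.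
- move=> U u dU u0; split=> //; split=> //; have [_ eA] := gr_matP dU.
  apply/(incidentE (y := super_point U u) eA (super_pointE dU u0)).
  by rewrite -addsmxE addsmxSl.
- move=> U u a dU u0; rewrite -(super_frame_unit u a dU).
  exact: gr_domP (super_pointE dU u0) (super_frame_free dU u0).
- move=> U u a dU ua; have u0 := entry_neq0 ua.
  have da : super_dom a (super_point U u).
    apply/(gr_domP _ (super_pointE dU u0) (super_frame_free dU u0)).
    by rewrite super_frame_unit.
  have [vE v1 vW] := super_coordE da; set v := super_coord _ _ in vE v1 vW *.
  have /submxP[D] := vW _ _ (super_pointE dU u0); rewrite -[D]hsubmxK mul_row_col => vD.
  have [fM _] := gr_matP dU.
  have d0 : lsubmx D = 0.
    have := congr1 (colsub f) vD.
    rewrite mul_colsub_rowsub (mxsub1_disjointC _ fg) mulmx0 linearD /= -mulmx_colsub fM.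
    by rewrite mulmx1 mulmxA mul_colsub_rowsub (mxsub1_disjointC _ fg) mulmx0 addr0.
  move: vD; rewrite d0 mul0mx add0r mulmxA => /(congr1 (colsub g)).
  rewrite !mul_colsub_rowsub (mxsub1_inj K gi) !mulmx1 [rsubmx D]mx11_scalar mul_scalar_mx => vD.
  rewrite vD; congr (_ *: _); apply: (mulIf ua); rewrite mulVf // -v1 vD mxE.
  by rewrite !mxE.
- move=> U u dU u0; apply: regmap_pair; first exact: regmap_fst.
  pose W : set (vproduct (Gr k) (affine_space K m)) := gr_dom f `*` @nonzero K m.
  have Wq : W (U, u) by [].
  apply: (@regmap_gr _ _ _ _ W _ _ (fun q => super_frame q.1 q.2) Wq).
    by apply: near_all => -[U' u'] [dU' u0'] /=; exact: super_pointE.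
  apply: regmx_col.
    exact: (@regmx_comp K _ (Gr k) W setT (U, u) fst _ _ (gr_mat f) Wq
      (fun _ _ => Logic.I) (regmap_fst _ _) (regmx_gr_mat _ dU)).
  apply: regmxM; last exact: regmxC.
  exact: (@regmx_comp K _ (affine_space K m) W setT (U, u) snd _ _ id Wq
    (fun _ _ => Logic.I) (regmap_snd _ _) (regmx_affine _ _)).
Qed.

End SuperspaceBundle.

Section SubspaceBundle.
Variables (K : closedFieldType) (V : vectType K) (k : nat).
Local Notation n := (\dim {:V}).
Local Notation Gr k := (grassmannian V k).
Variables (g : {ffun 'I_k.+1 -> 'I_n}) (U0 : Gr k).
Let Y := vproduct (Gr k) (Gr k.+1).

(** The chart of U obtained from the chart [g] of W by forgetting the coordinate
[g a]; it contains the hyperplanes of W whose equation has a nonzero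
a-th coefficient. *)
Definition omit_chart (a : 'I_k.+1) : {ffun 'I_k -> 'I_n} := [ffun j => g (lift a j)].
Definition sub_dom (a : 'I_k.+1) : set Y := [set y | gr_dom (omit_chart a) y.1].
(** The equation of U in W, read off from the echelon form of its normalized frame. *)
Definition sub_coord (a : 'I_k.+1) (y : Y) : 'rV[K]_k.+1 :=
  \row_i (if unlift a i is Some j then - gr_mat (omit_chart a) y.1 j (g a) else 1).
(** The subspace U of W with equation [u], where [gr_mat g W] provides coordinates
on W. *)
Definition sub_point (W : Gr k.+1) (u : 'rV[K]_k.+1) : Y :=
  (gr_span U0 (kermx u^T *m gr_mat g W), W).

Lemma colsub_omit p (A : 'M[K]_(p, n)) a : colsub (omit_chart a) A = colsub (lift a) (colsub g A).
Proof. by apply/matrixP => i j; rewrite !mxE ffunE. Qed.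

Lemma submx_chart (W : Gr k.+1) p (A : 'M[K]_(p, n)) : gr_dom g W ->
  (A <= gr_mat g W)%MS -> A = colsub g A *m gr_mat g W.
Proof.
by move=> dW /submxP[D ->]; have [gB _] := gr_matP dW; rewrite -mulmx_colsub gB mulmx1.
Qed.

Lemma sub_pointE (W : Gr k.+1) (C : 'M[K]_(k, k.+1)) u : gr_dom g W ->
  row_free C -> u != 0 -> C *m u^T = 0 ->
  row_space (C *m gr_mat g W) = val (sub_point W u).1.
Proof.
move=> dW fC u0 Cu; have eK := kermx_vector fC u0 Cu.
have e : (kermx u^T *m gr_mat g W :=: C *m gr_mat g W)%MS by exact: eqmxMr.
rewrite -gr_spanE; first by apply/row_space_eq/eqmx_sym.
by rewrite e mxrankMfree ?(eqP fC) //; exact: gr_mat_free.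
Qed.

Lemma sub_point_frame (W : Gr k.+1) (u : 'rV[K]_k.+1) a : gr_dom g W -> u 0 a != 0 ->
  row_space (kernel_basis a u *m gr_mat g W) = val (sub_point W u).1.
Proof.
move=> dW ua; apply: sub_pointE => //; [exact: kernel_basis_free|exact: entry_neq0 ua|].
exact: kernel_basis_mul.
Qed.

Lemma sub_dom_coords (W : Gr k.+1) (U : Gr k) a : gr_dom g W ->
  incident ((U, W) : vproduct (Gr k) (Gr k.+1)) -> gr_dom (omit_chart a) U ->
  let C := colsub g (gr_mat (omit_chart a) U) in
  [/\ gr_mat (omit_chart a) U = C *m gr_mat g W, colsub (lift a) C = 1%:M & row_free C].
Proof.
move=> dW iy dU C; have [A1 eA] := gr_matP dU; have [_ eB] := gr_matP dW.
have C1 : colsub (lift a) C = 1%:M by rewrite -colsub_omit.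
split=> //; first exact/(submx_chart dW)/(incidentE (y := (U, W)) eA eB).
by apply/row_freeP; exists (colsub (lift a) 1%:M); rewrite mulmx_colsub mulmx1.
Qed.

Lemma sub_coord_kernel (U : Gr k) (W : Gr k.+1) a :
  colsub (lift a) (colsub g (gr_mat (omit_chart a) U)) = 1%:M ->
  colsub g (gr_mat (omit_chart a) U) *m (sub_coord a (U, W))^T = 0.
Proof.
move=> C1; apply/matrixP => j i; rewrite ord1 (mulmx_trE _ _ _ a) [RHS]mxE.
rewrite [sub_coord _ _ _ a]mxE unlift_none mulr1 (bigD1 j) //= big1 => [|l lj]; last first.
  by have /matrixP/(_ j l) := C1; rewrite mxE [RHS]mxE eq_sym (negPf lj) => ->; rewrite mul0r.
have /matrixP/(_ j j) := C1; rewrite mxE [RHS]mxE eqxx => ->.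
by rewrite !mxE liftK mul1r addr0 subrr.
Qed.

Lemma sub_coord1 (y : Y) a : sub_coord a y 0 a = 1.
Proof. by rewrite mxE unlift_none. Qed.

Lemma sub_coord_neq0 (y : Y) a : sub_coord a y != 0.
Proof. by apply: (@entry_neq0 _ _ _ a); rewrite sub_coord1 oner_eq0. Qed.

Lemma sub_coordK (y : Y) a : gr_dom g y.2 -> incident y -> sub_dom a y ->
  sub_point y.2 (sub_coord a y) = y.
Proof.
case: y => U W /= dW iy dU; have [AE C1 fC] := sub_dom_coords dW iy dU.
have Cu := sub_coord_kernel W C1.
have [_ eA] := gr_matP dU.
congr (_, _); apply: val_inj.
rewrite -(sub_pointE dW fC (sub_coord_neq0 _ _) Cu) -AE.
exact: eA.
Qed.

Lemma sub_point_incident (W : Gr k.+1) u : gr_dom g W -> u != 0 -> incident (sub_point W u).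
Proof.
move=> dW u0; have [a ua] := exists_entry_neq0 u0; have [_ eB] := gr_matP dW.
by apply/(incidentE (y := sub_point W u) (sub_point_frame dW ua) eB); exact: submxMl.
Qed.

Lemma sub_point_coords (W : Gr k.+1) u a : gr_dom g W -> u != 0 -> sub_dom a (sub_point W u) ->
  forall j, u 0 (lift a j) = - gr_mat (omit_chart a) (sub_point W u).1 j (g a) * u 0 a.
Proof.
move=> dW u0 dU j.
have [AE C1 fC] := sub_dom_coords dW (sub_point_incident dW u0) dU.
set C := colsub g _ in AE C1 fC.
have Cu : C *m u^T = 0.
  have [b ub] := exists_entry_neq0 u0; have [_ eA] := gr_matP dU.
  have /row_space_eq e : row_space (C *m gr_mat g W) = row_space (kernel_basis b u *m gr_mat g W).
    by rewrite (sub_point_frame dW ub) -eA -AE.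
  have /submxP[D eD] : (C <= kernel_basis b u)%MS.
    by rewrite -(submxMfree _ _ (gr_mat_free dW)) e.
  by rewrite eD -mulmxA kernel_basis_mul mulmx0.
by rewrite (kernel_vector_coord C1 Cu) mxE.
Qed.

Lemma sub_point_dom (W : Gr k.+1) (u : 'rV[K]_k.+1) a : gr_dom g W -> u != 0 ->
  sub_dom a (sub_point W u) <-> u 0 a != 0.
Proof.
move=> dW u0; split=> [da|ua].
  apply/eqP => ua; case/eqP: (u0); apply/rowP => i; rewrite [RHS]mxE.
  by case: (unliftP a i) => [j ->|-> //]; rewrite (sub_point_coords dW u0 da) ua mulr0.
have eU := sub_point_frame dW ua; apply/(gr_domP _ eU (row_space_free eU)).
have [gB _] := gr_matP dW.
rewrite colsub_omit -mulmx_colsub gB mulmx1 kernel_basis_colsub.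
by rewrite unitmxE det_scalar unitfE expf_neq0.
Qed.

(** Over the chart [g] of Gr(k+1,V), the normalized frame gives coordinates on W, so
the hyperplanes of W are parametrized by their equations in a fixed dual space. *)
Lemma trivial_subspace_bundle :
  @trivial_bundle K (Gr k.+1) Y k.+1 (gr_dom g) (@incident _ V k k.+1 `&` snd @^-1` gr_dom g)
    snd sub_dom sub_coord sub_point.
Proof.
split.
- by move=> y [_ dW]; split=> //; exact: regmap_snd.
- move=> [U W] [iy /= dW]; have [gB eB] := gr_matP dW; have [A [fA eA]] := gr_basis U.
  have AE := submx_chart dW (proj1 (incidentE (y := (U, W)) eA eB) iy).
  set C := colsub g A in AE.
  have fC : row_free C.
    apply: inj_row_free => u uC; apply/eqP; rewrite -(mulmx_free_eq0 u fA).
    by rewrite AE mulmxA uC mul0mx.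
  have [u [ui Cu]] := exists_kernel_vector fC.
  have [a ua] := exists_entry_neq0 ui; exists a.
  have -> : (U, W) = sub_point W u.
    by congr (_, _); apply: val_inj; rewrite -(sub_pointE dW fC ui Cu) -AE.
  exact/sub_point_dom.
- move=> a y iy da; apply: (near_comp (W' := setT) iy (fun _ _ => Logic.I) (regmap_fst _ _)).
  exact: (near_dom (X := Gr k)).
- move=> a y iy da i j; rewrite ord1.
  have rM := regmx_comp (W' := setT) iy (fun _ _ => Logic.I) (regmap_fst _ _) (regmx_gr_mat _ da).
  case: (unliftP a j) => [b|] ->.
    apply: reg_near (regN (rM b (g a))); apply: near_all => z _ /=.
    by rewrite mxE liftK.
  by apply: reg_near (regC _ _ 1); apply: near_all => z _ /=; rewrite sub_coord1.
- by move=> a y _ _; exact: sub_coord1.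
- by move=> a y [iy dW] da; exact: sub_coordK.
- by move=> W u dW u0; split=> //; split=> //; exact: sub_point_incident.
- by move=> W u a dW u0; exact: sub_point_dom.
- move=> W u a dW ua; have u0 := entry_neq0 ua.
  have da := proj2 (sub_point_dom a dW u0) ua.
  apply/rowP => i; rewrite [RHS]mxE; case: (unliftP a i) => [j|] ->.
    by rewrite mxE liftK (sub_point_coords dW u0 da j) mulrC mulfK.
  by rewrite sub_coord1 mulVf.
- move=> W u dW u0; have [a ua] := exists_entry_neq0 u0.
  pose S : set (vproduct (Gr k.+1) (affine_space K k.+1)) := gr_dom g `*` @nonzero K k.+1.
  have Sq : S (W, u) by [].
  have ru : regular_mx_at S (W, u) (fun q => q.2 : 'rV[K]_k.+1).
    exact: (@regmx_comp K _ (affine_space K k.+1) S setT (W, u) snd _ _ id Sq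
      (fun _ _ => Logic.I) (regmap_snd _ _) (regmx_affine _ _)).
  apply: regmap_pair; last exact: regmap_fst.
  apply: (@regmap_gr _ _ _ _ S _ _ (fun q => kernel_basis a
    (q.2 : 'rV[K]_k.+1) *m gr_mat g q.1) Sq).
    apply: near_mono (reg_neq0 Sq (ru 0 a) ua) => -[W' u'] [/= dW' _] ua'.
    exact: sub_point_frame.
  apply: regmxM; last first.
    exact: (@regmx_comp K _ (Gr k.+1) S setT (W, u) fst _ _ (gr_mat g) Sq
      (fun _ _ => Logic.I) (regmap_fst _ _) (regmx_gr_mat _ dW)).
  move=> i j; under eq_fun do rewrite mxE.
  apply: regD; first by apply: regM; [exact: ru|exact: regC].
  by apply: regN; apply: regM; [exact: ru|exact: regC].
Qed.

End SubspaceBundle.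

(** * The vanishing locus of a section *)

Section SectionLocus.
Variables (K : closedFieldType) (V : vectType K) (s : section11 V).
Local Notation n := (\dim {:V}).
Local Notation Gr k := (grassmannian V k).
Local Notation L := (lefschetz K).
Local Notation Y := (vproduct (Gr 2) (Gr 3)).

Definition section_locus : set Y :=
  [set y | incident y /\ forall (A : 'M_(2, n)) (B : 'M_(3, n)),
     row_space A = val y.1 -> row_space B = val y.2 -> s (A, B) = 0].

(** By equivariance, vanishing can be tested on a single pair of frames. *)
Lemma section_locusP (y : Y) (A : 'M_(2, n)) (B : 'M_(3, n)) : incident y ->
  row_space A = val y.1 -> row_space B = val y.2 -> section_locus y <-> s (A, B) = 0.
Proof.
move=> iy eA eB; split=> [[_]|s0]; first exact.
split=> // A' B' eA' eB'.
have [g ug ->] : exists2 g, g \in unitmx & A' = g *m A.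
  by apply: row_space_eq_free; [exact: row_space_free eA'|rewrite eA].
have [h uh ->] : exists2 h, h \in unitmx & B' = h *m B.
  by apply: row_space_eq_free; [exact: row_space_free eB'|rewrite eB].
by rewrite section_equivariant // s0 mulr0.
Qed.

Lemma vclosed_section_locus : vclosed section_locus.
Proof.
apply/vclosedP => y nD; case: (pselect (incident y)) => iy; last first.
  have := proj1 (vclosedP _) (@vclosed_incident K V 2 3) y iy.
  by apply: near_mono => z _ nz [].
have [f df] := gr_cover y.1; have [g dg] := gr_cover y.2.
pose W : set Y := @incident K V 2 3.
have nf : near_in W y (fun z => gr_dom f z.1).
  exact: (near_comp (W' := setT) iy (fun _ _ => Logic.I) (regmap_fst _ _) (near_dom
    (X := Gr 2) setT df)).
have ng : near_in W y (fun z => gr_dom g z.2).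
  exact: (near_comp (W' := setT) iy (fun _ _ => Logic.I) (regmap_snd _ _) (near_dom
    (X := Gr 3) setT dg)).
have [_ eA] := gr_matP df; have [_ eB] := gr_matP dg.
have sy : s (gr_mat f y.1, gr_mat g y.2) != 0.
  by apply/eqP => s0; apply: nD; apply/(section_locusP iy eA eB).
have rs : regular_at W y (fun z => s (gr_mat f z.1, gr_mat g z.2)).
  apply: reg_section => //.
  - exact: (@regmx_comp K _ (Gr 2) W setT y fst _ _ (gr_mat f) iy (fun _ _ => Logic.I)
    (regmap_fst _ _) (regmx_gr_mat _ df)).
  - exact: (@regmx_comp K _ (Gr 3) W setT y snd _ _ (gr_mat g) iy (fun _ _ => Logic.I)
    (regmap_snd _ _) (regmx_gr_mat _ dg)).
  apply: near_mono (near_and nf ng) => z iz [/= df' dg'].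
  have [_ eA'] := gr_matP df'; have [_ eB'] := gr_matP dg'.
  by split=> /=; [exact: gr_mat_free|exact: gr_mat_free|rewrite eA' eB'].
apply: near_mono (near_imp (near_and (near_and nf ng) (reg_neq0 iy rs sy))) => z _ h [iz sz].
have [[/= df' dg'] /eqP] := h iz; apply; apply: sz.
  by have [] := gr_matP df'.
by have [] := gr_matP dg'.
Qed.

(** The fibre over U is cut out in P(V/U) by the linear form [p_push s] of a frame of
U, and U lies in the zero locus of p_* s when this form is zero. *)
Lemma K0_section_locus_p m : (2 + m.+1 = n)%N ->
  K0_locus section_locus =
  (K0_class (Gr 2) * projective_class K m + K0_class (p_zero_variety s) * L ^+ m)%K0.
Proof.
move=> nm.
have [W0] : inhabited (Gr (2 + 1)) by apply: gr_inhabited; rewrite -nm leq_add2l.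
pose J := {i : {ffun 'I_2 -> 'I_n} * {ffun 'I_m.+1 -> 'I_n} | `[< complementary i.1 i.2 >]}.
pose O (i : J) : set (Gr 2) := gr_dom (val i).1.
rewrite -(K0_locusE (vclosed_locally_closed (p_zero_locus_closed s))).
apply: (@K0_hyperplane_fibration K (Gr 2) Y fst m (@incident K V 2 3) section_locus _ J O).
- by move=> y; exact: regmap_fst.
- exact: vclosed_locally_closed (@vclosed_incident K V 2 3).
- exact: vclosed_locally_closed vclosed_section_locus.
- by move=> y [].
- exact: p_zero_locus_closed.
- by move=> i; exact: gr_dom_vopen.
- move=> U; have [f df] := gr_cover U.
  have [g fg] := exists_complementary (gr_dom_inj df) nm.
  by have /asboolP c := fg; exists (exist _ (f, g) c).
move=> [[f g] cfg]; have fg : complementary f g by exact/asboolP.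
rewrite /O /=.
pose phi (U : Gr 2) : 'rV[K]_m.+1 :=
  \row_j p_push s (gr_mat f U) (row j (rowsub g 1%:M)).
have phiE (U : Gr 2) u : gr_dom f U ->
    p_push s (gr_mat f U) (u *m rowsub g 1%:M) = pairing (phi U) u.
  move=> dU; rewrite p_push_sum; last exact: gr_mat_free.
  by apply: eq_bigr => j _; rewrite mxE.
exists phi; split.
- move=> U dU i j; rewrite ord1.
  have : regular_at (gr_dom f : set (Gr 2)) U (fun U => s (gr_mat f U, super_frame f g U
    (delta_mx 0 j))).
    apply: reg_section => //; first exact: regmx_gr_mat.
      by apply: (@regmx_col _ _ _ _ 2 1); [exact: regmx_gr_mat|exact: regmxC].
    apply: near_all => U' dU'; apply: flag_frame_col.
    apply: (super_frame_free fg dU'); apply/eqP => /matrixP/(_ 0 j)/eqP.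
    by rewrite !mxE !eqxx oner_eq0.
  by apply: reg_near; apply: near_all => U' _ /=; rewrite mxE /p_push rowE.
- move=> U dU; have [fM eM] := gr_matP dU; have fA := gr_mat_free dU; split=> [XU|phi0].
    by apply/rowP => j; rewrite !mxE; exact: XU.
  move=> A fA' eA v; have [h uh ->] : exists2 h, h \in unitmx & A = h *m gr_mat f U.
    by apply: row_space_eq_free; rewrite // eM.
  rewrite p_push_mull //; apply/eqP; rewrite mulf_eq0; apply/orP; right; apply/eqP.
  pose v' := v - colsub f v *m gr_mat f U.
  have fv' : colsub f v' = 0 by rewrite linearB /= -mulmx_colsub fM mulmx1 subrr.
  have -> : v = colsub f v *m gr_mat f U + colsub g v' *m rowsub g 1%:M.
    have := complementary_decomp fg v'; rewrite fv' mul0mx add0r => <-.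
    by rewrite addrC subrK.
  by rewrite p_pushD // p_push_sub0 ?submxMl // add0r phiE // phi0 pairing0.
- exists (super_dom f g), (super_coord f g), (super_point f g W0).
  have tb := trivial_superspace_bundle W0 fg; split=> // a y iy dU Oy.
  have [_ eA] := gr_matP dU.
  have eB := super_pointE W0 fg dU (tb_norm_neq0 tb (conj iy dU) Oy).
  rewrite (tb_normK tb (conj iy dU) Oy) in eB.
  by rewrite (section_locusP iy eA eB) -phiE.
Qed.

(** The value at a hyperplane of W, in any basis of this hyperplane. *)
Lemma section_kernel (B : 'M[K]_(3, n)) (C : 'M_(2, 3)) (u : 'rV[K]_3) :
  row_free B -> row_free C -> u != 0 -> C *m u^T = 0 ->
  s (C *m B, B) = 0 <-> pairing (q_coords s B) u = 0.
Proof.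
move=> fB fC u0 Cu; have [a ua] := exists_entry_neq0 u0.
have /submxP[D eD] : (C <= kernel_basis a u)%MS.
  rewrite -(kermx_vector (kernel_basis_free ua) u0 (kernel_basis_mul u a)).
  exact/sub_kermxP.
have uD : D \in unitmx.
  rewrite -row_free_unit; apply: inj_row_free => v vD; apply/eqP.
  by rewrite -(mulmx_free_eq0 v fC) eD mulmxA vD mul0mx.
rewrite eD bisection_mul // section_kernel_basis //; split=> [/eqP|->]; last by rewrite !mulr0.
rewrite !mulf_eq0 signr_eq0 (negPf ua) /=; move: uD; rewrite unitmxE unitfE => /negPf ->.
by move/eqP.
Qed.

Lemma q_coords0_section (B : 'M[K]_(3, n)) (C : 'M_(2, 3)) :
  row_free B -> q_coords s B = 0 -> s (C *m B, B) = 0.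
Proof.
move=> fB q0; case: (boolP (row_free C)) => fC; last first.
  apply: section_nonfree; apply: contra fC => fCB; apply: inj_row_free => v vC.
  by apply/eqP; rewrite -(mulmx_free_eq0 v fCB) mulmxA vC mul0mx.
have [u [u0 Cu]] := exists_kernel_vector fC.
by apply/(section_kernel fB fC u0 Cu); rewrite q0 pairing0.
Qed.

(** That q_* s vanishes at W does not depend on the basis of W: if it does in one
basis, then [s] vanishes on all flags over W. *)
Lemma q_coords_eq0 (B : 'M[K]_(3, n)) (h : 'M_3) : row_free B -> h \in unitmx ->
  q_coords s B = 0 -> q_coords s (h *m B) = 0.
Proof.
move=> fB uh q0; apply/rowP => i; rewrite mxE [RHS]mxE -mul_rowsub_mx.
rewrite -[rowsub _ h *m B]mul1mx section_equivariant ?unitmx1 //.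
by rewrite q_coords0_section // mulr0.
Qed.

(** The fibre over W is cut out in P(W^vee) by the linear form [q_coords], which is
zero when W lies in the zero locus of q_* s. *)
Lemma K0_section_locus_q : (2 <= n)%N -> K0_locus section_locus =
  (K0_class (Gr 3) * projective_class K 2 + K0_class (q_zero_variety s) * L ^+ 2)%K0.
Proof.
move=> /gr_inhabited[U0]; pose O (g : {ffun 'I_3 -> 'I_n}) : set (Gr 3) := gr_dom g.
rewrite -(K0_locusE (vclosed_locally_closed (q_zero_locus_closed s))).
apply: (@K0_hyperplane_fibration K (Gr 3) Y snd 2 (@incident K V 2 3) section_locus _ _ O).
- by move=> y; exact: regmap_snd.
- exact: vclosed_locally_closed (@vclosed_incident K V 2 3).
- exact: vclosed_locally_closed vclosed_section_locus.
- by move=> y [].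
- exact: q_zero_locus_closed.
- by move=> i; exact: gr_dom_vopen.
- by move=> W; exact: gr_cover.
move=> g; rewrite /O.
exists (fun W => q_coords s (gr_mat g W)); split.
- move=> W dW i j; rewrite ord1; under eq_fun do rewrite mxE.
  apply: reg_section => //; [apply: regmx_mxsub| |]; try exact: regmx_gr_mat.
  apply: near_all => W' dW'; split=> /=; last by rewrite row_space_sub rowsub_sub.
    have fD := gr_mat_free dW'; apply: inj_row_free => v.
    rewrite -[gr_mat g W']mul1mx -mul_rowsub_mx mulmxA => /eqP.
    rewrite mulmx_free_eq0 // => /eqP/(congr1 (mulmx^~ (colsub
      (fun k : 'I_2 => j + lift ord0 k) 1%:M))).
    rewrite mul0mx -mulmxA mulmx_colsub mulmx1.
    rewrite (_ : colsub _ _ = 1%:M) ?mulmx1 //; apply/matrixP => a b.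
    by rewrite !mxE (inj_eq (addrI _)) (inj_eq lift_inj).
  exact: gr_mat_free.
- move=> W dW; have [_ eB] := gr_matP dW; have fB := gr_mat_free dW; split=> [YW|q0].
    by apply/(q_push_eq0 s fB); exact: YW.
  move=> B fB' eB'; have [h uh ->] : exists2 h, h \in unitmx & B = h *m gr_mat g W.
    by apply: row_space_eq_free; rewrite // eB.
  by rewrite q_pushE q_coords_eq0 // mul0mx.
- exists (sub_dom g), (sub_coord g), (sub_point g U0).
  have tb := trivial_subspace_bundle g U0; split=> // a y iy dW Oy.
  have [_ eB] := gr_matP dW; have fB := gr_mat_free dW.
  have ua : sub_coord g a y 0 a != 0 by rewrite sub_coord1 oner_eq0.
  have eA := sub_point_frame U0 dW ua.
  rewrite (tb_normK tb (conj iy dW) Oy) in eA.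
  rewrite (section_locusP iy eA eB).
  apply: section_kernel fB (kernel_basis_free ua) _ (kernel_basis_mul _ _).
  exact: sub_coord_neq0.
Qed.

End SectionLocus.

Theorem theorem4p1 (R : realType) (V5 : vectType R[i]) (dimV5 : \dim {:V5} = 5%N) :
  generic (fun s : section11 V5 =>
    ((K0_class (p_zero_variety s) - K0_class (q_zero_variety s))
      * lefschetz R[i] ^+ 2 = 0)%K0).
Proof.
(* every section satisfies the relation, so the open set is the whole space *)
exists setT; split; [|by exists 0|].
  move=> s _; exists 0%N, (fun i : 'I_0 => False_rect _ (notF (ltn_ord i))), 1; split=> //.
  by rewrite meval1 oner_eq0.
move=> s _.
have p := @K0_section_locus_p _ _ s 2; have q := @K0_section_locus_q _ _ s.
rewrite dimV5 in p q; rewrite (p erefl) (@grassmannian_dual _ V5 2 3) ?dimV5 // in q.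
exact: K0_cancel (q isT).
Qed.
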